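(* Let $\phi:\mathbb{D}\to\mathbb{R}_+$ be a weight on the unit disk $\mathbb{D}$, let $\Lambda\subset\mathbb{D}$ be a discrete sequence and let $n\ge1$ be an integer. Then the identity $\mathcal{R}_\Lambda(A_\phi)=X^{n-1}_\phi(\Lambda)$ holds if and only if $\Lambda$ is the union of $n$ interpolating sequences for $A_\phi$.
   Context: $\mathbb{R}_+=[0,\infty)$, $\mathbb{D}=\{z\in\mathbb{C}:|z|<1\}$, and the pseudo-hyperbolic distance is $\rho(z,\zeta)=\left|\frac{z-\zeta}{1-\bar\zeta z}\right|$ for $z,\zeta\in\mathbb{D}$. A function $\phi:\mathbb{D}\to\mathbb{R}_+$ is a weight if (wd1) there is a constant $K>0$ such that $\phi(z)\ge K\ln\bigl(\frac{1}{1-|z|}\bigr)$ for all $z\in\mathbb{D}$; and (wd2) there are constants $c\in(0,1)$, $D_0>0$ and $E_0>0$ such that whenever $\rho(z,\zeta)\le c$ one has $\phi(z)\le D_0\,\phi(\zeta)+E_0$. $A_\phi$ is the algebra of all holomorphic functions $f$ on $\mathbb{D}$ such that $\sup_{z\in\mathbb{D}}|f(z)|e^{-B\phi(z)}<\infty$ for some $B>0$. A discrete sequence $\Lambda\subset\mathbb{D}$ is a set of points with no accumulation points in $\mathbb{D}$. $A_\phi(\Lambda)$ is the space of families $\{\omega(\lambda)\}_{\lambda\in\Lambda}$ of complex numbers for which there are $A,B>0$ with $|\omega(\lambda)|\le Ae^{B\phi(\lambda)}$ for all $\lambda\in\Lambda$. The restriction operator is $\mathcal{R}_\Lambda:A_\phi\to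 A_\phi(\Lambda)$, $f\mapsto\{f(\lambda)\}_{\lambda\in\Lambda}$. $\Lambda$ is an interpolating sequence for $A_\phi$ if $\mathcal{R}_\Lambda(A_\phi)=A_\phi(\Lambda)$. For a function $\omega$ on $\Lambda$ and pairwise distinct points of $\Lambda$, the Euclidean divided differences are $\Delta^0\omega(\lambda_1)=\omega(\lambda_1)$ and, for $j\ge1$, $\Delta^j\omega(\lambda_1,\ldots,\lambda_{j+1})=\dfrac{\Delta^{j-1}\omega(\lambda_2,\ldots,\lambda_{j+1})-\Delta^{j-1}\omega(\lambda_1,\ldots,\lambda_j)}{\lambda_{j+1}-\lambda_1}$. The hyperbolic divided differences are $\delta^0\omega(\lambda_1)=\omega(\lambda_1)$ and, for $j\ge1$, $$\delta^j\omega(\lambda_1,\ldots,\lambda_{j+1})=\frac{\Delta^{j-1}\omega(\lambda_2,\ldots,\lambda_{j+1})-\Delta^{j-1}\omega(\lambda_1,\ldots,\lambda_j)}{\dfrac{\lambda_{j+1}-\lambda_1}{1-\bar\lambda_1\lambda_{j+1}}}.$$ For $n\ge1$, $\Lambda^n$ is the set of $n$-tuples of pairwise distinct points of $\Lambda$, and $X^{n-1}_\phi(\Lambda)$ is the set of functions $\omega$ on $\Lambda$ such that for some $B>0$ $$\sup_{(\lambda_1,\ldots,\lambda_n)\in\Lambda^n}|\delta^{n-1}\omega(\lambda_1,\ldots,\lambda_n)|\,e^{-B[\phi(\lambda_1)+\cdots+\phi(\lambda_n)]}<+\infty.$$ *)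

(* Defs.v *)
(* Stdlib reals and Coquelicot complex numbers.

   Functions defined on the disk, or on a subset of it, are represented by total
   functions on C whose values elsewhere are never inspected.  Subsets of C are
   predicates [C -> Prop].  A tuple (l_1, ..., l_{j+1}) is a function
   [p : nat -> C] with [p i] = l_{i+1}; only [p 0], ..., [p j] matter. *)
From Stdlib Require Import Reals.
From Coquelicot Require Import Coquelicot.

Open Scope R_scope.

Definition disk (z : C) : Prop := Cmod z < 1.

Definition rho (z w : C) : R := Cmod ((z - w) / (1 - Cconj w * z))%C.

Definition weight (phi : C -> R) : Prop :=
  (forall z, disk z -> 0 <= phi z) /\
  (exists K, 0 < K /\
     forall z, disk z -> K * ln (1 / (1 - Cmod z)) <= phi z) /\
  (exists c D0 E0, 0 < c < 1 /\ 0 < D0 /\ 0 < E0 /\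
     forall z w, disk z -> disk w -> rho z w <= c ->
       phi z <= D0 * phi w + E0).

(* Complex differentiability: the scalar field is C, not R. *)
Definition holomorphic_on_disk (f : C -> C) : Prop :=
  forall z, disk z -> @ex_derive C_AbsRing C_NormedModule f z.

Definition A_fun (phi : C -> R) (f : C -> C) : Prop :=
  holomorphic_on_disk f /\
  exists B, 0 < B /\
    exists M, forall z, disk z -> Cmod (f z) * exp (- B * phi z) <= M.

Definition accumulation_point (L : C -> Prop) (z : C) : Prop :=
  forall eps, 0 < eps -> exists l, L l /\ l <> z /\ Cmod (l - z)%C < eps.

Definition discrete_sequence (L : C -> Prop) : Prop :=
  (forall l, L l -> disk l) /\
  (forall z, disk z -> ~ accumulation_point L z).

Definition A_seq (phi : C -> R) (L : C -> Prop) (w : C -> C) : Prop :=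
  exists A B, 0 < A /\ 0 < B /\
    forall l, L l -> Cmod (w l) <= A * exp (B * phi l).

(* [w], as a function on [L], lies in the range of the restriction operator. *)
Definition trace (phi : C -> R) (L : C -> Prop) (w : C -> C) : Prop :=
  exists f, A_fun phi f /\ forall l, L l -> f l = w l.

Definition interpolating_sequence (phi : C -> R) (L : C -> Prop) : Prop :=
  discrete_sequence L /\ forall w, trace phi L w <-> A_seq phi L w.

Fixpoint Delta (j : nat) (w : C -> C) (p : nat -> C) : C :=
  match j with
  | O => w (p O)
  | S k => ((Delta k w (fun i => p (S i)) - Delta k w p) / (p (S k) - p O))%C
  end.

(* The numerator is the Euclidean one; only the last step is hyperbolic. *)
Definition delta (j : nat) (w : C -> C) (p : nat -> C) : C :=
  match j with
  | O => w (p O)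
  | S k => ((Delta k w (fun i => p (S i)) - Delta k w p) /
            ((p (S k) - p O) / (1 - Cconj (p O) * p (S k))))%C
  end.

Definition distinct_tuple (L : C -> Prop) (n : nat) (p : nat -> C) : Prop :=
  (forall i, (i < n)%nat -> L (p i)) /\
  (forall i j, (i < n)%nat -> (j < n)%nat -> i <> j -> p i <> p j).

(* [sum_f_R0 g j] is g 0 + ... + g j. *)
Definition X_space (phi : C -> R) (L : C -> Prop) (j : nat) (w : C -> C) : Prop :=
  exists B, 0 < B /\
    exists M, forall p, distinct_tuple L (S j) p ->
      Cmod (delta j w p) * exp (- B * sum_f_R0 (fun i => phi (p i)) j) <= M.

(* The pieces may overlap and may be empty. *)
Definition union_of_interpolating (phi : C -> R) (L : C -> Prop) (n : nat) : Prop :=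
  exists G : nat -> C -> Prop,
    (forall i, (i < n)%nat -> interpolating_sequence phi (G i)) /\
    (forall z, L z <-> exists i, (i < n)%nat /\ G i z).

(* Main.v *)
(* Since [1 - |z| >= exp (- kappa * phi z)], hyperbolic and Euclidean
   differences are interchangeable.  Dividing a function vanishing at [a] by
   [z - a] costs a factor [exp (kappa * phi a)]; iterating
   [(f z - f a) / (z - a)] shows that traces have bounded divided differences.
   If [X^j(L)] consists of traces, the open mapping argument gives
   interpolation with constants uniform over [|w| <= exp (T phi)],
   [|Delta^j w| <= exp (T (phi(l_1) + ... + phi(l_(j+1))))].

   Union => equality: by induction on the number of pieces one may assume that
   [w] vanishes on all pieces but the last.  For [mu] in the last piece,
   [|w mu|] is at most the product of the distances from [mu] to the other
   pieces.  If [h l = d / (l - mu)] on a piece at distance about [d] from [mu],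
   then [d - (z - mu) h z] vanishes on that piece and equals [d] at [mu].  The
   products of these functions with [g_mu], which vanishes at the other points
   of the last piece, are summed over [mu]: normalising [g_mu] by
   [exp (- T phi mu)] makes the sum converge, because the pieces are separated.

   Equality => union: give [w] at a single point [mu] half of the (nearly)
   smallest product of at most [n - 1] distances to other points of [L].  The
   difference of order [n] of its extension shows that a disk of radius
   [exp (- Q (phi mu + 1))] about [mu] holds at most [n] points of [L].  A greedy
   colouring then splits [L] into [n] separated classes.  Dividing the extension
   by [z - x] for the neighbours [x] of [mu], all of other colours, gives
   functions vanishing on the rest of the class of [mu]; these are summed as
   before. *)
Require Import Defs.
From Stdlib Require Import Reals.
From Coquelicot Require Import Coquelicot.
From Stdlib Require Import Lra Lia Classical ClassicalEpsilon List Cantor Wf_nat.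
(* [Reals] also exports a constant [Delta]. *)
Require Import Defs.
Import ListNotations.

(** The complex analysis rests on one Taylor expansion of order two with a cubic remainder, derived
    from Cauchy's formula on circles; it serves both for termwise differentiation of series and for
    division by a linear factor. On the disk of centre [a] and radius c (1 - |a|) the weight is
    comparable to [phi a], which turns Cauchy estimates into bounds in terms of [phi a].

    The obstacle in both directions is uniformity. The hypotheses extend each single function with
    constants of its own, whereas a solution is a sum over infinitely many points [mu] of functions
    built at [mu]. Hence Baire's argument, applied to a ball of data and to the countably many
    classes with integer constant and exponent; hence also the order of quantifiers in the lemmas,
    where constants are fixed before the function and the point. Separation enters through an
    injective numbering of the points whose values grow at most like exp (q phi).

    Products of distances are minimised only up to a factor 2, because points near the unit circle
    may keep the infimum from being attained; every estimate tolerates this factor. *)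

Lemma functional_choice {A B : Type} (P : A -> B -> Prop) :
  (forall x, exists y, P x y) -> exists f, forall x, P x (f x).
Proof.
  intros H. exists (fun x => proj1_sig (constructive_indefinite_description _ (H x))).
  intros x. apply proj2_sig.
Qed.

(** The division-free, non-strict form needs no exception at [w = z] and keeps the later estimates
    free of filters and normed modules. *)
Definition cderiv (f : C -> C) (z l : C) : Prop :=
  forall eps, 0 < eps -> exists d, 0 < d /\ forall w, Cmod (w - z)%C < d ->
    Cmod (f w - f z - l * (w - z))%C <= eps * Cmod (w - z)%C.

Lemma cderiv_is_derive (f : C -> C) (z l : C) :
  @is_derive C_AbsRing C_NormedModule f z l <-> cderiv f z l.
Proof.
  assert (E1 : forall x : C, @norm _ C_NormedModule x = Cmod x)
    by reflexivity.
  assert (E2 : forall x : C, @norm _ (AbsRing_NormedModule C_AbsRing) x = Cmod x) by reflexivity.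
  assert (E3 : forall w x : C, minus (minus (f w) (f x)) (scal (minus w x) l) = (f w - f x - l * (w - x))%C).
  { intros w x. unfold minus, plus, opp, scal; simpl; unfold mult; simpl. ring. }
  split.
  - intros [_ H] eps Heps.
    destruct (H z (fun P HP => HP) (mkposreal eps Heps)) as [d Hd].
    exists d; split; [apply cond_pos|].
    intros w Hw. specialize (Hd w Hw).
    rewrite <- E3, <- E1, <- E2. exact Hd.
  - intros H. split.
    + apply is_linear_scal_l.
    + intros x Hx eps.
      assert (Hzx : z = x) by exact (@is_filter_lim_locally_unique C_AbsRing (AbsRing_NormedModule C_AbsRing) z x Hx).
      subst x.
      destruct (H eps (cond_pos eps)) as [d [Hd0 Hd]].
      exists (mkposreal d Hd0). intros w Hw. specialize (Hd w Hw).
      rewrite <- E3, <- E1, <- E2 in Hd. exact Hd.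
Qed.

Lemma holomorphic_cderiv (f : C -> C) :
  holomorphic_on_disk f <-> (forall z, disk z -> exists l, cderiv f z l).
Proof.
  split; intros H z Hz; destruct (H z Hz) as [l Hl]; exists l; apply cderiv_is_derive; exact Hl.
Qed.

Lemma Cmod_le_components (z : C) : Cmod z <= Rabs (Re z) + Rabs (Im z).
Proof.
  destruct z as [x y]. unfold Cmod, Re, Im; simpl fst; simpl snd.
  rewrite <- (sqrt_pow2 (Rabs x + Rabs y)).
  - apply sqrt_le_1_alt. rewrite <- (pow2_abs x), <- (pow2_abs y).
    pose proof (Rabs_pos x); pose proof (Rabs_pos y). nra.
  - pose proof (Rabs_pos x); pose proof (Rabs_pos y). lra.
Qed.

Lemma im_le_Cmod (z : C) : Rabs (Im z) <= Cmod z.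
Proof. eapply Rle_trans; [apply Rmax_r | apply (Rmax_Cmod z)]. Qed.

Lemma Cmod_sub_ge (x y : C) : Cmod x - Cmod y <= Cmod (x - y)%C.
Proof.
  pose proof (Cmod_triangle (x - y) y). replace (x - y + y)%C with x in H by ring. lra.
Qed.

Lemma Cmod_sub_le (x y : C) : Cmod (x - y)%C <= Cmod x + Cmod y.
Proof.
  unfold Cminus. rewrite <- (Cmod_opp y). apply Cmod_triangle.
Qed.

Lemma Cmod_diag (x : C) : Cmod (x - x)%C = 0.
Proof. unfold Cminus. rewrite Cplus_opp_r. apply Cmod_0. Qed.

Lemma Cmod_sub_sym (x y : C) : Cmod (x - y)%C = Cmod (y - x)%C.
Proof. rewrite <- Cmod_opp. f_equal. ring. Qed.

Lemma Rinv_nonneg x : 0 < x -> 0 <= / x.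
Proof. intros H. apply Rlt_le, Rinv_0_lt_compat, H. Qed.

Lemma Rlt_Rmin x a b : x < Rmin a b -> x < a /\ x < b.
Proof. intros H. split; eapply Rlt_le_trans; try exact H; [apply Rmin_l|apply Rmin_r]. Qed.

(** * Continuity and integration of complex-valued functions on a real interval *)

Definition rcont (g : R -> C) (t : R) : Prop :=
  continuous (fun x => Re (g x)) t /\ continuous (fun x => Im (g x)) t.

Lemma rcont_eps (g : R -> C) (t : R) :
  rcont g t <-> (forall eps, 0 < eps -> exists d, 0 < d /\
    forall x, Rabs (x - t) < d -> Cmod (g x - g t)%C < eps).
Proof.
  split.
  - intros [H1 H2] eps He.
    assert (He2 : 0 < eps / 2) by lra.
    destruct (proj1 (filterlim_locally _ _) H1 (mkposreal _ He2)) as [d1 Hd1].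
    destruct (proj1 (filterlim_locally _ _) H2 (mkposreal _ He2)) as [d2 Hd2].
    exists (Rmin d1 d2). split; [apply Rmin_pos; apply cond_pos|].
    intros x Hx.
    eapply Rle_lt_trans; [apply Cmod_le_components|].
    specialize (Hd1 x (Rlt_le_trans _ _ _ Hx (Rmin_l _ _))).
    specialize (Hd2 x (Rlt_le_trans _ _ _ Hx (Rmin_r _ _))).
    unfold ball in Hd1, Hd2; simpl in Hd1, Hd2; unfold AbsRing_ball, abs, minus, plus, opp in Hd1, Hd2; simpl in Hd1, Hd2.
    unfold Re, Im in *; simpl. unfold Rminus in *. lra.
  - intros H; split; apply filterlim_locally; intros eps;
    destruct (H eps (cond_pos eps)) as [d [Hd0 Hd]]; exists (mkposreal d Hd0); intros x Hx;
    specialize (Hd x Hx); unfold ball; simpl; unfold AbsRing_ball, abs, minus, plus, opp; simpl;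
    eapply Rle_lt_trans; try exact Hd.
    + apply (re_le_Cmod (g x - g t)%C).
    + apply (im_le_Cmod (g x - g t)%C).
Qed.

Lemma rcont_mult (f g : R -> C) (t : R) :
  rcont f t -> rcont g t -> rcont (fun x => f x * g x)%C t.
Proof.
  intros [H1 H2] [H3 H4]. split; simpl.
  - apply (continuous_minus (fun x => Re (f x) * Re (g x)) (fun x => Im (f x) * Im (g x)));
    apply (continuous_mult (K := R_AbsRing)); assumption.
  - apply (continuous_plus (fun x => Re (f x) * Im (g x)) (fun x => Im (f x) * Re (g x)));
    apply (continuous_mult (K := R_AbsRing)); assumption.
Qed.

Lemma rcont_plus (f g : R -> C) (t : R) :
  rcont f t -> rcont g t -> rcont (fun x => f x + g x)%C t.
Proof.
  intros [H1 H2] [H3 H4]. split; simpl;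
  [apply (continuous_plus (fun x => Re (f x)) (fun x => Re (g x))) |
   apply (continuous_plus (fun x => Im (f x)) (fun x => Im (g x)))]; assumption.
Qed.

Lemma rcont_const (c : C) (t : R) : rcont (fun _ => c) t.
Proof. split; apply continuous_const. Qed.

Lemma cderiv_cont (f : C -> C) (z l : C) : cderiv f z l ->
  forall eps, 0 < eps -> exists d, 0 < d /\ forall w, Cmod (w - z)%C < d -> Cmod (f w - f z)%C < eps.
Proof.
  intros H eps He.
  destruct (H 1 Rlt_0_1) as [d [Hd0 Hd]].
  pose proof (Cmod_ge_0 l) as Hl.
  exists (Rmin d (eps / (2 + Cmod l))). split.
  - apply Rmin_pos; [lra|]. apply Rdiv_lt_0_compat; lra.
  - intros w Hw.
    specialize (Hd w (Rlt_le_trans _ _ _ Hw (Rmin_l _ _))).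
    assert (Hw2 := Rlt_le_trans _ _ _ Hw (Rmin_r _ _)).
    apply (Rmult_lt_compat_r (2 + Cmod l)) in Hw2; [|lra].
    unfold Rdiv in Hw2. rewrite Rmult_assoc, Rinv_l in Hw2 by lra.
    pose proof (Cmod_triangle (f w - f z - l * (w - z)) (l * (w - z))) as Ht.
    rewrite Cmod_mult in Ht.
    replace (f w - f z - l * (w - z) + l * (w - z))%C with (f w - f z)%C in Ht by ring.
    pose proof (Cmod_ge_0 (w - z)). lra.
Qed.

Lemma rcont_comp (u : C -> C) (g : R -> C) (t : R) (l : C) :
  rcont g t -> cderiv u (g t) l -> rcont (fun x => u (g x)) t.
Proof.
  intros Hg Hu. apply rcont_eps. intros eps He.
  destruct (cderiv_cont _ _ _ Hu eps He) as [d [Hd0 Hd]].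
  destruct (proj1 (rcont_eps _ _) Hg d Hd0) as [d' [Hd0' Hd']].
  exists d'. split; [assumption|]. intros x Hx. apply Hd, Hd', Hx.
Qed.

Definition CInt (g : R -> C) (a b : R) : C :=
  (RInt (fun t => Re (g t)) a b, RInt (fun t => Im (g t)) a b).

Lemma rcont_ex_RInt (g : R -> C) (a b : R) : a <= b ->
  (forall t, a <= t <= b -> rcont g t) ->
  ex_RInt (fun t => Re (g t)) a b /\ ex_RInt (fun t => Im (g t)) a b.
Proof.
  intros Hab H. split; apply (ex_RInt_continuous (V := R_CompleteNormedModule));
  rewrite Rmin_left, Rmax_right by assumption; intros t Ht; apply H; assumption.
Qed.

Lemma CInt_chasles (g : R -> C) (a b c : R) : a <= b <= c ->
  (forall t, a <= t <= c -> rcont g t) ->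
  CInt g a c = (CInt g a b + CInt g b c)%C.
Proof.
  intros [Hab Hbc] H.
  destruct (rcont_ex_RInt g a b Hab) as [H1 H2]; [intros; apply H; lra|].
  destruct (rcont_ex_RInt g b c Hbc) as [H3 H4]; [intros; apply H; lra|].
  unfold CInt. apply injective_projections; simpl;
  symmetry; apply (RInt_Chasles (V := R_CompleteNormedModule)); assumption.
Qed.

Lemma CInt_plus (f g : R -> C) (a b : R) : a <= b ->
  (forall t, a <= t <= b -> rcont f t) -> (forall t, a <= t <= b -> rcont g t) ->
  CInt (fun t => f t + g t)%C a b = (CInt f a b + CInt g a b)%C.
Proof.
  intros Hab Hf Hg.
  destruct (rcont_ex_RInt f a b Hab Hf) as [H1 H2].
  destruct (rcont_ex_RInt g a b Hab Hg) as [H3 H4].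
  unfold CInt. apply injective_projections; simpl;
  apply (RInt_plus (V := R_CompleteNormedModule)); assumption.
Qed.

Lemma CInt_ext (f g : R -> C) (a b : R) : a <= b ->
  (forall t, a <= t <= b -> f t = g t) -> CInt f a b = CInt g a b.
Proof.
  intros Hab H. unfold CInt. f_equal; apply RInt_ext;
  rewrite Rmin_left, Rmax_right by assumption; intros t Ht; rewrite H; auto; lra.
Qed.

Lemma CInt_bound (g : R -> C) (a b M : R) : a <= b ->
  (forall t, a <= t <= b -> rcont g t) ->
  (forall t, a <= t <= b -> Cmod (g t) <= M) ->
  Cmod (CInt g a b) <= 2 * M * (b - a).
Proof.
  intros Hab Hc HM.
  destruct (rcont_ex_RInt g a b Hab Hc) as [H1 H2].
  eapply Rle_trans; [apply Cmod_le_components|]. simpl.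
  assert (K1 : Rabs (RInt (fun t => Re (g t)) a b) <= (b - a) * M).
  { apply (norm_RInt_le_const (fun t => Re (g t)) a b); auto.
    - intros t Ht. eapply Rle_trans; [apply re_le_Cmod| auto].
    - apply (RInt_correct (V := R_CompleteNormedModule)); assumption. }
  assert (K2 : Rabs (RInt (fun t => Im (g t)) a b) <= (b - a) * M).
  { apply (norm_RInt_le_const (fun t => Im (g t)) a b); auto.
    - intros t Ht. eapply Rle_trans; [apply im_le_Cmod| auto].
    - apply (RInt_correct (V := R_CompleteNormedModule)); assumption. }
  lra.
Qed.

Definition rderiv (g : R -> C) (t : R) (l : C) : Prop :=
  is_derive (fun x => Re (g x)) t (Re l) /\ is_derive (fun x => Im (g x)) t (Im l).

Lemma CInt_derive (g dg : R -> C) (a b : R) : a <= b ->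
  (forall t, a <= t <= b -> rderiv g t (dg t)) ->
  (forall t, a <= t <= b -> rcont dg t) ->
  CInt dg a b = (g b - g a)%C.
Proof.
  intros Hab Hd Hc. unfold CInt. apply injective_projections; simpl;
  apply is_RInt_unique.
  - apply (is_RInt_derive (fun x => Re (g x)) (fun x => Re (dg x)));
    rewrite Rmin_left, Rmax_right by assumption; intros t Ht; [apply Hd| apply Hc]; assumption.
  - apply (is_RInt_derive (fun x => Im (g x)) (fun x => Im (dg x)));
    rewrite Rmin_left, Rmax_right by assumption; intros t Ht; [apply Hd| apply Hc]; assumption.
Qed.

Lemma rderiv_rcont (g : R -> C) (t : R) (l : C) : rderiv g t l -> rcont g t.
Proof.
  intros [H1 H2]. split; apply (ex_derive_continuous (V := R_NormedModule)); eexists; eassumption.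
Qed.

(** * Bisection of rectangles *)

Lemma nested_limit (a b : nat -> R) : (forall n, a n <= b n) -> (forall n, a n <= a (S n)) ->
  (forall n, b (S n) <= b n) -> exists x, forall n, a n <= x <= b n.
Proof.
  intros Hab Ha Hb.
  assert (Ha' : forall n k, a n <= a (n + k)%nat).
  { intros n k; induction k; [rewrite Nat.add_0_r; lra|]. rewrite Nat.add_succ_r. specialize (Ha (n+k)%nat). lra. }
  assert (Hb' : forall n k, b (n + k)%nat <= b n).
  { intros n k; induction k; [rewrite Nat.add_0_r; lra|]. rewrite Nat.add_succ_r. specialize (Hb (n+k)%nat). lra. }
  assert (Hm : forall n m, a n <= b m).
  { intros n m. specialize (Ha' n m). specialize (Hb' m n). rewrite Nat.add_comm in Hb'. specialize (Hab (n+m)%nat). lra. }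
  destruct (completeness (fun x => exists n, x = a n)) as [x [Hx1 Hx2]].
  - exists (b O). intros y [n ->]. apply Hm.
  - exists (a O). exists O. reflexivity.
  - exists x. intros n. split; [apply Hx1; exists n; reflexivity|].
    apply Hx2. intros y [k ->]. apply Hm.
Qed.

Section Bisection.
Variable N : R -> R -> R -> R -> R.
Variables a0 b0 c0 d0 : R.
Hypothesis Hab : a0 < b0.
Hypothesis Hcd : c0 < d0.
Hypothesis Nsub : forall a b c d, a0 <= a -> a <= b -> b <= b0 -> c0 <= c -> c <= d -> d <= d0 ->
  N a b c d <= N a ((a+b)/2) c ((c+d)/2) + N ((a+b)/2) b c ((c+d)/2)
             + N a ((a+b)/2) ((c+d)/2) d + N ((a+b)/2) b ((c+d)/2) d.
Hypothesis Nloc : forall x y, a0 <= x <= b0 -> c0 <= y <= d0 -> forall eps, 0 < eps ->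
  exists del, 0 < del /\ forall a b c d, a0 <= a -> a <= x <= b -> b <= b0 ->
    c0 <= c -> c <= y <= d -> d <= d0 -> (b - a) + (d - c) < del ->
    N a b c d <= eps * ((b - a) + (d - c))^2.

Definition rect := (R * R * R * R)%type.
Definition quarter (q : rect) (l r : bool) : rect :=
  let '(a, b, c, d) := q in
  ((if l then (a+b)/2 else a), (if l then b else (a+b)/2),
   (if r then (c+d)/2 else c), (if r then d else (c+d)/2)).
Definition NN (q : rect) : R := let '(a,b,c,d) := q in N a b c d.
(** The last branch needs no test: when three quarters each fall short of a quarter of [N], the
    subadditivity [Nsub] forces the fourth to reach it. *)
Definition next (q : rect) : rect :=
  if Rle_dec (NN q) (4 * NN (quarter q false false)) then quarter q false false
  else if Rle_dec (NN q) (4 * NN (quarter q true false)) then quarter q true false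
  else if Rle_dec (NN q) (4 * NN (quarter q false true)) then quarter q false true
  else quarter q true true.
Fixpoint qseq (n : nat) : rect :=
  match n with O => (a0, b0, c0, d0) | S k => next (qseq k) end.
Definition qa n := let '(a,b,c,d) := qseq n in a.
Definition qb n := let '(a,b,c,d) := qseq n in b.
Definition qc n := let '(a,b,c,d) := qseq n in c.
Definition qd n := let '(a,b,c,d) := qseq n in d.

Lemma qseq_spec n :
  a0 <= qa n /\ qa n <= qb n /\ qb n <= b0 /\ c0 <= qc n /\ qc n <= qd n /\ qd n <= d0 /\
  (qb n - qa n) = (b0 - a0) / 2^n /\ (qd n - qc n) = (d0 - c0) / 2^n /\
  N a0 b0 c0 d0 <= 4^n * N (qa n) (qb n) (qc n) (qd n) /\
  qa n <= qa (S n) /\ qb (S n) <= qb n /\ qc n <= qc (S n) /\ qd (S n) <= qd n.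
Proof.
  induction n as [|n IH].
  - unfold qa, qb, qc, qd; simpl. unfold next, NN, quarter; simpl.
    repeat (destruct (Rle_dec _ _)); simpl; repeat split; lra.
  - destruct IH as (H1 & H2 & H3 & H4 & H5 & H6 & H7 & H8 & H9 & _).
    assert (Hn : N (qa n) (qb n) (qc n) (qd n) <= 4 * N (qa (S n)) (qb (S n)) (qc (S n)) (qd (S n)) /\
      (qb (S n) - qa (S n)) = (qb n - qa n)/2 /\ (qd (S n) - qc (S n)) = (qd n - qc n)/2 /\
      qa n <= qa (S n) /\ qb (S n) <= qb n /\ qc n <= qc (S n) /\ qd (S n) <= qd n).
    { pose proof (Nsub _ _ _ _ H1 H2 H3 H4 H5 H6) as HS.
      unfold qa, qb, qc, qd in *. cbn [qseq]. destruct (qseq n) as [[[a b] c] d].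
      unfold next, NN, quarter. 
      repeat (destruct (Rle_dec _ _)); repeat split; lra. }
    assert (Hn2 : qa (S n) <= qa (S (S n)) /\ qb (S (S n)) <= qb (S n) /\ 
             qc (S n) <= qc (S (S n)) /\ qd (S (S n)) <= qd (S n)).
    { assert (Hx : qa (S n) <= qb (S n) /\ qc (S n) <= qd (S n)) by lra.
      revert Hx. clear.
      unfold qa, qb, qc, qd. change (qseq (S (S n))) with (next (qseq (S n))).
      destruct (qseq (S n)) as [[[a b] c] d]. unfold next, NN, quarter.
      repeat (destruct (Rle_dec _ _)); lra. }
    destruct Hn as (G1 & G2 & G3 & G4 & G5 & G6 & G7).
    assert (0 < 2^n) by (apply pow_lt; lra).
    assert (0 < 4^n) by (apply pow_lt; lra).
    repeat match goal with |- _ /\ _ => split end; try lra.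
    + rewrite G2, H7. simpl. field. lra.
    + rewrite G3, H8. simpl. field. lra.
    + simpl. apply Rle_trans with (1 := H9).
      apply (Rmult_le_compat_l (4^n)) in G1; lra.
Qed.

(** The bisection of Goursat's theorem for any rectangle function that is subadditive under
    quartering and small of second order at every point. The value on the whole is at most 4^n times
    the value on the n-th rectangle, whose squared size has shrunk by 4^n, so only an arbitrary
    [eps] is left. *)
Lemma bisection_zero : N a0 b0 c0 d0 <= 0.
Proof.
  destruct (nested_limit qa qb) as [x Hx]; try (intros n; apply (qseq_spec n)).
  destruct (nested_limit qc qd) as [y Hy]; try (intros n; apply (qseq_spec n)).
  apply le_epsilon. intros eps Heps. rewrite Rplus_0_l.
  set (sz := (b0 - a0) + (d0 - c0)).
  assert (Hsz : 0 < sz) by (unfold sz; lra).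
  assert (Hx0 : a0 <= x <= b0) by (apply (Hx O)).
  assert (Hy0 : c0 <= y <= d0) by (apply (Hy O)).
  assert (Hs2 : 0 < sz^2) by (apply pow_lt; lra).
  assert (He : 0 < eps / sz^2) by (apply Rdiv_lt_0_compat; lra).
  destruct (Nloc x y Hx0 Hy0 _ He) as [del [Hdel Hloc]].
  destruct (pow_lt_1_zero (1/2)) with (y := del / sz) as [n Hn].
  { rewrite Rabs_right; lra. } { apply Rdiv_lt_0_compat; lra. }
  specialize (Hn n (le_n n)). rewrite Rabs_right in Hn by (apply Rle_ge, pow_le; lra).
  destruct (qseq_spec n) as (H1 & H2 & H3 & H4 & H5 & H6 & H7 & H8 & H9 & _).
  assert (P2 : 0 < 2^n) by (apply pow_lt; lra).
  assert (Hsn : (qb n - qa n) + (qd n - qc n) = sz / 2^n).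
  { rewrite H7, H8. unfold sz. field. lra. }
  eapply Rle_trans; [exact H9|].
  specialize (Hloc (qa n) (qb n) (qc n) (qd n) H1 (Hx n) H3 H4 (Hy n) H6).
  rewrite Hsn in Hloc.
  assert (Hlt : sz / 2^n < del).
  { unfold Rdiv at 1 in Hn. rewrite Rmult_1_l, pow_inv in Hn.
    apply (Rmult_lt_compat_l sz) in Hn; [|lra]. 
    replace (sz * (del / sz)) with del in Hn by (field; lra). exact Hn. }
  specialize (Hloc Hlt).
  apply Rle_trans with (4^n * (eps / sz^2 * (sz/2^n)^2)).
  - apply Rmult_le_compat_l; [apply pow_le; lra| exact Hloc].
  - apply Req_le. replace 4 with (2*2) by ring. rewrite Rpow_mult_distr. field. lra.
Qed.
End Bisection.

(** * Goursat's theorem for a homotopy of circles *)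

Ltac by_components := apply injective_projections; simpl; unfold Re, Im; ring.

Definition cis (t : R) : C := (cos t, sin t).

Lemma Cmod_cis (t : R) : Cmod (cis t) = 1.
Proof.
  unfold Cmod, cis, fst, snd.
  replace (cos t ^ 2 + sin t ^ 2) with 1; [apply sqrt_1|].
  rewrite <- (sin2_cos2 t). unfold Rsqr. ring.
Qed.

Section Goursat.
Variables (z : C) (r e : R).
Hypothesis Hze : Cmod z + e < r.
Hypothesis He : 0 < e.

(* The straight-line homotopy from the circle of centre [z] and radius [e] to
   the circle of centre 0 and radius [r]; it avoids [z]. *)
Definition hom (s t : R) : C :=
  (Re z * (1 - s) + ((1 - s) * e + s * r) * cos t,
   Im z * (1 - s) + ((1 - s) * e + s * r) * sin t).
Definition hom_s (s t : R) : C :=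
  (- Re z + (r - e) * cos t, - Im z + (r - e) * sin t).
Definition hom_t (s t : R) : C :=
  (- ((1 - s) * e + s * r) * sin t, ((1 - s) * e + s * r) * cos t).

Lemma rderiv_hom_s s t : rderiv (fun x => hom x t) s (hom_s s t).
Proof.
  split; unfold hom, hom_s, Re, Im; simpl; auto_derive; trivial; ring.
Qed.

Lemma rderiv_hom_t s t : rderiv (fun x => hom s x) t (hom_t s t).
Proof.
  split; unfold hom, hom_t, Re, Im; simpl; auto_derive; trivial; ring.
Qed.

Lemma rcont_hom_s s t : rcont (fun x => hom_s x t) s.
Proof. apply rcont_const. Qed.

Lemma rcont_hom_t s t : rcont (fun x => hom_t s x) t.
Proof.
  apply (rderiv_rcont _ _ ((- ((1 - s) * e + s * r) * cos t, - ((1 - s) * e + s * r) * sin t))).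
  split; unfold hom_t, Re, Im; simpl; auto_derive; trivial; ring.
Qed.

(** A primitive of the affine function al + be (w - w0): along an edge, the affine part of [u]
    integrates to a difference of end values. *)
Definition prim (al be w0 w : C) : C := (al * w + be * (w - w0) * (w - w0) / 2)%C.

Lemma rderiv_prim_s al be w0 s t :
  rderiv (fun x => prim al be w0 (hom x t)) s ((al + be * (hom s t - w0)) * hom_s s t)%C.
Proof.
  destruct al as [a1 a2], be as [b1 b2], w0 as [c1 c2].
  split; unfold prim, hom, hom_s, Re, Im; simpl; auto_derive; trivial; field.
Qed.

Lemma rderiv_prim_t al be w0 s t :
  rderiv (fun x => prim al be w0 (hom s x)) t ((al + be * (hom s t - w0)) * hom_t s t)%C.
Proof.
  destruct al as [a1 a2], be as [b1 b2], w0 as [c1 c2].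
  split; unfold prim, hom, hom_t, Re, Im; simpl; auto_derive; trivial; field.
Qed.

(** The integral of u(w) dw along the image under [hom] of the boundary of [a, b] x [c, d],
    counterclockwise in the parameter plane. *)
Definition loop (u : C -> C) (a b c d : R) : C :=
  (CInt (fun s => u (hom s c) * hom_s s c) a b + CInt (fun t => u (hom b t) * hom_t b t) c d
   - CInt (fun s => u (hom s d) * hom_s s d) a b - CInt (fun t => u (hom a t) * hom_t a t) c d)%C.

Let K := 2 * (Cmod z + r + e).

Lemma hom_s_bound s t : Cmod (hom_s s t) <= K.
Proof.
  replace (hom_s s t) with (RtoC (r - e) * cis t - z)%C.
  2:{ unfold hom_s, cis; by_components. }
  eapply Rle_trans; [apply Cmod_sub_le|]. rewrite Cmod_mult, Cmod_cis, Cmod_R.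
  pose proof (Cmod_ge_0 z). rewrite Rabs_right; unfold K; lra.
Qed.

Lemma hom_t_bound s t : 0 <= s <= 1 -> Cmod (hom_t s t) <= K.
Proof.
  intros Hs.
  replace (hom_t s t) with (RtoC ((1 - s) * e + s * r) * (Ci * cis t))%C.
  2:{ unfold hom_t, cis, Ci; simpl; apply injective_projections; simpl; ring. }
  rewrite Cmod_mult, Cmod_mult, Cmod_cis, Cmod_R, Cmod_Ci.
  pose proof (Cmod_ge_0 z). rewrite Rabs_right; unfold K; nra.
Qed.

Lemma hom_lip s t s' t' : 0 <= s <= 1 -> 0 <= s' <= 1 ->
  Cmod (hom s t - hom s' t')%C <= 2 * K * (Rabs (s - s') + Rabs (t - t')).
Proof.
  intros Hs Hs'.
  replace (hom s t - hom s' t')%C with (RtoC (s - s') * hom_s s t + RtoC ((1 - s') * e + s' * r) * (cis t - cis t'))%C.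
  2:{ unfold hom, hom_s, cis; by_components. }
  eapply Rle_trans; [apply Cmod_triangle|].
  rewrite !Cmod_mult, !Cmod_R.
  assert (Hc : Cmod (cis t - cis t') <= 2 * Rabs (t - t')).
  { eapply Rle_trans; [apply Cmod_le_components|]. unfold cis; simpl.
    assert (H1 : Rabs (cos t - cos t') <= 1 * Rabs (t - t')).
    { apply (bounded_variation cos (fun x => - sin x)). intros x _. split; [|apply Rabs_le; pose proof (SIN_bound x); lra].
      auto_derive; trivial; ring. }
    assert (H2 : Rabs (sin t - sin t') <= 1 * Rabs (t - t')).
    { apply (bounded_variation sin cos). intros x _. split; [|apply Rabs_le; pose proof (COS_bound x); lra].
      auto_derive; trivial; ring. }
    unfold Rminus in *. lra. }
  pose proof (hom_s_bound s t). pose proof (Cmod_ge_0 z).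
  pose proof (Rabs_pos (s - s')). pose proof (Rabs_pos (t - t')).
  rewrite (Rabs_right ((1 - s') * e + s' * r)) by nra.
  assert (0 <= (1 - s') * e + s' * r <= K / 2) by (unfold K; nra).
  pose proof (Cmod_ge_0 (cis t - cis t')).
  assert (Rabs (s - s') * Cmod (hom_s s t) <= Rabs (s-s') * K) by (apply Rmult_le_compat_l; lra).
  assert (((1 - s') * e + s' * r) * Cmod (cis t - cis t') <= K/2 * (2 * Rabs (t - t'))) by (apply Rmult_le_compat; lra).
  assert (0 <= K * Rabs (s - s')) by (apply Rmult_le_pos; unfold K; lra).
  assert (0 <= K * Rabs (t - t')) by (apply Rmult_le_pos; unfold K; lra).
  nra.
Qed.

Lemma K_pos : 0 < K.
Proof. unfold K. pose proof (Cmod_ge_0 z). lra. Qed.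

Lemma rcont_us (u : C -> C) s t : (exists l, cderiv u (hom s t) l) ->
  rcont (fun x => u (hom x t) * hom_s x t)%C s.
Proof.
  intros [l Hl]. apply rcont_mult; [|apply rcont_hom_s].
  apply (rcont_comp u (fun x => hom x t) s l); [|exact Hl].
  eapply rderiv_rcont, rderiv_hom_s.
Qed.

Lemma rcont_ut (u : C -> C) s t : (exists l, cderiv u (hom s t) l) ->
  rcont (fun x => u (hom s x) * hom_t s x)%C t.
Proof.
  intros [l Hl]. apply rcont_mult; [|apply rcont_hom_t].
  apply (rcont_comp u (fun x => hom s x) t l); [|exact Hl].
  eapply rderiv_rcont, rderiv_hom_t.
Qed.

Variable u : C -> C.
Hypothesis Hu : forall s t, 0 <= s <= 1 -> exists l, cderiv u (hom s t) l.

(** Every inner edge is traversed twice, in opposite directions. *)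
Lemma loop_split a b c d : 0 <= a -> a <= b -> b <= 1 -> c <= d ->
  loop u a b c d = (loop u a ((a+b)/2) c ((c+d)/2) + loop u ((a+b)/2) b c ((c+d)/2)
     + loop u a ((a+b)/2) ((c+d)/2) d + loop u ((a+b)/2) b ((c+d)/2) d)%C.
Proof.
  intros Ha Hab Hb Hcd. unfold loop.
  rewrite (CInt_chasles (fun s => u (hom s c) * hom_s s c)%C a ((a+b)/2) b); [|lra|intros; apply rcont_us, Hu; lra].
  rewrite (CInt_chasles (fun s => u (hom s d) * hom_s s d)%C a ((a+b)/2) b); [|lra|intros; apply rcont_us, Hu; lra].
  rewrite (CInt_chasles (fun t => u (hom a t) * hom_t a t)%C c ((c+d)/2) d); [|lra|intros; apply rcont_ut, Hu; lra].
  rewrite (CInt_chasles (fun t => u (hom b t) * hom_t b t)%C c ((c+d)/2) d); [|lra|intros; apply rcont_ut, Hu; lra].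
  ring.
Qed.

(** Near the point [w0] the function [u] is affine up to a remainder [v] that is small compared with
    the distance. The affine part has a primitive and contributes 0 round the loop; [v] is
    integrated over edges whose length is of the order of the size of the rectangle, which yields
    second order. *)
Lemma loop_local s0 t0 : 0 <= s0 <= 1 -> forall eps, 0 < eps ->
  exists del, 0 < del /\ forall a b c d, 0 <= a -> a <= s0 <= b -> b <= 1 ->
    c <= t0 <= d -> (b - a) + (d - c) < del ->
    Cmod (loop u a b c d) <= eps * ((b - a) + (d - c))^2.
Proof.
  intros Hs0 eps Heps.
  pose proof K_pos as HK.
  destruct (Hu s0 t0 Hs0) as [be Hbe].
  set (w0 := hom s0 t0) in *. set (al := u w0).
  (* The denominator collects the Lipschitz constant 2 * K of [hom], the bound [K] for its partial
     derivatives, and 4 for two opposite edges with the factor 2 of [CInt_bound] on each. *)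
  assert (He1 : 0 < eps / (8 * K * K)) by (apply Rdiv_lt_0_compat; [lra|]; nra).
  destruct (Hbe _ He1) as [d1 [Hd1 Hloc]].
  exists (d1 / (2 * K)). split; [apply Rdiv_lt_0_compat; lra|].
  intros a b c d Ha Hs Hb Ht Hsz.
  set (sz := b - a + (d - c)) in *.
  set (v := fun w => (u w - al - be * (w - w0))%C).
  assert (Hv : forall s t, a <= s <= b -> c <= t <= d -> Cmod (v (hom s t)) <= eps / (4 * K) * sz).
  { intros s t Hss Htt. unfold v.
    assert (HL := hom_lip s t s0 t0 ltac:(lra) Hs0). fold w0 in HL.
    assert (Hab : Rabs (s - s0) + Rabs (t - t0) <= sz).
    { unfold sz. assert (Rabs (s - s0) <= b - a) by (apply Rabs_le; lra).
      assert (Rabs (t - t0) <= d - c) by (apply Rabs_le; lra). lra. }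
    assert (HL2 : Cmod (hom s t - w0) <= 2 * K * sz).
    { eapply Rle_trans; [exact HL|]. apply Rmult_le_compat_l; lra. }
    assert (HL3 : Cmod (hom s t - w0) < d1).
    { eapply Rle_lt_trans; [exact HL2|]. apply (Rmult_lt_compat_l (2*K)) in Hsz; [|lra].
      replace (2 * K * (d1 / (2 * K))) with d1 in Hsz by (field; lra). exact Hsz. }
    eapply Rle_trans; [exact (Hloc _ HL3)|].
    apply Rle_trans with (eps / (8 * K * K) * (2 * K * sz)).
    - apply Rmult_le_compat_l; lra.
    - apply Req_le. field. lra. }
  assert (Hvc : forall s t, 0 <= s <= 1 -> exists l, cderiv v (hom s t) l).
  { intros s t Hss. destruct (Hu s t Hss) as [l Hl]. exists (l - be)%C.
    intros ee Hee. destruct (Hl ee Hee) as [dd [Hdd Hdd2]]. exists dd; split; [assumption|].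
    intros w Hw. unfold v.
    replace (u w - al - be * (w - w0) - (u (hom s t) - al - be * (hom s t - w0)) - (l - be) * (w - hom s t))%C
      with (u w - u (hom s t) - l * (w - hom s t))%C by ring. auto. }
  assert (Hpc : forall w, exists l, cderiv (fun w => al + be * (w - w0))%C w l).
  { intros w. exists be. intros ee Hee. exists 1. split; [lra|]. intros w' _.
    replace (al + be * (w' - w0) - (al + be * (w - w0)) - be * (w' - w))%C with (RtoC 0) by ring.
    rewrite Cmod_0. apply Rmult_le_pos; [lra|apply Cmod_ge_0]. }
  pose proof (fun s t Hs => rcont_us v s t (Hvc s t Hs)) as Hvcs.
  pose proof (fun s t Hs => rcont_ut v s t (Hvc s t Hs)) as Hvct.
  pose proof (fun s t => rcont_us _ s t (Hpc (hom s t))) as Hps.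
  pose proof (fun s t => rcont_ut _ s t (Hpc (hom s t))) as Hpt.
  cbv beta in Hps, Hpt.
  assert (Es : forall t, CInt (fun s => u (hom s t) * hom_s s t)%C a b =
     (CInt (fun s => v (hom s t) * hom_s s t)%C a b + (prim al be w0 (hom b t) - prim al be w0 (hom a t)))%C).
  { intros t. 
    rewrite <- (CInt_derive (fun s => prim al be w0 (hom s t)) (fun s => (al + be * (hom s t - w0)) * hom_s s t)%C a b);
      [|lra|intros; apply rderiv_prim_s|intros; apply Hps].
    rewrite <- CInt_plus; [|lra|intros; apply Hvcs; lra|intros; apply Hps].
    apply CInt_ext; [lra|]. intros s _. unfold v. ring. }
  assert (Et : forall s, 0 <= s <= 1 -> CInt (fun t => u (hom s t) * hom_t s t)%C c d =
     (CInt (fun t => v (hom s t) * hom_t s t)%C c d + (prim al be w0 (hom s d) - prim al be w0 (hom s c)))%C).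
  { intros s Hss. 
    rewrite <- (CInt_derive (fun t => prim al be w0 (hom s t)) (fun t => (al + be * (hom s t - w0)) * hom_t s t)%C c d);
      [|lra|intros; apply rderiv_prim_t|intros; apply Hpt].
    rewrite <- CInt_plus; [|lra|intros; apply Hvct; lra|intros; apply Hpt].
    apply CInt_ext; [lra|]. intros t _. unfold v. ring. }
  unfold loop. rewrite !Es, !Et by lra.
  set (I1 := CInt (fun s => v (hom s c) * hom_s s c)%C a b).
  set (I2 := CInt (fun t => v (hom b t) * hom_t b t)%C c d).
  set (I3 := CInt (fun s => v (hom s d) * hom_s s d)%C a b).
  set (I4 := CInt (fun t => v (hom a t) * hom_t a t)%C c d).
  match goal with |- Cmod ?x <= _ => replace x with ((I1 + I2) - (I3 + I4))%C by ring end.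
  assert (Hsz0 : 0 <= eps / (4 * K) * sz).
  { apply Rmult_le_pos; [apply Rlt_le, Rdiv_lt_0_compat; lra| unfold sz; lra]. }
  assert (Bs : forall t, c <= t <= d -> Cmod (CInt (fun s => v (hom s t) * hom_s s t)%C a b) <= 2 * (eps / 4 * sz) * (b - a)).
  { intros t Htt. apply CInt_bound; [lra|intros; apply Hvcs; lra|].
    intros s Hss. rewrite Cmod_mult.
    apply Rle_trans with (eps / (4 * K) * sz * K).
    - apply Rmult_le_compat; try apply Cmod_ge_0; [apply Hv; lra|apply hom_s_bound].
    - apply Req_le. field. lra. }
  assert (Bt : forall s, a <= s <= b -> Cmod (CInt (fun t => v (hom s t) * hom_t s t)%C c d) <= 2 * (eps / 4 * sz) * (d - c)).
  { intros s Hss. apply CInt_bound; [lra|intros; apply Hvct; lra|].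
    intros t Htt. rewrite Cmod_mult.
    apply Rle_trans with (eps / (4 * K) * sz * K).
    - apply Rmult_le_compat; try apply Cmod_ge_0; [apply Hv; lra|apply hom_t_bound; lra].
    - apply Req_le. field. lra. }
  eapply Rle_trans; [apply Cmod_sub_le|].
  pose proof (Cmod_triangle I1 I2). pose proof (Cmod_triangle I3 I4).
  pose proof (Bs c ltac:(lra)) as B1. pose proof (Bs d ltac:(lra)) as B3.
  pose proof (Bt b ltac:(lra)) as B2. pose proof (Bt a ltac:(lra)) as B4.
  fold I1 in B1. fold I2 in B2. fold I3 in B3. fold I4 in B4.
  replace (eps * sz ^ 2) with (2 * (2 * (eps / 4 * sz) * (b - a)) + 2 * (2 * (eps / 4 * sz) * (d - c))).
  - lra.
  - unfold sz. field.
Qed.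

Lemma goursat : loop u 0 1 0 (2 * PI) = 0%C.
Proof.
  assert (H : Cmod (loop u 0 1 0 (2 * PI)) <= 0).
  { pose proof PI_RGT_0.
    apply (bisection_zero (fun a b c d => Cmod (loop u a b c d)) 0 1 0 (2 * PI)); try lra.
    - intros a b c d H1 H2 H3 H4 H5 H6. rewrite loop_split by lra.
      eapply Rle_trans; [apply Cmod_triangle|]. apply Rplus_le_compat_r.
      eapply Rle_trans; [apply Cmod_triangle|]. apply Rplus_le_compat_r.
      apply Cmod_triangle.
    - intros x y Hx Hy eps Heps.
      destruct (loop_local x y Hx eps Heps) as [del [Hdel Hl]].
      exists del. split; [assumption|]. intros. apply Hl; lra. }
  apply Cmod_eq_0. pose proof (Cmod_ge_0 (loop u 0 1 0 (2 * PI))). lra.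
Qed.

(** By periodicity the edges t = 0 and t = 2 PI are the same path and cancel in [goursat]; the other
    two edges are the two circles. *)
Lemma circle_shift :
  CInt (fun t => u (hom 1 t) * hom_t 1 t)%C 0 (2 * PI) = CInt (fun t => u (hom 0 t) * hom_t 0 t)%C 0 (2 * PI).
Proof.
  pose proof goursat as H. unfold loop in H.
  assert (E : CInt (fun s => u (hom s (2 * PI)) * hom_s s (2 * PI))%C 0 1 = CInt (fun s => u (hom s 0) * hom_s s 0)%C 0 1).
  { unfold hom, hom_s. rewrite cos_2PI, sin_2PI, cos_0, sin_0. reflexivity. }
  rewrite E in H.
  match type of H with (?A + ?B - ?A - ?D)%C = _ => 
    assert (H2 : (B - D)%C = 0%C) by (rewrite <- H; ring); 
    rewrite <- (Cplus_0_r D), <- H2; ring end.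
Qed.
End Goursat.

(** * Cauchy's formula and Taylor estimates *)

Lemma cderiv_ext_loc (f g : C -> C) (z l : C) (d : R) : 0 < d ->
  (forall w, Cmod (w - z)%C < d -> f w = g w) -> cderiv f z l -> cderiv g z l.
Proof.
  intros Hd H Hf eps He. destruct (Hf eps He) as [d' [Hd' Hf']].
  exists (Rmin d d'). split; [apply Rmin_pos; assumption|].
  intros w Hw. rewrite <- !H.
  - apply Hf'. eapply Rlt_le_trans; [exact Hw|apply Rmin_r].
  - rewrite Cmod_diag. exact Hd.
  - eapply Rlt_le_trans; [exact Hw|apply Rmin_l].
Qed.

Lemma cderiv_const (c z : C) : cderiv (fun _ => c) z 0%C.
Proof.
  intros eps He. exists 1. split; [lra|]. intros w _.
  replace (c - c - 0 * (w - z))%C with (RtoC 0) by ring. rewrite Cmod_0.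
  apply Rmult_le_pos; [lra|apply Cmod_ge_0].
Qed.

Lemma cderiv_id (z : C) : cderiv (fun w => w) z 1%C.
Proof.
  intros eps He. exists 1. split; [lra|]. intros w _.
  replace (w - z - 1 * (w - z))%C with (RtoC 0) by ring. rewrite Cmod_0.
  apply Rmult_le_pos; [lra|apply Cmod_ge_0].
Qed.

Lemma cderiv_plus (f g : C -> C) (z l m : C) :
  cderiv f z l -> cderiv g z m -> cderiv (fun w => f w + g w)%C z (l + m)%C.
Proof.
  intros Hf Hg eps He.
  destruct (Hf (eps / 2)) as [d1 [Hd1 H1]]; [lra|].
  destruct (Hg (eps / 2)) as [d2 [Hd2 H2]]; [lra|].
  exists (Rmin d1 d2). split; [apply Rmin_pos; assumption|]. intros w Hw.
  destruct (Rlt_Rmin _ _ _ Hw) as [Ha Hb]. specialize (H1 w Ha). specialize (H2 w Hb).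
  replace (f w + g w - (f z + g z) - (l + m) * (w - z))%C with
    ((f w - f z - l * (w - z)) + (g w - g z - m * (w - z)))%C by ring.
  eapply Rle_trans; [apply Cmod_triangle|]. lra.
Qed.

Lemma cderiv_mult (f g : C -> C) (z l m : C) :
  cderiv f z l -> cderiv g z m -> cderiv (fun w => f w * g w)%C z (l * g z + f z * m)%C.
Proof.
  intros Hf Hg eps He.
  pose proof (Cmod_ge_0 l) as Pl. pose proof (Cmod_ge_0 (f z)) as Pf. pose proof (Cmod_ge_0 (g z)) as Pg.
  destruct (Hf (eps / (3 * (Cmod (g z) + 1)))) as [d1 [Hd1 H1]]; [apply Rdiv_lt_0_compat; lra|].
  destruct (Hg (eps / (3 * (Cmod (f z) + 1)))) as [d2 [Hd2 H2]]; [apply Rdiv_lt_0_compat; lra|].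
  destruct (cderiv_cont _ _ _ Hg (Rmin 1 (eps / (3 * (Cmod l + 1))))) as [d3 [Hd3 H3]].
  { apply Rmin_pos; [lra|]. apply Rdiv_lt_0_compat; lra. }
  exists (Rmin d1 (Rmin d2 d3)). split; [repeat apply Rmin_pos; assumption|]. intros w Hw.
  destruct (Rlt_Rmin _ _ _ Hw) as [Ha Hw']. destruct (Rlt_Rmin _ _ _ Hw') as [Hb Hc].
  specialize (H1 w Ha). specialize (H2 w Hb). specialize (H3 w Hc).
  destruct (Rlt_Rmin _ _ _ H3) as [H4 H5].
  assert (H6 : Cmod (g w) <= Cmod (g z) + 1) by (pose proof (Cmod_sub_ge (g w) (g z)); lra).
  replace (f w * g w - f z * g z - (l * g z + f z * m) * (w - z))%C with
    ((f w - f z - l * (w - z)) * g w + l * (w - z) * (g w - g z) + f z * (g w - g z - m * (w - z)))%C by ring.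
  eapply Rle_trans; [apply Cmod_triangle|].
  eapply Rle_trans; [apply Rplus_le_compat_r, Cmod_triangle|].
  rewrite !Cmod_mult.
  set (x := Cmod (w - z)) in *. assert (Px : 0 <= x) by apply Cmod_ge_0.
  assert (K1 : Cmod (f w - f z - l * (w - z)) * Cmod (g w) <= eps / (3 * (Cmod (g z) + 1)) * x * (Cmod (g z) + 1)).
  { apply Rmult_le_compat; try apply Cmod_ge_0; assumption. }
  replace (eps / (3 * (Cmod (g z) + 1)) * x * (Cmod (g z) + 1)) with (eps / 3 * x) in K1 by (field; lra).
  assert (K2 : Cmod l * x * Cmod (g w - g z) <= (Cmod l + 1) * x * (eps / (3 * (Cmod l + 1)))).
  { apply Rmult_le_compat; try apply Cmod_ge_0; [apply Rmult_le_pos; assumption| | lra].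
    apply Rmult_le_compat_r; lra. }
  replace ((Cmod l + 1) * x * (eps / (3 * (Cmod l + 1)))) with (eps / 3 * x) in K2 by (field; lra).
  assert (K3 : Cmod (f z) * Cmod (g w - g z - m * (w - z)) <= (Cmod (f z) + 1) * (eps / (3 * (Cmod (f z) + 1)) * x)).
  { apply Rmult_le_compat; try apply Cmod_ge_0; lra. }
  replace ((Cmod (f z) + 1) * (eps / (3 * (Cmod (f z) + 1)) * x)) with (eps / 3 * x) in K3 by (field; lra).
  lra.
Qed.

Lemma Csub_neq_0 (x y : C) : x <> y -> (x - y)%C <> 0%C.
Proof. intros H E. apply H. rewrite <- (Cplus_0_r y), <- E. ring. Qed.

Lemma cderiv_inv (a z : C) : z <> a -> exists l, cderiv (fun w => / (w - a))%C z l.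
Proof.
  intros Hza. apply Csub_neq_0 in Hza. exists (- (/ (z - a) * / (z - a)))%C.
  intros eps He.
  assert (Hp : 0 < Cmod (z - a)) by (apply Cmod_gt_0; assumption).
  set (p := Cmod (z - a)) in *.
  (* The first bound keeps |w - a| above p / 2; the second makes the exact remainder (w - z)^2 / ((z
     - a)^2 (w - a)) at most eps |w - z| in modulus. *)
  exists (Rmin (p / 2) (eps * p * p * p / 2)). split.
  { apply Rmin_pos; [lra|]. apply Rdiv_lt_0_compat; [|lra]. repeat apply Rmult_lt_0_compat; lra. }
  intros w Hw.
  destruct (Rlt_Rmin _ _ _ Hw) as [H1 H2].
  assert (H3 : p / 2 <= Cmod (w - a)).
  { pose proof (Cmod_sub_ge (z - a) (z - w)). rewrite (Cmod_sub_sym z w) in H.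
    replace (z - a - (z - w))%C with (w - a)%C in H by ring. fold p in H. lra. }
  assert (Hwa : (w - a)%C <> 0%C) by (apply Cmod_gt_0; lra).
  replace (/ (w - a) - / (z - a) - - (/ (z - a) * / (z - a)) * (w - z))%C with
    ((w - z) * (w - z) / ((z - a) * (z - a) * (w - a)))%C by (field; split; assumption).
  rewrite Cmod_div by (repeat apply Cmult_neq_0; assumption).
  rewrite !Cmod_mult. fold p.
  assert (Hq : 0 < p * p * Cmod (w - a)) by (repeat apply Rmult_lt_0_compat; lra).
  apply Rle_div_l; [lra|].
  pose proof (Cmod_ge_0 (w - z)).
  set (x := Cmod (w - z)) in *.
  apply Rle_trans with (eps * x * (p * p * (p / 2))).
  - replace (eps * x * (p * p * (p / 2))) with (x * (eps * p * p * p / 2)) by field.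
    apply Rmult_le_compat_l; lra.
  - apply Rmult_le_compat_l; [apply Rmult_le_pos; lra|].
    apply Rmult_le_compat_l; [apply Rmult_le_pos; lra|]. lra.
Qed.

Lemma CInt_scal (c : C) (g : R -> C) (a b : R) : a <= b ->
  (forall t, a <= t <= b -> rcont g t) ->
  CInt (fun t => c * g t)%C a b = (c * CInt g a b)%C.
Proof.
  intros Hab Hg. destruct (rcont_ex_RInt g a b Hab Hg) as [H1 H2].
  assert (S : forall k h, ex_RInt h a b -> RInt (fun t => k * h t) a b = k * RInt h a b).
  { intros k h Hh. exact (RInt_scal (V := R_CompleteNormedModule) h a b k Hh). }
  assert (E : forall k h, ex_RInt h a b -> ex_RInt (fun t => k * h t) a b).
  { intros k h Hh. exact (ex_RInt_scal (V := R_CompleteNormedModule) h a b k Hh). }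
  destruct c as [x y].
  unfold CInt. apply injective_projections; simpl.
  - rewrite <- !S by assumption.
    apply (RInt_minus (V := R_CompleteNormedModule) (fun t => x * Re (g t)) (fun t => y * Im (g t)));
    apply E; assumption.
  - rewrite <- !S by assumption.
    apply (RInt_plus (V := R_CompleteNormedModule) (fun t => x * Im (g t)) (fun t => y * Re (g t)));
    apply E; assumption.
Qed.

Lemma CInt_const (c : C) (a b : R) : CInt (fun _ => c) a b = (RtoC (b - a) * c)%C.
Proof.
  unfold CInt. rewrite !RInt_const. unfold scal; simpl; unfold mult; simpl.
  apply injective_projections; simpl; unfold Re, Im; ring.
Qed.

Lemma rcont_cis t : rcont cis t.
Proof.
  apply (rderiv_rcont _ _ (Ci * cis t)%C).
  split; unfold cis, Ci, Re, Im; simpl; auto_derive; trivial; ring.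
Qed.

Section Cauchy.
Variables (f : C -> C) (r : R).
Hypothesis Hr : 0 < r.
Hypothesis Hf : forall w, Cmod w <= r -> exists l, cderiv f w l.

Lemma Cmod_r_cis t : Cmod (RtoC r * cis t)%C = r.
Proof. rewrite Cmod_mult, Cmod_cis, Cmod_R, Rabs_right; lra. Qed.

Lemma rcont_circle t : rcont (fun t => f (RtoC r * cis t))%C t.
Proof.
  destruct (Hf (RtoC r * cis t)%C) as [l Hl]; [rewrite Cmod_r_cis; lra|].
  apply (rcont_comp f (fun t => RtoC r * cis t)%C t l); [|exact Hl].
  apply rcont_mult; [apply rcont_const|apply rcont_cis].
Qed.

Lemma rcont_inv_circle (a : C) t : Cmod a < r -> rcont (fun t => / (RtoC r * cis t - a))%C t.
Proof.
  intros Ha.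
  destruct (cderiv_inv a (RtoC r * cis t)%C) as [l Hl].
  { intros E. pose proof (Cmod_r_cis t) as H. rewrite E in H. lra. }
  apply (rcont_comp (fun w => / (w - a))%C (fun t => RtoC r * cis t)%C t l); [|exact Hl].
  apply rcont_mult; [apply rcont_const|apply rcont_cis].
Qed.

Lemma circle_neq (a : C) t : Cmod a < r -> (RtoC r * cis t - a)%C <> 0%C.
Proof.
  intros Ha. apply Csub_neq_0. intros E. pose proof (Cmod_r_cis t) as H. rewrite E in H. lra.
Qed.

(** On the circle zeta = r e^(it) one has d zeta = i zeta dt, whence the factor zeta in the
    integrand and the absence of i on the right. [circle_shift] moves the circle to a small one
    about [z], where the integrand becomes [f] itself, which is close to f z. *)
Lemma cauchy_formula (z : C) : Cmod z < r ->
  CInt (fun t => f (RtoC r * cis t) * (RtoC r * cis t) * / (RtoC r * cis t - z))%C 0 (2 * PI)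
  = (RtoC (2 * PI) * f z)%C.
Proof.
  intros Hz.
  set (ze := fun t => (RtoC r * cis t)%C) in *.
  assert (Hpi := PI_RGT_0).
  assert (Hcz : forall t, rcont ze t) by (intros; apply rcont_mult; [apply rcont_const|apply rcont_cis]).
  set (LHS := CInt (fun t => f (ze t) * ze t * / (ze t - z))%C 0 (2 * PI)).
  assert (Hclose : forall eps, 0 < eps -> Cmod (LHS - RtoC (2 * PI) * f z) <= eps).
  { intros eps Heps.
    destruct (Hf z) as [l0 Hl0]; [lra|].
    (* The length 2 * PI of the interval times the factor 2 of [CInt_bound]. *)
    assert (He0 : 0 < eps / (4 * PI)) by (apply Rdiv_lt_0_compat; lra).
    destruct (cderiv_cont _ _ _ Hl0 _ He0) as [d [Hd Hcont]].
    set (e := Rmin (d / 2) ((r - Cmod z) / 2)).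
    assert (He : 0 < e) by (apply Rmin_pos; lra).
    assert (He1 : e <= d / 2) by apply Rmin_l.
    assert (He2 : e <= (r - Cmod z) / 2) by apply Rmin_r.
    assert (Hze : Cmod z + e < r) by lra.
    set (u := fun w => (f w * / (w - z))%C).
    assert (Hhom : forall s t, 0 <= s <= 1 -> Cmod (hom z r e s t) <= r /\ hom z r e s t <> z).
    { intros s t Hs. split.
      - replace (hom z r e s t) with (RtoC (1 - s) * z + RtoC ((1 - s) * e + s * r) * cis t)%C.
        2:{ unfold hom, cis; by_components. }
        eapply Rle_trans; [apply Cmod_triangle|].
        rewrite !Cmod_mult, !Cmod_R, Cmod_cis, !Rabs_right by nra. nra.
      (* If the homotopy met [z], comparing moduli would give (1 - s) e + s r = s |z|, against e > 0
         and |z| < r. *)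
      - intros E.
        assert (E2 : (RtoC ((1 - s) * e + s * r) * cis t)%C = (RtoC s * z)%C).
        { transitivity (hom z r e s t - RtoC (1 - s) * z)%C.
          - unfold hom, cis; by_components.
          - rewrite E. rewrite RtoC_minus. ring. }
        apply (f_equal Cmod) in E2. rewrite !Cmod_mult, !Cmod_R, Cmod_cis, !Rabs_right in E2 by nra.
        nra. }
    assert (Hu : forall s t, 0 <= s <= 1 -> exists l, cderiv u (hom z r e s t) l).
    { intros s t Hs. destruct (Hhom s t Hs) as [H1 H2].
      destruct (Hf _ H1) as [l Hl]. destruct (cderiv_inv z _ H2) as [m Hm].
      eexists. unfold u. apply cderiv_mult; eassumption. }
    pose proof (circle_shift z r e Hze He u Hu) as H.
    assert (E1 : CInt (fun t => u (hom z r e 1 t) * hom_t r e 1 t)%C 0 (2 * PI) = (Ci * LHS)%C).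
    { unfold LHS. rewrite <- CInt_scal; [|lra|].
      2:{ intros. apply rcont_mult; [apply rcont_mult; [apply rcont_circle|apply Hcz]|apply rcont_inv_circle; assumption]. }
      apply CInt_ext; [lra|]. intros t _. unfold u.
      replace (hom z r e 1 t) with (ze t).
      2:{ unfold hom, ze, cis; by_components. }
      replace (hom_t r e 1 t) with (Ci * ze t)%C.
      2:{ unfold hom_t, ze, cis, Ci; by_components. }
      ring. }
    assert (Hrc0 : forall t, rcont (fun t => f (z + RtoC e * cis t))%C t).
    { intros t. destruct (Hf (z + RtoC e * cis t)%C) as [l Hl].
      { eapply Rle_trans; [apply Cmod_triangle|]. rewrite Cmod_mult, Cmod_R, Cmod_cis, Rabs_right; lra. }
      apply (rcont_comp f (fun t => z + RtoC e * cis t)%C t l); [|exact Hl].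
      apply rcont_plus; [apply rcont_const|apply rcont_mult; [apply rcont_const|apply rcont_cis]]. }
    assert (E2 : CInt (fun t => u (hom z r e 0 t) * hom_t r e 0 t)%C 0 (2 * PI) =
       (Ci * (CInt (fun t => f (z + RtoC e * cis t) + - f z) 0 (2 * PI) + RtoC (2 * PI) * f z))%C).
    { replace (RtoC (2 * PI) * f z)%C with (CInt (fun _ => f z) 0 (2 * PI)).
      2:{ rewrite CInt_const, Rminus_0_r. reflexivity. }
      assert (Hrc1 : forall t, rcont (fun t => f (z + RtoC e * cis t) + - f z)%C t).
      { intros t. apply rcont_plus; [apply Hrc0|apply rcont_const]. }
      rewrite <- CInt_plus; [|lra|intros; apply Hrc1|intros; apply rcont_const].
      rewrite <- CInt_scal; [|lra|intros; apply rcont_plus; [apply Hrc1|apply rcont_const]].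
      apply CInt_ext; [lra|]. intros t _. unfold u.
      destruct (Hhom 0 t) as [_ Hne]; [lra|].
      assert (EE : hom z r e 0 t = (z + RtoC e * cis t)%C).
      { unfold hom, cis; by_components. }
      rewrite EE in *.
      replace (hom_t r e 0 t) with (Ci * ((z + RtoC e * cis t) - z))%C.
      2:{ unfold hom_t, cis, Ci; by_components. }
      field. apply Csub_neq_0, Hne. }
    rewrite E1, E2 in H.
    assert (H' : LHS = (CInt (fun t => f (z + RtoC e * cis t) + - f z) 0 (2 * PI) + RtoC (2 * PI) * f z)%C).
    { assert (HCi : Ci <> 0%C) by (intros E; apply (f_equal Cmod) in E; rewrite Cmod_Ci, Cmod_0 in E; lra).
      transitivity (/ Ci * (Ci * LHS))%C; [field; assumption|]. rewrite H. field; assumption. }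
    rewrite H'.
    match goal with |- Cmod ?x <= _ => replace x with (CInt (fun t => f (z + RtoC e * cis t) + - f z)%C 0 (2 * PI)) by ring end.
    eapply Rle_trans.
    - apply (CInt_bound _ _ _ (eps / (4 * PI))); [lra| |].
      + intros t _. apply rcont_plus; [apply Hrc0|apply rcont_const].
      + intros t _. apply Rlt_le. apply Hcont.
        replace (z + RtoC e * cis t - z)%C with (RtoC e * cis t)%C by ring.
        rewrite Cmod_mult, Cmod_R, Cmod_cis, Rabs_right; lra.
    - apply Req_le. field. lra. }
  assert (H0 : Cmod (LHS - RtoC (2 * PI) * f z) <= 0).
  { apply le_epsilon. intros eps He. rewrite Rplus_0_l. auto. }
  assert (H1 : (LHS - RtoC (2 * PI) * f z)%C = 0%C).
  { apply Cmod_eq_0. pose proof (Cmod_ge_0 (LHS - RtoC (2 * PI) * f z)). lra. }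
  change (LHS = RtoC (2 * PI) * f z)%C. transitivity ((LHS - RtoC (2 * PI) * f z) + RtoC (2 * PI) * f z)%C; [ring|].
  rewrite H1. ring.
Qed.

(** Integrate [f] against the finite expansion zeta / (zeta - z) = 1 + z / zeta + z^2 / zeta^2 + z^3
    / (zeta^2 (zeta - z)). Order two is what the sequel needs: [c1] yields the derivative of a sum
    of functions, [c2] the derivative at [a] of f z / (z - a). In the remainder one factor 2 is that
    of [CInt_bound], the other comes from |zeta - z| >= r / 2. *)
Lemma taylor0 (M : R) : (forall w, Cmod w = r -> Cmod (f w) <= M) ->
  exists c1 c2, Cmod c1 <= 2 * M / r /\ Cmod c2 <= 2 * M / r^2 /\
    forall z, Cmod z <= r / 2 -> Cmod (f z - f 0 - c1 * z - c2 * (z * z))%C <= 4 * M / r^3 * Cmod z ^ 3.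
Proof.
  intros HM.
  assert (Hpi := PI_RGT_0).
  set (ze := fun t => (RtoC r * cis t)%C) in *.
  assert (Hzm : forall t, Cmod (ze t) = r) by apply Cmod_r_cis.
  assert (Hzn : forall t, ze t <> 0%C) by (intros t; apply Cmod_gt_0; rewrite Hzm; lra).
  assert (Hcf : forall t, rcont (fun t => f (ze t)) t) by apply rcont_circle.
  assert (Hcz : forall t, rcont ze t) by (intros; apply rcont_mult; [apply rcont_const|apply rcont_cis]).
  assert (H0r : Cmod 0 < r) by (rewrite Cmod_0; lra).
  assert (Hci : forall t, rcont (fun t => / (ze t - 0))%C t) by (intros; apply rcont_inv_circle; assumption).
  set (g1 := fun t => (f (ze t) * / (ze t - 0))%C).
  set (g2 := fun t => (g1 t * / (ze t - 0))%C).
  assert (Hg1 : forall t, rcont g1 t) by (intros; apply rcont_mult; auto).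
  assert (Hg2 : forall t, rcont g2 t) by (intros; apply rcont_mult; auto).
  assert (Mg1 : forall t, Cmod (g1 t) <= M / r).
  { intros t. unfold g1. rewrite Cmod_mult, Cmod_inv by (apply circle_neq; assumption).
    replace (ze t - 0)%C with (ze t) by ring. rewrite Hzm.
    apply Rmult_le_compat_r; [apply Rinv_nonneg; lra|]. apply HM, Hzm. }
  assert (Mg2 : forall t, Cmod (g2 t) <= M / r^2).
  { intros t. unfold g2. rewrite Cmod_mult, Cmod_inv by (apply circle_neq; assumption).
    replace (ze t - 0)%C with (ze t) by ring. rewrite Hzm.
    replace (M / r^2) with (M / r * / r) by (field; lra).
    apply Rmult_le_compat_r; [apply Rinv_nonneg; lra|]. apply Mg1. }
  assert (H2pi : RtoC (2 * PI) <> 0%C) by (intros E; apply RtoC_inj in E; lra).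
  assert (Hscale : forall (x : C) (y : R), Cmod x <= 2 * y * (2 * PI - 0) -> Cmod (x / RtoC (2 * PI)) <= 2 * y).
  { intros x y Hx. rewrite Cmod_div, Cmod_R, Rabs_right by (try lra; assumption). apply Rle_div_l; lra. }
  exists (CInt g1 0 (2 * PI) / RtoC (2 * PI))%C, (CInt g2 0 (2 * PI) / RtoC (2 * PI))%C.
  split; [|split].
  - replace (2 * M / r) with (2 * (M / r)) by (field; lra). apply Hscale.
    apply CInt_bound; auto; lra.
  - replace (2 * M / r^2) with (2 * (M / r^2)) by (field; lra). apply Hscale.
    apply CInt_bound; auto; lra.
  - intros z Hz.
    assert (Hzr : Cmod z < r) by lra.
    pose proof (cauchy_formula z Hzr) as Fz.
    pose proof (cauchy_formula 0 H0r) as F0.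
    change (fun t => f (RtoC r * cis t) * (RtoC r * cis t) * / (RtoC r * cis t - z))%C with
       (fun t => f (ze t) * ze t * / (ze t - z))%C in Fz.
    change (fun t => f (RtoC r * cis t) * (RtoC r * cis t) * / (RtoC r * cis t - 0))%C with
       (fun t => f (ze t) * ze t * / (ze t - 0))%C in F0.
    assert (Hcz' : forall t, rcont (fun t => / (ze t - z))%C t) by (intros; apply rcont_inv_circle; assumption).
    set (g0 := fun t => (f (ze t) * ze t * / (ze t - 0))%C) in *.
    set (g3 := fun t => (g2 t * / (ze t - z))%C).
    assert (Hg0 : forall t, rcont g0 t) by (intros; apply rcont_mult; [apply rcont_mult|]; auto).
    assert (Hg3 : forall t, rcont g3 t) by (intros; apply rcont_mult; auto).
    assert (E : CInt (fun t => f (ze t) * ze t * / (ze t - z))%C 0 (2 * PI) =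
      (CInt g0 0 (2 * PI) + z * CInt g1 0 (2 * PI) + (z * z) * CInt g2 0 (2 * PI) + (z * z * z) * CInt g3 0 (2 * PI))%C).
    { assert (Hs : forall c g, (forall t, rcont g t) -> forall t, rcont (fun t => c * g t)%C t).
      { intros c g Hg t. apply rcont_mult; [apply rcont_const|apply Hg]. }
      rewrite <- !CInt_scal by (try lra; auto).
      rewrite <- CInt_plus; [|lra|auto|auto].
      rewrite <- CInt_plus; [|lra| |auto].
      2:{ intros; apply rcont_plus; [auto|apply Hs; auto]. }
      rewrite <- CInt_plus; [|lra| |intros; apply Hs; auto].
      2:{ intros; apply rcont_plus; [apply rcont_plus; [auto|apply Hs; auto]|apply Hs; auto]. }
      apply CInt_ext; [lra|]. intros t _. unfold g3, g2, g1, g0.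
      pose proof (circle_neq z t Hzr) as N1. fold (ze t) in N1.
      pose proof (Hzn t) as N2.
      replace (ze t - 0)%C with (ze t) by ring.
      field. split; assumption. }
    rewrite Fz, F0 in E.
    replace (f z - f 0 - CInt g1 0 (2 * PI) / RtoC (2 * PI) * z - CInt g2 0 (2 * PI) / RtoC (2 * PI) * (z * z))%C
      with ((z * z * z) * CInt g3 0 (2 * PI) / RtoC (2 * PI))%C.
    2:{ transitivity ((RtoC (2 * PI) * f z) / RtoC (2 * PI) - f 0 - CInt g1 0 (2 * PI) / RtoC (2 * PI) * z - CInt g2 0 (2 * PI) / RtoC (2 * PI) * (z * z))%C.
        - rewrite E. field. assumption.
        - field. assumption. }
    replace (4 * M / r^3 * Cmod z ^ 3) with (2 * (2 * M / r^3 * Cmod z ^ 3)) by (field; lra).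
    apply Hscale.
    rewrite !Cmod_mult.
    assert (B3 : Cmod (CInt g3 0 (2 * PI)) <= 2 * (2 * M / r^3) * (2 * PI - 0)).
    { apply CInt_bound; [lra|auto|]. intros t _. unfold g3.
      rewrite Cmod_mult, Cmod_inv by (apply circle_neq; assumption).
      assert (Hge : r / 2 <= Cmod (ze t - z)).
      { pose proof (Cmod_sub_ge (ze t) z) as Hge. rewrite Hzm in Hge. lra. }
      replace (2 * M / r^3) with (M / r^2 * / (r / 2)) by (field; lra).
      apply Rmult_le_compat; [apply Cmod_ge_0| |apply Mg2|].
      - apply Rinv_nonneg; lra.
      - apply Rinv_le_contravar; lra. }
    pose proof (Cmod_ge_0 z).
    replace (Cmod z * Cmod z * Cmod z) with (Cmod z ^ 3) by ring.
    replace (2 * (2 * M / r ^ 3 * Cmod z ^ 3) * (2 * PI - 0)) with (Cmod z ^ 3 * (2 * (2 * M / r ^ 3) * (2 * PI - 0))) by ring.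
    apply Rmult_le_compat_l; [apply pow_le; assumption|exact B3].
Qed.
End Cauchy.

Lemma taylor (f : C -> C) (a : C) (r M : R) : 0 < r ->
  (forall w, Cmod (w - a)%C <= r -> exists l, cderiv f w l) ->
  (forall w, Cmod (w - a)%C = r -> Cmod (f w) <= M) ->
  exists c1 c2, Cmod c1 <= 2 * M / r /\ Cmod c2 <= 2 * M / r^2 /\
    forall z, Cmod (z - a)%C <= r / 2 ->
      Cmod (f z - f a - c1 * (z - a) - c2 * ((z - a) * (z - a)))%C <= 4 * M / r^3 * Cmod (z - a)%C ^ 3.
Proof.
  intros Hr Hf HM.
  assert (Hs : forall w, (a + w - a)%C = w) by (intros; ring).
  destruct (taylor0 (fun w => f (a + w)%C) r Hr) with (M := M) as [c1 [c2 [H1 [H2 H3]]]].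
  - intros w Hw. destruct (Hf (a + w)%C) as [l Hl]; [rewrite Hs; assumption|].
    exists l. intros eps He. destruct (Hl eps He) as [d [Hd H]]. exists d; split; [assumption|].
    intros x Hx. specialize (H (a + x)%C).
    replace (a + x - (a + w))%C with (x - w)%C in H by ring. auto.
  - intros w Hw. apply HM. rewrite Hs. assumption.
  - exists c1, c2. split; [assumption|]. split; [assumption|]. intros z Hz.
    specialize (H3 (z - a)%C Hz).
    replace (a + (z - a))%C with z in H3 by ring. replace (a + 0)%C with a in H3 by ring. exact H3.
Qed.

(** * Growth classes and division by linear factors *)

Lemma exp_nonneg x : 0 <= exp x.
Proof. apply Rlt_le, exp_pos. Qed.

(** * Complex series with a summable real majorant *)

Definition Csum (u : nat -> C) : C := (Series (fun k => Re (u k)), Series (fun k => Im (u k))).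

Lemma dominated_ex_series (u : nat -> C) (m : nat -> R) :
  (forall k, Cmod (u k) <= m k) -> ex_series m ->
  ex_series (fun k => Re (u k)) /\ ex_series (fun k => Im (u k)).
Proof.
  intros H Hm. split; apply (ex_series_le (V := R_CompleteNormedModule) _ m); auto; intros k;
  eapply Rle_trans; try apply H; [apply re_le_Cmod|apply im_le_Cmod].
Qed.

Lemma Series_dominated (u m : nat -> R) : (forall k, Rabs (u k) <= m k) -> ex_series m ->
  Rabs (Series u) <= Series m.
Proof.
  intros H Hm. eapply Rle_trans; [apply Series_Rabs|].
  - apply (ex_series_le (V := R_CompleteNormedModule) _ m); auto. intros k.
    unfold norm; simpl; unfold abs; simpl. rewrite Rabs_Rabsolu. apply H.
  - apply Series_le; auto. intros k. split; [apply Rabs_pos|apply H].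
Qed.

Lemma Csum_bound (u : nat -> C) (m : nat -> R) :
  (forall k, Cmod (u k) <= m k) -> ex_series m -> Cmod (Csum u) <= 2 * Series m.
Proof.
  intros H Hm. eapply Rle_trans; [apply Cmod_le_components|]. unfold Csum; simpl.
  assert (H1 : Rabs (Series (fun k => Re (u k))) <= Series m).
  { apply Series_dominated; auto. intros k. eapply Rle_trans; [apply re_le_Cmod|apply H]. }
  assert (H2 : Rabs (Series (fun k => Im (u k))) <= Series m).
  { apply Series_dominated; auto. intros k. eapply Rle_trans; [apply im_le_Cmod|apply H]. }
  lra.
Qed.

Lemma Csum_minus (u v : nat -> C) (m p : nat -> R) :
  (forall k, Cmod (u k) <= m k) -> ex_series m -> (forall k, Cmod (v k) <= p k) -> ex_series p ->
  Csum (fun k => u k - v k)%C = (Csum u - Csum v)%C.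
Proof.
  intros H Hm H' Hp.
  destruct (dominated_ex_series u m H Hm). destruct (dominated_ex_series v p H' Hp).
  unfold Csum. apply injective_projections; simpl;
  [apply (Series_minus (fun k => Re (u k)) (fun k => Re (v k))) |
   apply (Series_minus (fun k => Im (u k)) (fun k => Im (v k)))]; assumption.
Qed.

Lemma Csum_scal_r (u : nat -> C) (m : nat -> R) (c : C) :
  (forall k, Cmod (u k) <= m k) -> ex_series m ->
  Csum (fun k => u k * c)%C = (Csum u * c)%C.
Proof.
  intros H Hm. destruct (dominated_ex_series u m H Hm) as [H1 H2].
  assert (E : forall a x, ex_series a -> ex_series (fun k => a k * x)).
  { intros a x Ha. apply (ex_series_scal_r). assumption. }
  destruct c as [x y]. unfold Csum. apply injective_projections; simpl.
  - rewrite <- !Series_scal_r.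
    apply (Series_minus (fun k => Re (u k) * x) (fun k => Im (u k) * y)); apply E; assumption.
  - rewrite <- !Series_scal_r.
    apply (Series_plus (fun k => Re (u k) * y) (fun k => Im (u k) * x)); apply E; assumption.
Qed.

Lemma Csum_incr (u : nat -> C) (m : nat -> R) :
  (forall k, Cmod (u k) <= m k) -> ex_series m ->
  Csum u = (u O + Csum (fun k => u (S k)))%C.
Proof.
  intros H Hm. destruct (dominated_ex_series u m H Hm) as [H1 H2].
  unfold Csum. apply injective_projections; simpl;
  rewrite Series_incr_1 by assumption; reflexivity.
Qed.

Lemma Csum_ext (u v : nat -> C) : (forall k, u k = v k) -> Csum u = Csum v.
Proof.
  intros H. unfold Csum. f_equal; apply Series_ext; intros k; rewrite H; reflexivity.
Qed.

Lemma Series_zero : Series (fun _ : nat => 0) = 0.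
Proof.
  transitivity (Series (fun _ : nat => 0 * 0)).
  - apply Series_ext. intros; ring.
  - rewrite Series_scal_l. ring.
Qed.

Lemma Csum_0 : Csum (fun _ => 0%C) = 0%C.
Proof.
  unfold Csum. simpl. rewrite Series_zero. reflexivity.
Qed.

Lemma Csum_single (j : nat) : forall (u : nat -> C) (m : nat -> R),
  (forall k, Cmod (u k) <= m k) -> ex_series m ->
  (forall k, k <> j -> u k = 0%C) -> Csum u = u j.
Proof.
  induction j as [|j IH]; intros u m H Hm Hz; rewrite (Csum_incr u m H Hm).
  - rewrite (Csum_ext _ (fun _ => 0%C)), Csum_0; [ring|]. intros k. apply Hz. lia.
  - rewrite Hz by lia. rewrite (IH (fun k => u (S k)) (fun k => m (S k))).
    + ring.
    + intros; apply H.
    + apply ex_series_incr_1 in Hm. exact Hm.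
    + intros k Hk. apply Hz. lia.
Qed.

(** Telescoping: [s n] is what is left of [s O] after subtracting n terms. It serves both the limit
    of nested balls and the successive approximation of given data. *)
Lemma Csum_partial (u : nat -> C) (m : nat -> R) (s : nat -> C) :
  (forall k, Cmod (u k) <= m k) -> ex_series m ->
  (forall k, s (S k) = s k - u k)%C ->
  forall n, (s O - Csum u = s n - Csum (fun k => u (n + k)%nat))%C.
Proof.
  intros H Hm Hs n. induction n as [|n IH]; [reflexivity|].
  rewrite IH, Hs. rewrite (Csum_incr (fun k => u (n + k)%nat) (fun k => m (n + k)%nat)).
  - rewrite Nat.add_0_r. rewrite (Csum_ext (fun k => u (n + S k)%nat) (fun k => u (S n + k)%nat)).
    + ring.
    + intros k. f_equal. lia.
  - intros; apply H.
  - apply (ex_series_incr_n (V := R_NormedModule) m n) in Hm. exact Hm.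
Qed.

(** * Functions of controlled growth and the constants of a weight *)

Definition holo (f : C -> C) : Prop := forall z, disk z -> exists l, cderiv f z l.

(** A ball in a normed space of holomorphic functions; [A_fun] is the union of these over [M] and
    over B > 0. Constant and exponent are explicit because bounds uniform over families of functions
    are needed. *)
Definition hgrow (phi : C -> R) (M B : R) (f : C -> C) : Prop :=
  holo f /\ forall z, disk z -> Cmod (f z) <= M * exp (B * phi z).

Lemma A_fun_hgrow phi f : A_fun phi f <-> exists M B, 0 < B /\ hgrow phi M B f.
Proof.
  unfold A_fun. rewrite holomorphic_cderiv. split.
  - intros [Hf [B [HB [M HM]]]]. exists M, B. split; [assumption|]. split; [assumption|].
    intros z Hz. specialize (HM z Hz).
    apply (Rmult_le_compat_r (exp (B * phi z))) in HM; [|apply exp_nonneg].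
    rewrite Rmult_assoc, <- exp_plus in HM.
    replace (- B * phi z + B * phi z) with 0 in HM by ring. rewrite exp_0 in HM. lra.
  - intros [M [B [HB [Hf HM]]]]. split; [assumption|]. exists B. split; [assumption|]. exists M.
    intros z Hz. specialize (HM z Hz).
    apply (Rmult_le_compat_r (exp (- B * phi z))) in HM; [|apply exp_nonneg].
    rewrite Rmult_assoc, <- exp_plus in HM.
    replace (B * phi z + - B * phi z) with 0 in HM by ring. rewrite exp_0 in HM. lra.
Qed.

Lemma hgrow_nonneg phi M B f : hgrow phi M B f -> 0 <= M.
Proof.
  intros [_ H]. assert (H0 : disk 0) by (unfold disk; rewrite Cmod_0; lra).
  specialize (H _ H0). pose proof (Cmod_ge_0 (f 0)). pose proof (exp_pos (B * phi 0)).
  destruct (Rle_lt_dec 0 M); [assumption|]. nra.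
Qed.

(** The form in which the weight conditions are used: the first one in exponential form, the second
    one on a Euclidean disk of radius proportional to 1 - |z|, in both directions and with a single
    constant [D]. *)
Definition wconst (phi : C -> R) (kap c D : R) : Prop :=
  (forall z, disk z -> 0 <= phi z) /\ 0 < kap /\ 0 < c < 1 /\ 1 <= D /\
  (forall z, disk z -> exp (- kap * phi z) <= 1 - Cmod z) /\
  (forall z w, disk z -> Cmod (w - z)%C <= c * (1 - Cmod z) ->
    disk w /\ phi w <= D * phi z + D /\ phi z <= D * phi w + D).

Lemma Cmod_one_minus_conj x y : disk x -> disk y ->
  1 - Cmod x <= Cmod (1 - Cconj x * y)%C /\ 1 - Cmod y <= Cmod (1 - Cconj x * y)%C.
Proof.
  unfold disk. intros Hx Hy. pose proof (Cmod_sub_ge 1 (Cconj x * y)) as H.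
  rewrite Cmod_1, Cmod_mult, Cmod_conj in H.
  pose proof (Cmod_ge_0 x). pose proof (Cmod_ge_0 y). split; nra.
Qed.

(** Since |1 - conj z w| >= 1 - |z|, the Euclidean disk of radius c (1 - |z|) about [z] lies in the
    pseudo-hyperbolic disk of radius [c]. The two comparisons of weights use the distance in either
    order of its arguments. *)
Lemma weight_wconst phi : weight phi -> exists kap c D, wconst phi kap c D.
Proof.
  intros [Hp [[K [HK H1]] [c [D0 [E0 [Hc [HD0 [HE0 H2]]]]]]]].
  exists (/ K), c, (Rmax 1 (Rmax D0 E0)).
  assert (HM1 := Rmax_l 1 (Rmax D0 E0)). assert (HM2 := Rmax_r 1 (Rmax D0 E0)).
  assert (HM3 := Rmax_l D0 E0). assert (HM4 := Rmax_r D0 E0).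
  set (D := Rmax 1 (Rmax D0 E0)) in *.
  split; [assumption|]. split; [apply Rinv_0_lt_compat; assumption|]. split; [assumption|].
  split; [assumption|]. split.
  - intros z Hz. specialize (H1 z Hz). unfold disk in Hz.
    unfold Rdiv in H1. rewrite Rmult_1_l, ln_Rinv in H1 by lra.
    rewrite <- (exp_ln (1 - Cmod z)) at 1 by lra.
    assert (Hle : - / K * phi z <= ln (1 - Cmod z)).
    { apply (Rmult_le_reg_l K); [assumption|].
      replace (K * (- / K * phi z)) with (- phi z) by (field; lra). lra. }
    destruct Hle as [Hle| ->]; [left; apply exp_increasing; assumption|right; reflexivity].
  - intros z w Hz Hw. unfold disk in Hz.
    assert (Hdw : disk w).
    { unfold disk. pose proof (Cmod_triangle (w - z) z). replace (w - z + z)%C with w in H by ring. nra. }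
    split; [assumption|].
    assert (Hr : rho w z <= c /\ rho z w <= c).
    { unfold rho. split.
      - destruct (Cmod_one_minus_conj z w Hz Hdw) as [Hd _].
        rewrite Cmod_div by (apply Cmod_gt_0; lra). apply Rle_div_l; [lra|]. nra.
      - destruct (Cmod_one_minus_conj w z Hdw Hz) as [_ Hd].
        rewrite Cmod_div by (apply Cmod_gt_0; lra). apply Rle_div_l; [lra|].
        rewrite Cmod_sub_sym. nra. }
    destruct Hr as [Hr1 Hr2].
    pose proof (H2 w z Hdw Hz Hr1). pose proof (H2 z w Hz Hdw Hr2).
    pose proof (Hp z Hz). pose proof (Hp w Hdw). split; nra.
Qed.

Lemma exp_le x y : x <= y -> exp x <= exp y.
Proof. intros [H| ->]; [left; apply exp_increasing; assumption|right; reflexivity]. Qed.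

Lemma exp_ge_1 x : 0 <= x -> 1 <= exp x.
Proof. intros H. rewrite <- exp_0. apply exp_le, H. Qed.

(* Taylor's formula makes the termwise derivatives summable. *)
Lemma weierstrass {phi kap c D} (Hw : wconst phi kap c D) (f : nat -> C -> C) (m : nat -> R) (B : R) :
  0 <= B -> (forall k, hgrow phi (m k) B (f k)) -> ex_series m ->
  hgrow phi (2 * Series m) B (fun z => Csum (fun k => f k z)).
Proof.
  intros HB Hf Hm. destruct Hw as (Hp & Hk & Hc & HD & Hw1 & Hw2).
  assert (Hm0 : forall k, 0 <= m k) by (intros k; eapply hgrow_nonneg, Hf).
  assert (Es : forall x, ex_series (fun k => m k * x)).
  { intros x. apply (ex_series_scal_r). assumption. }
  split.
  2:{ intros z Hz. rewrite Rmult_assoc, <- Series_scal_r.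
      apply Csum_bound; [|apply Es]. intros k. apply Hf, Hz. }
  intros a Ha.
  set (r := c * (1 - Cmod a)).
  assert (Hr : 0 < r) by (unfold r, disk in *; apply Rmult_lt_0_compat; lra).
  (* On the disk of radius [r] about [a] the weight is at most D * phi a + D, so a single [W] bounds
     all terms up to their factors [m k]. *)
  set (W := exp (B * (D * phi a + D))).
  assert (HW : 0 < W) by apply exp_pos.
  assert (Hb : forall k w, Cmod (w - a)%C <= r -> disk w /\ Cmod (f k w) <= m k * W).
  { intros k w Hwr. destruct (Hw2 a w Ha Hwr) as [H1 [H2 H3]]. split; [assumption|].
    eapply Rle_trans; [apply Hf; assumption|]. apply Rmult_le_compat_l; [apply Hm0|].
    apply exp_le, Rmult_le_compat_l; assumption. }
  assert (Hex : forall k, exists c1, Cmod c1 <= m k * (2 * W / r) /\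
     forall z, Cmod (z - a)%C <= r / 2 -> Cmod (f k z - f k a - c1 * (z - a))%C <= m k * (4 * W / r^2 * Cmod (z - a)%C ^2)).
  { intros k. destruct (taylor (f k) a r (m k * W) Hr) as [c1 [c2 [H1 [H2 H3]]]].
    - intros w Hwr. apply Hf, (Hb k w Hwr).
    - intros w Hwr. apply (Hb k w). lra.
    - exists c1. split; [replace (m k * (2 * W / r)) with (2 * (m k * W) / r) by (field; lra); assumption|].
      intros z Hz. specialize (H3 z Hz).
      set (x := Cmod (z - a)) in *. assert (Hx : 0 <= x) by apply Cmod_ge_0.
      assert (Hmw : 0 <= m k * W) by (apply Rmult_le_pos; [auto|lra]).
      replace (f k z - f k a - c1 * (z - a))%C with
        ((f k z - f k a - c1 * (z - a) - c2 * ((z - a) * (z - a))) + c2 * ((z - a) * (z - a)))%C by ring.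
      eapply Rle_trans; [apply Cmod_triangle|]. rewrite !Cmod_mult. fold x.
      assert (K1 : Cmod c2 * (x * x) <= 2 * (m k * W) / r^2 * (x * x)).
      { apply Rmult_le_compat_r; [nra|assumption]. }
      assert (K2 : 4 * (m k * W) / r^3 * x^3 <= 4 * (m k * W) / r^3 * (r / 2 * x^2)).
      { apply Rmult_le_compat_l.
        - apply Rmult_le_pos; [lra|]. apply Rinv_nonneg, pow_lt; lra.
        - replace (x^3) with (x * x^2) by ring. apply Rmult_le_compat_r; [apply pow_le; lra|assumption]. }
      replace (4 * (m k * W) / r^3 * (r / 2 * x^2)) with (2 * (m k * W) / r^2 * (x*x)) in K2 by (field; lra).
      replace (m k * (4 * W / r^2 * x^2)) with (2 * (m k * W) / r^2 * (x*x) + 2 * (m k * W) / r^2 * (x*x)) by (field; lra).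
      lra. }
  destruct (functional_choice _ Hex) as [c1 Hc1].
  exists (Csum c1). intros eps Heps.
  set (S := Series m). assert (HS : 0 <= S).
  { unfold S. rewrite <- Series_zero. apply Series_le; [|assumption]. intros; split; [lra|apply Hm0]. }
  set (Q := 2 * S * (4 * W / r^2)).
  assert (HQ : 0 <= Q).
  { unfold Q. apply Rmult_le_pos; [lra|]. apply Rmult_le_pos; [lra|]. apply Rinv_nonneg, pow_lt; lra. }
  exists (Rmin (r / 2) (eps / (Q + 1))). split.
  { apply Rmin_pos; [lra|]. apply Rdiv_lt_0_compat; lra. }
  intros w Hwd.
  destruct (Rlt_Rmin _ _ _ Hwd) as [G1 G2].
  rewrite <- (Csum_minus (fun k => f k w) (fun k => f k a) (fun k => m k * W) (fun k => m k * W)); try apply Es.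
  2:{ intros k. apply Hb. lra. }
  2:{ intros k. apply Hb. rewrite Cmod_diag. lra. }
  rewrite <- (Csum_scal_r c1 (fun k => m k * (2 * W / r)) (w - a)%C); [|intros; apply Hc1|apply Es].
  rewrite <- (Csum_minus (fun k => f k w - f k a)%C (fun k => c1 k * (w - a))%C
     (fun k => m k * (2 * W)) (fun k => m k * (2 * W / r * Cmod (w - a)))); try apply Es.
  2:{ intros k. eapply Rle_trans; [apply Cmod_sub_le|]. 
      assert (Cmod (f k w) <= m k * W) by (apply Hb; lra).
      assert (Cmod (f k a) <= m k * W) by (apply Hb; rewrite Cmod_diag; lra). lra. }
  2:{ intros k. rewrite Cmod_mult, <- Rmult_assoc. apply Rmult_le_compat_r; [apply Cmod_ge_0|apply Hc1]. }
  eapply Rle_trans.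
  { apply (Csum_bound _ (fun k => m k * (4 * W / r^2 * Cmod (w - a)%C ^2))); [|apply Es].
    intros k. apply Hc1. lra. }
  rewrite Series_scal_r. fold S.
  pose proof (Cmod_ge_0 (w - a)) as Hx0. set (x := Cmod (w - a)) in *.
  replace (2 * (S * (4 * W / r ^ 2 * x ^ 2))) with (Q * x * x) by (unfold Q; field; lra).
  apply Rmult_le_compat_r; [assumption|].
  apply Rle_trans with ((Q + 1) * (eps / (Q + 1))).
  - apply Rmult_le_compat; lra.
  - apply Req_le. field. lra.
Qed.

(** Within r / 2 of [a] the quotient is estimated by the Taylor expansion, further away by |z - a|
    >= r / 2. The loss is of order 1 / r with r = c (1 - |a|), hence the factor exp (kap * phi a).
    Near [a] the weight is transferred twice, from the circle to [a] and from [a] to [z], hence the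
    exponent B * D * D. *)
Lemma div_zero {phi kap c D} (Hw : wconst phi kap c D) (B : R) : 0 <= B ->
  exists B' K', 0 <= B' /\ 0 < K' /\ forall f M a, disk a -> hgrow phi M B f -> f a = 0%C ->
    exists g, hgrow phi (M * K' * exp (kap * phi a)) B' g /\ forall z, f z = ((z - a) * g z)%C.
Proof.
  intros HB. destruct Hw as (Hp & Hk & Hc & HD & Hw1 & Hw2).
  exists (B * D * D), (4 / c * exp (B * D * D + B * D)).
  assert (H4c : 0 < 4 / c) by (apply Rdiv_lt_0_compat; lra).
  assert (HBD : 0 <= B * D) by (apply Rmult_le_pos; lra).
  assert (HBDD : 0 <= B * D * D) by (apply Rmult_le_pos; lra).
  split; [assumption|].
  split. { apply Rmult_lt_0_compat; [assumption|apply exp_pos]. }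
  intros f M a Ha Hf Hfa.
  pose proof (hgrow_nonneg _ _ _ _ Hf) as HM. destruct Hf as [Hf Hfb].
  set (r := c * (1 - Cmod a)).
  assert (Hr : 0 < r) by (unfold r, disk in *; apply Rmult_lt_0_compat; lra).
  assert (Hrinv : / r <= / c * exp (kap * phi a)).
  { unfold r. rewrite Rinv_mult. apply Rmult_le_compat_l; [apply Rinv_nonneg; lra|].
    replace (kap * phi a) with (- (- kap * phi a)) by ring. rewrite exp_Ropp.
    apply Rinv_le_contravar; [apply exp_pos|auto]. }
  set (W := M * exp (B * (D * phi a + D))).
  assert (HW : 0 <= W) by (apply Rmult_le_pos; [assumption|apply exp_nonneg]).
  destruct (taylor f a r W Hr) as [c1 [c2 [H1 [H2 H3]]]].
  - intros w Hwr. apply Hf, (Hw2 a w Ha Hwr).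
  - intros w Hwr. destruct (Hw2 a w Ha (Req_le _ _ Hwr)) as [G1 [G2 G3]].
    eapply Rle_trans; [apply Hfb; assumption|]. apply Rmult_le_compat_l; [assumption|].
    apply exp_le, Rmult_le_compat_l; assumption.
  - rewrite Hfa in H3.
    (* The removable singularity is filled with the first Taylor coefficient; the second one is then
       the derivative of [g] at [a]. *)
    set (g := fun z => if excluded_middle_informative (z = a) then c1 else (f z / (z - a))%C).
    assert (Hga : g a = c1) by (unfold g; destruct (excluded_middle_informative (a = a)); congruence).
    assert (Hgz : forall z, z <> a -> g z = (f z / (z - a))%C)
      by (intros z Hz; unfold g; destruct (excluded_middle_informative (z = a)); congruence).
    clearbody g.
    assert (Hloc : forall z, Cmod (z - a)%C <= r / 2 -> Cmod (g z - c1 - c2 * (z - a))%C <= 4 * W / r^3 * Cmod (z - a)%C ^2).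
    { intros z Hz. destruct (classic (z = a)) as [->|Hne].
      - rewrite Hga. replace (c1 - c1 - c2 * (a - a))%C with (RtoC 0) by ring.
        rewrite Cmod_diag, Cmod_0. apply Req_le. ring.
      - rewrite Hgz by assumption. specialize (H3 z Hz).
        pose proof (Csub_neq_0 _ _ Hne) as Hn.
        replace (f z / (z - a) - c1 - c2 * (z - a))%C with
         ((f z - 0 - c1 * (z - a) - c2 * ((z - a) * (z - a))) / (z - a))%C by (field; assumption).
        rewrite Cmod_div by assumption.
        pose proof (proj1 (Cmod_gt_0 _) Hn). apply Rle_div_l; [lra|].
        replace (4 * W / r ^ 3 * Cmod (z - a) ^ 2 * Cmod (z - a)) with (4 * W / r ^ 3 * Cmod (z - a) ^ 3) by ring.
        assumption. }
    assert (HWr : 0 <= 4 * W / r ^ 3).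
    { apply Rmult_le_pos; [lra|]. apply Rinv_nonneg, pow_lt; lra. }
    exists g. split; [split|].
    + intros z Hz. destruct (classic (z = a)) as [->|Hne].
      * exists c2. intros eps Heps.
        exists (Rmin (r / 2) (eps / (4 * W / r^3 + 1))). split.
        { apply Rmin_pos; [lra|]. apply Rdiv_lt_0_compat; lra. }
        intros w Hwd.
        destruct (Rlt_Rmin _ _ _ Hwd) as [G1 G2].
        rewrite Hga. eapply Rle_trans; [apply Hloc; lra|].
        pose proof (Cmod_ge_0 (w - a)) as Hx0. set (x := Cmod (w - a)) in *.
        set (Q := 4 * W / r^3) in *.
        replace (Q * x ^ 2) with (Q * x * x) by ring. apply Rmult_le_compat_r; [assumption|].
        apply Rle_trans with ((Q + 1) * (eps / (Q + 1))).
        { apply Rmult_le_compat; lra. }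
        { apply Req_le. field. lra. }
      * destruct (Hf z Hz) as [l Hl]. destruct (cderiv_inv a z Hne) as [m Hm].
        eexists. apply (cderiv_ext_loc (fun w => f w * / (w - a))%C _ _ _ (Cmod (z - a))).
        { apply Cmod_gt_0, Csub_neq_0, Hne. }
        { intros w Hwz. rewrite Hgz; [reflexivity|]. intros E. subst w.
          rewrite Cmod_sub_sym in Hwz. lra. }
        { apply cderiv_mult; eassumption. }
    + intros z Hz.
      destruct (Rle_lt_dec (Cmod (z - a)) (r / 2)) as [Hn|Hfar].
      * destruct (Hw2 a z Ha) as [G1 [G2 G3]]; [fold r; lra|].
        specialize (Hloc z Hn).
        replace (g z) with ((g z - c1 - c2 * (z - a)) + (c1 + c2 * (z - a)))%C by ring.
        eapply Rle_trans; [apply Cmod_triangle|].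
        eapply Rle_trans; [apply Rplus_le_compat_l, Cmod_triangle|]. rewrite Cmod_mult.
        pose proof (Cmod_ge_0 (z - a)) as Hx0. set (x := Cmod (z - a)) in *.
        assert (K1 : 4 * W / r^3 * x^2 <= 4 * W / r^3 * (r/2)^2).
        { apply Rmult_le_compat_l; [assumption|]. apply pow_incr. lra. }
        replace (4 * W / r^3 * (r/2)^2) with (W / r) in K1 by (field; lra).
        assert (K2 : Cmod c2 * x <= 2 * W / r^2 * (r / 2)).
        { apply Rmult_le_compat; try assumption. apply Cmod_ge_0. }
        replace (2 * W / r^2 * (r / 2)) with (W / r) in K2 by (field; lra).
        apply Rle_trans with (4 * W * / r); [unfold Rdiv in *; lra|].
        apply Rle_trans with (4 * W * (/ c * exp (kap * phi a))).
        { apply Rmult_le_compat_l; lra. }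
        apply Rle_trans with (4 * (M * exp (B * D * D * phi z + (B * D * D + B * D))) * (/ c * exp (kap * phi a))).
        { apply Rmult_le_compat_r.
          - apply Rlt_le, Rmult_lt_0_compat; [apply Rinv_0_lt_compat; lra|apply exp_pos].
          - apply Rmult_le_compat_l; [lra|]. unfold W. apply Rmult_le_compat_l; [assumption|].
            apply exp_le.
            assert (B * D * phi a <= B * D * (D * phi z + D)) by (apply Rmult_le_compat_l; lra).
            lra. }
        rewrite exp_plus. apply Req_le. field. lra.
      * assert (Hne : z <> a).
        { intros E. subst z. rewrite Cmod_diag in Hfar. lra. }
        rewrite Hgz by assumption.
        rewrite Cmod_div by (apply Csub_neq_0; assumption).
        apply Rle_trans with (M * exp (B * phi z) * (2 * / r)).
        { apply Rmult_le_compat; [apply Cmod_ge_0|apply Rinv_nonneg; lra|auto|].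
          replace (2 * / r) with (/ (r / 2)) by (field; lra). apply Rinv_le_contravar; lra. }
        pose proof (Hp z Hz) as Hpz.
        assert (E1 : exp (B * phi z) <= exp (B * D * D * phi z)).
        { apply exp_le. apply Rmult_le_compat_r; [assumption|]. nra. }
        assert (E2 : 1 <= exp (B * D * D + B * D)) by (apply exp_ge_1; lra).
        apply Rle_trans with (M * exp (B * D * D * phi z) * (2 * (/ c * exp (kap * phi a)))).
        { apply Rmult_le_compat.
          - apply Rmult_le_pos; [assumption|apply exp_nonneg].
          - apply Rlt_le, Rmult_lt_0_compat; [lra|apply Rinv_0_lt_compat; lra].
          - apply Rmult_le_compat_l; assumption.
          - lra. }
        replace (M * (4 / c * exp (B * D * D + B * D)) * exp (kap * phi a) * exp (B * D * D * phi z)) with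
          (M * exp (B * D * D * phi z) * (2 * (/ c * exp (kap * phi a))) * (2 * exp (B * D * D + B * D))) by (field; lra).
        rewrite <- (Rmult_1_r (M * exp (B * D * D * phi z) * (2 * (/ c * exp (kap * phi a))))) at 1.
        apply Rmult_le_compat_l; [|lra].
        apply Rmult_le_pos; [apply Rmult_le_pos; [assumption|apply exp_nonneg]|].
        apply Rlt_le. apply Rmult_lt_0_compat; [lra|]. apply Rmult_lt_0_compat; [apply Rinv_0_lt_compat; lra|apply exp_pos].
    + intros z. destruct (classic (z = a)) as [->|Hne].
      * rewrite Hfa. ring.
      * rewrite Hgz by assumption. field. apply Csub_neq_0, Hne.
Qed.

(** * Divided differences *)

Definition shift (p : nat -> C) : nat -> C := fun i => p (S i).

Lemma Delta_ext (k : nat) : forall (w w' : C -> C) (p p' : nat -> C),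
  (forall i, (i <= k)%nat -> w (p i) = w' (p' i) /\ p i = p' i) -> Delta k w p = Delta k w' p'.
Proof.
  induction k as [|k IH]; intros w w' p p' H; simpl.
  - apply H; lia.
  - rewrite (IH w w' (fun i => p (S i)) (fun i => p' (S i))) by (intros i Hi; apply H; lia).
    rewrite (IH w w' p p') by (intros i Hi; apply H; lia).
    destruct (H (S k) (le_n _)) as [_ ->]. destruct (H O) as [_ ->]; [lia|]. reflexivity.
Qed.

Lemma Delta_minus (k : nat) : forall (w w' : C -> C) (p : nat -> C),
  Delta k (fun z => w z - w' z)%C p = (Delta k w p - Delta k w' p)%C.
Proof.
  induction k as [|k IH]; intros w w' p; simpl; [reflexivity|].
  rewrite !IH. unfold Cdiv. ring.
Qed.

Lemma Delta_scal (k : nat) : forall (c : C) (w : C -> C) (p : nat -> C),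
  Delta k (fun z => c * w z)%C p = (c * Delta k w p)%C.
Proof.
  induction k as [|k IH]; intros c w p; simpl; [reflexivity|].
  rewrite !IH. unfold Cdiv. ring.
Qed.

Definition inj_upto (k : nat) (p : nat -> C) : Prop :=
  forall i j, (i <= k)%nat -> (j <= k)%nat -> i <> j -> p i <> p j.

Lemma inj_upto_shift k p : inj_upto (S k) p -> inj_upto k (shift p).
Proof. intros H i j Hi Hj Hij. apply H; lia. Qed.

Lemma inj_upto_le k m p : (k <= m)%nat -> inj_upto m p -> inj_upto k p.
Proof. intros Hk H i j Hi Hj Hij. apply H; lia. Qed.

Lemma inj_upto_neq k p i j : inj_upto k p -> (i <= k)%nat -> (j <= k)%nat -> i <> j -> (p i - p j)%C <> 0%C.
Proof. intros H Hi Hj Hij. apply Csub_neq_0, H; assumption. Qed.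

Lemma Delta_const (k : nat) : forall (c : C) (p : nat -> C), Delta (S k) (fun _ => c) p = 0%C.
Proof.
  induction k as [|k IH]; intros c p.
  - simpl. unfold Cdiv. ring.
  - change (Delta (S (S k)) (fun _ => c) p) with
     ((Delta (S k) (fun _ => c) (shift p) - Delta (S k) (fun _ => c) p) / (p (S (S k)) - p O))%C.
    rewrite !IH. unfold Cdiv. ring.
Qed.

(** Leibniz rule: a linear factor has no differences beyond order one, so two terms remain. *)
Lemma Delta_leibniz (a : C) (h : C -> C) (k : nat) : forall p, inj_upto (S k) p ->
  Delta (S k) (fun z => (z - a) * h z)%C p = ((p O - a) * Delta (S k) h p + Delta k h (shift p))%C.
Proof.
  induction k as [|k IH]; intros p Hp.
  - pose proof (inj_upto_neq 1 p 1 0 Hp ltac:(lia) ltac:(lia) ltac:(lia)) as N1.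
    simpl. unfold shift. field. assumption.
  - assert (E : forall w, Delta (S (S k)) w p = ((Delta (S k) w (shift p) - Delta (S k) w p) / (p (S (S k)) - p O))%C) by reflexivity.
    rewrite !E, (IH (shift p) (inj_upto_shift _ _ Hp)), (IH p (inj_upto_le (S k) (S (S k)) p ltac:(lia) Hp)).
    assert (E2 : Delta (S k) h (shift p) = ((Delta k h (shift (shift p)) - Delta k h (shift p)) / (shift p (S k) - shift p O))%C) by reflexivity.
    pose proof (inj_upto_neq (S (S k)) p (S (S k)) 0 Hp ltac:(lia) ltac:(lia) ltac:(lia)) as N1.
    pose proof (inj_upto_neq (S (S k)) p (S (S k)) 1 Hp ltac:(lia) ltac:(lia) ltac:(lia)) as N2.
    assert (E3 : Delta k h (shift (shift p)) = ((p (S (S k)) - p 1%nat) * Delta (S k) h (shift p) + Delta k h (shift p))%C).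
    { rewrite E2. unfold shift. field. assumption. }
    rewrite E3. change (shift p O) with (p 1%nat). field. assumption.
Qed.

(** Splitting off a node as a difference quotient lowers the order by one. With [a] as the last
    node, the shifted tuple still ends in [a] and falls under the induction hypothesis; the other
    tuple omits [a] and is treated by the Leibniz rule, after subtracting the constant [w a]. No
    symmetry of divided differences is involved. *)
Lemma Delta_quot (w h : C -> C) (a : C) (k : nat) : forall p, inj_upto (S k) p -> p (S k) = a ->
  (forall i, (i <= k)%nat -> w (p i) = (w a + (p i - a) * h (p i))%C) ->
  Delta (S k) w p = Delta k h p.
Proof.
  induction k as [|k IH]; intros p Hp Ha Hw.
  - pose proof (inj_upto_neq 1 p 1 0 Hp ltac:(lia) ltac:(lia) ltac:(lia)) as N1.
    simpl. rewrite (Hw O) by lia. rewrite Ha in *. field. assumption.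
  - change (Delta (S (S k)) w p) with ((Delta (S k) w (shift p) - Delta (S k) w p) / (p (S (S k)) - p O))%C.
    pose proof (inj_upto_neq (S (S k)) p (S (S k)) 0 Hp ltac:(lia) ltac:(lia) ltac:(lia)) as N1.
    rewrite (IH (shift p)); [|apply inj_upto_shift; assumption|exact Ha|intros i Hi; apply (Hw (S i)); lia].
    rewrite (Delta_ext (S k) w (fun z => (z - a) * h z - (fun _ => - w a) z)%C p p).
    2:{ intros i Hi. split; [|reflexivity]. rewrite Hw by lia. ring. }
    rewrite Delta_minus, Delta_const, Delta_leibniz by (apply (inj_upto_le _ (S (S k))); [lia|assumption]).
    rewrite Ha in *. field. assumption.
Qed.

Lemma delta_Delta (k : nat) (w : C -> C) (p : nat -> C) : inj_upto (S k) p ->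
  (forall i, (i <= S k)%nat -> disk (p i)) ->
  delta (S k) w p = (Delta (S k) w p * (1 - Cconj (p O) * p (S k)))%C.
Proof.
  intros Hp Hd. simpl.
  pose proof (inj_upto_neq (S k) p (S k) 0 Hp ltac:(lia) ltac:(lia) ltac:(lia)) as N1.
  assert (N2 : (1 - Cconj (p O) * p (S k))%C <> 0%C).
  { apply Cmod_gt_0. destruct (Cmod_one_minus_conj (p O) (p (S k))) as [H _]; [apply Hd; lia|apply Hd; lia|].
    assert (H1 := Hd O ltac:(lia)). unfold disk in H1. lra. }
  unfold Cdiv. field. split; assumption.
Qed.

Lemma distinct_inj L k p : distinct_tuple L (S k) p -> inj_upto k p.
Proof. intros [_ H] i j Hi Hj. apply H; lia. Qed.

Lemma distinct_sub (L L' : C -> Prop) n p : (forall z, L z -> L' z) -> distinct_tuple L n p -> distinct_tuple L' n p.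
Proof. intros H [H1 H2]. split; auto. Qed.

Definition extend (n : nat) (p : nat -> C) (a : C) : nat -> C := fun i => if Nat.ltb i n then p i else a.

Lemma extend_lt n p a i : (i < n)%nat -> extend n p a i = p i.
Proof. intros H. unfold extend. destruct (Nat.ltb_spec i n); [reflexivity|lia]. Qed.

Lemma extend_last n p a : extend n p a n = a.
Proof. unfold extend. rewrite Nat.ltb_irrefl. reflexivity. Qed.

Lemma distinct_extend (L L' : C -> Prop) n p a : (forall z, L' z -> L z) -> L a -> ~ L' a ->
  distinct_tuple L' n p -> distinct_tuple L (S n) (extend n p a).
Proof.
  intros HLL Ha Ha' [H1 H2].
  assert (Hcase : forall i, (i < S n)%nat -> i = n \/ (i < n)%nat) by lia.
  split.
  - intros i Hi. destruct (Hcase i Hi) as [->|Hin]; [rewrite extend_last; assumption|].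
    rewrite extend_lt by assumption. auto.
  - intros i k Hi Hk Hik. destruct (Hcase i Hi) as [->|Hin]; destruct (Hcase k Hk) as [->|Hkn]; try lia;
    rewrite ?extend_last, ?extend_lt by assumption; auto;
    intros E; apply Ha'; [rewrite E|rewrite <- E]; auto.
Qed.

Definition wsum (phi : C -> R) (p : nat -> C) (k : nat) : R := sum_f_R0 (fun i => phi (p i)) k.

Lemma wsum_nonneg phi p k : (forall i, (i <= k)%nat -> 0 <= phi (p i)) -> 0 <= wsum phi p k.
Proof. intros H. unfold wsum. induction k as [|k IHk]; simpl; [apply H; lia|].
  pose proof (IHk (fun i Hi => H i (le_S _ _ Hi))). specialize (H (S k) (le_n _)). lra. Qed.

Lemma wsum_le phi p k i : (forall i, (i <= k)%nat -> 0 <= phi (p i)) -> (i <= k)%nat -> phi (p i) <= wsum phi p k.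
Proof.
  intros H Hi. unfold wsum. induction k as [|k IH].
  - replace i with O by lia. simpl. lra.
  - simpl. destruct (Nat.eq_dec i (S k)) as [->|Hne].
    + pose proof (wsum_nonneg phi p k (fun i Hi => H i (le_S _ _ Hi))). unfold wsum in H0. lra.
    + pose proof (IH (fun i Hi => H i (le_S _ _ Hi)) ltac:(lia)). specialize (H (S k) (le_n _)). lra.
Qed.

Lemma wsum_bound phi p k X : (forall i, (i <= k)%nat -> phi (p i) <= X) -> wsum phi p k <= INR (S k) * X.
Proof.
  intros H. unfold wsum. induction k as [|k IH].
  - simpl. specialize (H O (le_n _)). lra.
  - rewrite S_INR. simpl sum_f_R0. specialize (IH (fun i Hi => H i (le_S _ _ Hi))). specialize (H (S k) (le_n _)). lra.
Qed.

(** The Euclidean, quantitative form of [X_space], whose constants can be followed through sums,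
    limits and quotients. *)
Definition XD (phi : C -> R) (L : C -> Prop) (k : nat) (M B : R) (w : C -> C) : Prop :=
  forall p, distinct_tuple L (S k) p -> Cmod (Delta k w p) <= M * exp (B * wsum phi p k).

Lemma X_space_XD {phi kap c D} (Hw : wconst phi kap c D) L k w : (forall z, L z -> disk z) ->
  X_space phi L k w <-> exists M B, 0 <= M /\ 0 < B /\ XD phi L k M B w.
Proof.
  intros HL. destruct Hw as (Hp & Hk & Hc & HD & Hw1 & Hw2).
  assert (Hrw : forall x b s, x * exp (- b * s) = x / exp (b * s)).
  { intros x b s. replace (- b * s) with (- (b * s)) by ring. rewrite exp_Ropp. reflexivity. }
  split.
  - intros [B [HB [M HM]]].
    (* [kap] pays for the lower bound of |1 - conj (p O) p_k|. The absolute value is taken because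
       nothing fixes the sign of [M] when [L] has too few points for a tuple. *)
    exists (Rabs M), (B + kap). split; [apply Rabs_pos|]. split; [lra|].
    intros p Hpp. specialize (HM p Hpp).
    assert (Hpos : forall i, (i <= k)%nat -> 0 <= phi (p i)).
    { intros i Hi. apply Hp, HL. apply (proj1 Hpp). lia. }
    fold (wsum phi p k) in HM. rewrite Hrw in HM.
    apply Rle_div_l in HM; [|apply exp_pos].
    pose proof (wsum_nonneg phi p k Hpos) as Hs.
    pose proof (Rle_abs M) as HA.
    assert (He : exp (B * wsum phi p k) <= exp ((B + kap) * wsum phi p k)) by (apply exp_le; nra).
    assert (Pe := exp_pos (B * wsum phi p k)).
    destruct k as [|k].
    + simpl delta in HM. simpl Delta. apply Rle_trans with (1 := HM).
      apply Rmult_le_compat_r with (r := exp (B * wsum phi p 0)) in HA; [|lra].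
      eapply Rle_trans; [exact HA|]. apply Rmult_le_compat_l; [apply Rabs_pos|assumption].
    + rewrite delta_Delta, Cmod_mult in HM.
      2:{ apply (distinct_inj L), Hpp. }
      2:{ intros i Hi. apply HL, (proj1 Hpp). lia. }
      assert (Hd0 : disk (p O)) by (apply HL, (proj1 Hpp); lia).
      assert (Hdk : disk (p (S k))) by (apply HL, (proj1 Hpp); lia).
      assert (Hlow : exp (- kap * phi (p O)) <= Cmod (1 - Cconj (p O) * p (S k))).
      { eapply Rle_trans; [apply Hw1, Hd0|]. apply Cmod_one_minus_conj; assumption. }
      pose proof (exp_pos (- kap * phi (p O))) as Pk.
      assert (H1 : Cmod (Delta (S k) w p) * exp (- kap * phi (p O)) <= Rabs M * exp (B * wsum phi p (S k))).
      { eapply Rle_trans; [apply Rmult_le_compat_l; [apply Cmod_ge_0|exact Hlow]|].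
        eapply Rle_trans; [exact HM|]. apply Rmult_le_compat_r; lra. }
      rewrite Hrw in H1. apply (proj1 (Rle_div_l _ _ _ (exp_pos _))) in H1.
      eapply Rle_trans; [exact H1|]. rewrite Rmult_assoc, <- exp_plus.
      apply Rmult_le_compat_l; [apply Rabs_pos|]. apply exp_le.
      pose proof (wsum_le phi p (S k) O Hpos ltac:(lia)). nra.
  - intros [M [B [HM0 [HB HM]]]]. exists B. split; [assumption|]. exists (2 * M).
    intros p Hpp. specialize (HM p Hpp). fold (wsum phi p k). rewrite Hrw.
    apply Rle_div_l; [apply exp_pos|].
    assert (P1 : 0 <= M * exp (B * wsum phi p k)) by (apply Rmult_le_pos; [assumption|apply exp_nonneg]).
    destruct k as [|k]; [simpl delta; simpl Delta in HM; lra|].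
    rewrite delta_Delta, Cmod_mult.
    2:{ apply (distinct_inj L), Hpp. }
    2:{ intros i Hi. apply HL, (proj1 Hpp). lia. }
    assert (Hd0 : disk (p O)) by (apply HL, (proj1 Hpp); lia).
    assert (Hdk : disk (p (S k))) by (apply HL, (proj1 Hpp); lia).
    assert (Hup : Cmod (1 - Cconj (p O) * p (S k)) <= 2).
    { eapply Rle_trans; [apply Cmod_sub_le|]. rewrite Cmod_1, Cmod_mult, Cmod_conj. unfold disk in *.
      pose proof (Cmod_ge_0 (p O)). pose proof (Cmod_ge_0 (p (S k))). nra. }
    replace (2 * M * exp (B * wsum phi p (S k))) with (M * exp (B * wsum phi p (S k)) * 2) by ring.
    apply Rmult_le_compat; try apply Cmod_ge_0; assumption.
Qed.

(** * Divided differences of functions of controlled growth *)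

Lemma holo_const c : holo (fun _ => c).
Proof. intros z _. eexists. apply cderiv_const. Qed.

Lemma holo_plus f g : holo f -> holo g -> holo (fun z => f z + g z)%C.
Proof. intros Hf Hg z Hz. destruct (Hf z Hz), (Hg z Hz). eexists. apply cderiv_plus; eassumption. Qed.

Lemma holo_mult f g : holo f -> holo g -> holo (fun z => f z * g z)%C.
Proof. intros Hf Hg z Hz. destruct (Hf z Hz), (Hg z Hz). eexists. apply cderiv_mult; eassumption. Qed.

Lemma holo_lin a : holo (fun z => z - a)%C.
Proof. apply (holo_plus (fun z => z) (fun _ => - a)%C); [intros z _; eexists; apply cderiv_id|apply holo_const]. Qed.

Lemma hgrow_le phi M B M' B' f : (forall z, disk z -> 0 <= phi z) -> M <= M' -> B <= B' ->
  hgrow phi M B f -> hgrow phi M' B' f.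
Proof.
  intros Hp HM HB Hf. pose proof (hgrow_nonneg _ _ _ _ Hf). destruct Hf as [Hf Hb].
  split; [assumption|]. intros z Hz. eapply Rle_trans; [apply Hb, Hz|].
  apply Rmult_le_compat; [assumption|apply exp_nonneg|assumption|].
  apply exp_le, Rmult_le_compat_r; auto.
Qed.

Lemma hgrow_mult phi M B M' B' f g : hgrow phi M B f -> hgrow phi M' B' g ->
  hgrow phi (M * M') (B + B') (fun z => f z * g z)%C.
Proof.
  intros [Hf Hf'] [Hg Hg']. split; [apply holo_mult; assumption|].
  intros z Hz. rewrite Cmod_mult, Rmult_plus_distr_r, exp_plus.
  replace (M * M' * (exp (B * phi z) * exp (B' * phi z))) with
    ((M * exp (B * phi z)) * (M' * exp (B' * phi z))) by ring.
  apply Rmult_le_compat; try apply Cmod_ge_0; auto.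
Qed.

Lemma hgrow_plus phi M B M' f g : hgrow phi M B f -> hgrow phi M' B g ->
  hgrow phi (M + M') B (fun z => f z + g z)%C.
Proof.
  intros [Hf Hf'] [Hg Hg']. split; [apply holo_plus; assumption|].
  intros z Hz. eapply Rle_trans; [apply Cmod_triangle|]. rewrite Rmult_plus_distr_r.
  apply Rplus_le_compat; auto.
Qed.

Lemma hgrow_const phi B c : (forall z, disk z -> 0 <= phi z) -> 0 <= B -> hgrow phi (Cmod c) B (fun _ => c).
Proof.
  intros Hp HB. split; [apply holo_const|]. intros z Hz.
  rewrite <- (Rmult_1_r (Cmod c)) at 1. apply Rmult_le_compat_l; [apply Cmod_ge_0|].
  apply exp_ge_1, Rmult_le_pos; auto.
Qed.

Lemma hgrow_scal phi M B c f : hgrow phi M B f -> hgrow phi (Cmod c * M) B (fun z => c * f z)%C.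
Proof.
  intros [Hf Hb]. split; [apply holo_mult; [apply holo_const|assumption]|].
  intros z Hz. rewrite Cmod_mult, Rmult_assoc. apply Rmult_le_compat_l; [apply Cmod_ge_0|auto].
Qed.

Lemma hgrow_lin phi B a : (forall z, disk z -> 0 <= phi z) -> 0 <= B -> disk a -> hgrow phi 2 B (fun z => z - a)%C.
Proof.
  intros Hp HB Ha. split; [apply holo_lin|]. intros z Hz.
  assert (H1 : 1 <= exp (B * phi z)) by (apply exp_ge_1, Rmult_le_pos; auto).
  pose proof (Cmod_sub_le z a). unfold disk in *. lra.
Qed.

Lemma div_point {phi kap c D} (Hw : wconst phi kap c D) (B : R) : 0 <= B ->
  exists B' K', 0 <= B' /\ 0 < K' /\ forall f M a, disk a -> hgrow phi M B f ->
    exists g, hgrow phi (M * K' * exp (B' * phi a)) B' g /\ forall z, f z = (f a + (z - a) * g z)%C.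
Proof.
  intros HB. destruct (div_zero Hw B HB) as [B1 [K1 [HB1 [HK1 H]]]].
  destruct Hw as (Hp & Hk & Hc & HD & Hw1 & Hw2).
  (* [B1] is the growth of the quotient, [B] the cost of subtracting the value [f a], and [kap] the
     cost of dividing. One exponent serves for the growth and for the factor at [a]. *)
  exists (B1 + B + kap), (2 * K1). split; [lra|]. split; [lra|]. intros f M a Ha Hf.
  pose proof (hgrow_nonneg _ _ _ _ Hf) as HM.
  pose proof (Hp a Ha) as Hpa.
  destruct (H (fun z => f z + - f a)%C (2 * M * exp (B * phi a)) a Ha) as [g [Hg1 Hg2]].
  - assert (Hfa : Cmod (f a) <= M * exp (B * phi a)) by (apply Hf, Ha).
    apply (hgrow_le phi (M + Cmod (- f a)) B); auto; [|lra|].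
    + rewrite Cmod_opp. assert (1 <= exp (B * phi a)) by (apply exp_ge_1, Rmult_le_pos; auto). nra.
    + apply hgrow_plus; [assumption|apply hgrow_const; assumption].
  - ring.
  - exists g. split.
    + apply (hgrow_le phi (2 * M * exp (B * phi a) * K1 * exp (kap * phi a)) B1); auto; [|lra].
      replace (M * (2 * K1) * exp ((B1 + B + kap) * phi a)) with
       (2 * M * exp (B * phi a) * K1 * exp (kap * phi a) * exp (B1 * phi a)).
      2:{ rewrite !Rmult_plus_distr_r, !exp_plus. ring. }
      rewrite <- (Rmult_1_r (2 * M * exp (B * phi a) * K1 * exp (kap * phi a))) at 1.
      apply Rmult_le_compat_l; [|apply exp_ge_1, Rmult_le_pos; assumption].
      pose proof (exp_pos (B * phi a)). pose proof (exp_pos (kap * phi a)).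
      apply Rmult_le_pos; [|lra]. apply Rmult_le_pos; [|lra]. apply Rmult_le_pos; lra.
    + intros z. rewrite <- Hg2. ring.
Qed.

(** The constants are chosen before [f], which later turns this estimate into lower bounds for
    distances. Each node split off contributes its own weight to the sum in the exponent. *)
Lemma Delta_growth {phi kap c D} (Hw : wconst phi kap c D) (k : nat) : forall B, 0 <= B ->
  exists B' K', 0 < B' /\ 0 < K' /\ forall f M, hgrow phi M B f -> XD phi disk k (M * K') B' f.
Proof.
  induction k as [|k IH]; intros B HB.
  - exists (B + 1), 1. split; [lra|]. split; [lra|]. intros f M Hf p Hp.
    assert (Hd : disk (p O)) by (apply (proj1 Hp); lia).
    pose proof (hgrow_nonneg _ _ _ _ Hf). unfold wsum. simpl. rewrite Rmult_1_r.
    eapply Rle_trans; [apply Hf, Hd|]. apply Rmult_le_compat_l; [assumption|].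
    apply exp_le. pose proof (proj1 Hw _ Hd). nra.
  - destruct (div_point Hw B HB) as [B1 [K1 [HB1 [HK1 H1]]]].
    destruct (IH B1 HB1) as [B2 [K2 [HB2 [HK2 H2]]]].
    exists (B1 + B2), (K1 * K2). split; [lra|]. split; [nra|].
    intros f M Hf p Hp.
    set (a := p (S k)).
    assert (Ha : disk a) by (apply (proj1 Hp); lia).
    pose proof (hgrow_nonneg _ _ _ _ Hf) as HM.
    destruct (H1 f M a Ha Hf) as [g [Hg1 Hg2]].
    rewrite (Delta_quot f g a k p); [|apply (distinct_inj disk), Hp|reflexivity|intros; apply Hg2].
    assert (Hp' : distinct_tuple disk (S k) p).
    { split; [intros i Hi; apply (proj1 Hp); lia|intros i j Hi Hj; apply (proj2 Hp); lia]. }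
    eapply Rle_trans; [apply (H2 g _ Hg1 p Hp')|].
    assert (Hs : 0 <= wsum phi p k).
    { apply wsum_nonneg. intros i Hi. apply (proj1 Hw), (proj1 Hp). lia. }
    assert (Hpa := proj1 Hw a Ha).
    replace (M * K1 * exp (B1 * phi a) * K2 * exp (B2 * wsum phi p k)) with
      (M * (K1 * K2) * exp (B1 * phi a + B2 * wsum phi p k)) by (rewrite exp_plus; ring).
    apply Rmult_le_compat_l; [apply Rmult_le_pos; nra|]. apply exp_le.
    change (wsum phi p (S k)) with (wsum phi p k + phi a). nra.
Qed.

(* [fac mu] replaces the factor at [mu] itself by 1, so that the product over
   a tuple runs over the points other than [mu]. *)
Definition fac (mu x : C) : C := if excluded_middle_informative (x = mu) then 1%C else (mu - x)%C.
Definition facl (mu : C) (l : list C) : C := fold_right (fun x acc => fac mu x * acc)%C 1%C l.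
Definition tup (k : nat) (p : nat -> C) : list C := map p (seq 0 (S k)).

Lemma fac_eq mu : fac mu mu = 1%C.
Proof. unfold fac. destruct (excluded_middle_informative (mu = mu)); congruence. Qed.

Lemma fac_neq mu x : x <> mu -> fac mu x = (mu - x)%C.
Proof. intros H. unfold fac. destruct (excluded_middle_informative (x = mu)); congruence. Qed.

Lemma fac_nz mu x : fac mu x <> 0%C.
Proof.
  unfold fac. destruct (excluded_middle_informative (x = mu)) as [E|E].
  - intros H. apply RtoC_inj in H. lra.
  - apply Csub_neq_0. congruence.
Qed.

Lemma facl_nz mu l : facl mu l <> 0%C.
Proof.
  induction l as [|x l IH]; simpl.
  - intros H. apply RtoC_inj in H. lra.
  - apply Cmult_neq_0; [apply fac_nz|assumption].
Qed.

Lemma facl_app mu l l' : facl mu (l ++ l') = (facl mu l * facl mu l')%C.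
Proof. induction l as [|x l IH]; simpl; [ring|]. rewrite IH. ring. Qed.

Lemma tup_S k p : tup (S k) p = p O :: tup k (shift p).
Proof. unfold tup. change (seq 0 (S (S k))) with (0%nat :: seq 1 (S k)). rewrite <- seq_shift, map_cons, map_map. reflexivity. Qed.

Lemma tup_Sr k p : tup (S k) p = tup k p ++ [p (S k)].
Proof. unfold tup. rewrite (seq_S (S k)), map_app. reflexivity. Qed.

Lemma in_tup k p x : In x (tup k p) <-> exists i, (i <= k)%nat /\ p i = x.
Proof.
  unfold tup. rewrite in_map_iff. split.
  - intros [i [H1 H2]]. apply in_seq in H2. exists i. split; [lia|assumption].
  - intros [i [H1 H2]]. exists i. split; [assumption|]. apply in_seq. lia.
Qed.

(** This is the Lagrange coefficient of the node [mu]. When [mu] is neither first nor last, both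
    differences in the recursion contribute, and their numerators over the full product differ by a
    multiple p (S k) - p O, which cancels the denominator; when [mu] is at either end, only one of
    them contributes. *)
Lemma Delta_single (w : C -> C) (mu : C) (k : nat) : forall p, inj_upto k p ->
  (forall i, (i <= k)%nat -> p i <> mu -> w (p i) = 0%C) ->
  ((exists i, (i <= k)%nat /\ p i = mu) -> Delta k w p = (w mu / facl mu (tup k p))%C) /\
  ((forall i, (i <= k)%nat -> p i <> mu) -> Delta k w p = 0%C).
Proof.
  induction k as [|k IH]; intros p Hp Hz.
  - split.
    + intros [i [Hi E]]. replace i with O in E by lia. simpl. rewrite E, fac_eq. field.
    + intros H. simpl. apply Hz, H; lia.
  - destruct (IH (shift p) (inj_upto_shift _ _ Hp) (fun i Hi => Hz (S i) (le_n_S _ _ Hi))) as [A1 A2].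
    destruct (IH p (inj_upto_le k (S k) p ltac:(lia) Hp) (fun i Hi => Hz i (le_S _ _ Hi))) as [B1 B2].
    pose proof (inj_upto_neq (S k) p (S k) 0 Hp ltac:(lia) ltac:(lia) ltac:(lia)) as N1.
    change (Delta (S k) w p) with ((Delta k w (shift p) - Delta k w p) / (p (S k) - p O))%C.
    assert (F1 : facl mu (tup (S k) p) = (fac mu (p O) * facl mu (tup k (shift p)))%C) by (rewrite tup_S; reflexivity).
    assert (F2 : facl mu (tup (S k) p) = (facl mu (tup k p) * fac mu (p (S k)))%C).
    { rewrite tup_Sr, facl_app. simpl. ring. }
    pose proof (facl_nz mu (tup k p)) as Z1. pose proof (facl_nz mu (tup k (shift p))) as Z2.
    pose proof (facl_nz mu (tup (S k) p)) as Z3.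
    split.
    + intros [i [Hi E]].
      destruct (Nat.eq_dec i 0) as [->|Hi0]; [|destruct (Nat.eq_dec i (S k)) as [->|Hik]].
      * rewrite A2, B1.
        2:{ exists O. split; [lia|assumption]. }
        2:{ intros j Hj E2. apply (Hp (S j) O); [lia|lia|lia|]. unfold shift in E2. congruence. }
        rewrite F2. rewrite fac_neq.
        2:{ rewrite <- E. apply Hp; lia. }
        rewrite <- E in *. field. repeat split; try assumption.
        { apply Csub_neq_0. apply Hp; lia. }
      * rewrite B2, A1.
        2:{ exists k. split; [lia|assumption]. }
        2:{ intros j Hj E2. apply (Hp j (S k)); [lia|lia|lia|]. congruence. }
        rewrite F1. rewrite fac_neq.
        2:{ rewrite <- E. apply Hp; lia. }
        rewrite <- E in *. field. repeat split; assumption.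
      * rewrite A1, B1.
        2:{ exists i. split; [lia|assumption]. }
        2:{ exists (i - 1)%nat. split; [lia|]. unfold shift. replace (S (i - 1)) with i by lia. assumption. }
        assert (N2 : p O <> mu) by (rewrite <- E; apply Hp; lia).
        assert (N3 : p (S k) <> mu) by (rewrite <- E; apply Hp; lia).
        rewrite fac_neq in F1, F2 by assumption.
        assert (Y1 : (mu - p O)%C <> 0%C) by (apply Csub_neq_0; congruence).
        assert (Y2 : (mu - p (S k))%C <> 0%C) by (apply Csub_neq_0; congruence).
        assert (G1 : facl mu (tup k (shift p)) = (facl mu (tup (S k) p) / (mu - p O))%C) by (rewrite F1; field; assumption).
        assert (G2 : facl mu (tup k p) = (facl mu (tup (S k) p) / (mu - p (S k)))%C) by (rewrite F2; field; assumption).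
        rewrite G1, G2. field. repeat split; assumption.
    + intros H. rewrite A2, B2.
      * unfold Cdiv. ring.
      * intros i Hi. apply H. lia.
      * intros i Hi. apply H. lia.
Qed.

(** * The open mapping argument *)

Lemma ex_series_half (x : R) (n : nat) : ex_series (fun k => (1/2)^(n + k) * x).
Proof.
  apply ex_series_scal_r.
  apply (ex_series_incr_n (V := R_NormedModule) (fun k => (1/2)^k) n).
  apply ex_series_geom. rewrite Rabs_right; lra.
Qed.

Lemma Series_half (x : R) (n : nat) : Series (fun k => (1/2)^(n + k) * x) = 2 * (1/2)^n * x.
Proof.
  rewrite Series_scal_r.
  rewrite (Series_ext _ (fun k => (1/2)^n * (1/2)^k)) by (intros; apply pow_add).
  rewrite Series_scal_l, Series_geom by (rewrite Rabs_right; lra). field.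
Qed.

Lemma half_to_0 (x y : R) : 0 <= y -> (forall n, x <= (1/2)^n * y) -> x <= 0.
Proof.
  intros Hy H. apply le_epsilon. intros eps Heps. rewrite Rplus_0_l.
  destruct (pow_lt_1_zero (1/2)) with (y := eps / (y + 1)) as [n Hn].
  { rewrite Rabs_right; lra. } { apply Rdiv_lt_0_compat; lra. }
  specialize (Hn n (le_n n)). rewrite Rabs_right in Hn by (apply Rle_ge, pow_le; lra).
  eapply Rle_trans; [apply (H n)|].
  apply Rle_trans with (eps / (y + 1) * (y + 1)).
  - apply Rmult_le_compat; try lra. apply pow_le; lra.
  - apply Req_le. field. lra.
Qed.

(** [K] depends on the tuple without any control: it serves only to pass to the limit on a fixed
    tuple. *)
Lemma Delta_bounded (k : nat) : forall p, exists K, 0 <= K /\ forall w d,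
  (forall i, (i <= k)%nat -> Cmod (w (p i)) <= d) -> Cmod (Delta k w p) <= K * d.
Proof.
  induction k as [|k IH]; intros p.
  - exists 1. split; [lra|]. intros w d H. simpl. rewrite Rmult_1_l. apply H; lia.
  - destruct (IH p) as [K1 [HK1 H1]]. destruct (IH (shift p)) as [K2 [HK2 H2]].
    pose proof (Cmod_ge_0 (/ (p (S k) - p O))) as Hc.
    exists ((K2 + K1) * Cmod (/ (p (S k) - p O))%C). split; [apply Rmult_le_pos; lra|].
    intros w d H.
    change (Delta (S k) w p) with ((Delta k w (shift p) - Delta k w p) * / (p (S k) - p O))%C.
    rewrite Cmod_mult.
    replace ((K2 + K1) * Cmod (/ (p (S k) - p O)) * d) with ((K2 * d + K1 * d) * Cmod (/ (p (S k) - p O))) by ring.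
    apply Rmult_le_compat_r; [assumption|].
    eapply Rle_trans; [apply Cmod_sub_le|].
    apply Rplus_le_compat; [apply H2|apply H1]; intros i Hi; apply H; lia.
Qed.

Section OpenMapping.
Variables (phi : C -> R) (kap c D : R).
Hypothesis Hw : wconst phi kap c D.
Variable L : C -> Prop.
Hypothesis HL : forall z, L z -> disk z.
Variable j : nat.
Variable T : R.
Hypothesis HT : 0 < T.

(** The ball of radius [x] in the space of data. Differences of order [j] do not control the values,
    since for j > 0 they vanish on constants; the separate bound on values makes limits in this norm
    pointwise limits. *)
Definition Bd (x : R) (w : C -> C) : Prop :=
  (forall l, L l -> Cmod (w l) <= x * exp (T * phi l)) /\ XD phi L j x T w.

Lemma Bd_minus x y v w : Bd x v -> Bd y w -> Bd (x + y) (fun z => v z - w z)%C.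
Proof.
  intros [H1 H2] [H3 H4]. split.
  - intros l Hl. eapply Rle_trans; [apply Cmod_sub_le|]. rewrite Rmult_plus_distr_r.
    apply Rplus_le_compat; auto.
  - intros p Hp. rewrite Delta_minus. eapply Rle_trans; [apply Cmod_sub_le|].
    rewrite Rmult_plus_distr_r. apply Rplus_le_compat; auto.
Qed.

Lemma Bd_scal x a w : Bd x w -> Bd (Cmod a * x) (fun z => a * w z)%C.
Proof.
  intros [H1 H2]. split.
  - intros l Hl. rewrite Cmod_mult, Rmult_assoc. apply Rmult_le_compat_l; [apply Cmod_ge_0|auto].
  - intros p Hp. rewrite Delta_scal, Cmod_mult, Rmult_assoc. apply Rmult_le_compat_l; [apply Cmod_ge_0|auto].
Qed.

Lemma Bd_le x y w : x <= y -> Bd x w -> Bd y w.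
Proof.
  intros Hxy [H1 H2]. split.
  - intros l Hl. eapply Rle_trans; [apply H1, Hl|]. apply Rmult_le_compat_r; [apply exp_nonneg|assumption].
  - intros p Hp. eapply Rle_trans; [apply H2, Hp|]. apply Rmult_le_compat_r; [apply exp_nonneg|assumption].
Qed.

Lemma Bd_ext x v w : (forall l, L l -> v l = w l) -> Bd x v -> Bd x w.
Proof.
  intros E [H1 H2]. split.
  - intros l Hl. rewrite <- E by assumption. auto.
  - intros p Hp. rewrite <- (Delta_ext j v w p p); [auto|].
    intros i Hi. split; [apply E, (proj1 Hp); lia|reflexivity].
Qed.

Lemma Bd_sym x v w : Bd x (fun z => v z - w z)%C -> Bd x (fun z => w z - v z)%C.
Proof.
  intros H. apply (Bd_scal _ (-(1))%C) in H. rewrite Cmod_m1, Rmult_1_l in H.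
  apply (Bd_ext x) with (2 := H). intros. ring.
Qed.

Lemma Bd_0 : Bd 0 (fun _ => 0%C).
Proof.
  split.
  - intros l Hl. rewrite Cmod_0. lra.
  - intros p Hp. rewrite (Delta_ext j _ (fun z => 0 * 0)%C p p), Delta_scal.
    + rewrite Cmult_0_l, Cmod_0. lra.
    + intros i Hi. split; [ring|reflexivity].
Qed.

(** Balls are closed under pointwise limits: on a fixed tuple the error is a fixed multiple of
    (1/2)^n, so the constant of [Delta_bounded] disappears in the limit. *)
Lemma Bd_lim x w (v : nat -> C -> C) A : 0 <= A ->
  (forall n l, L l -> Cmod (w l - v n l)%C <= (1/2)^n * (A * exp (T * phi l))) ->
  (forall n, Bd x (v n)) -> Bd x w.
Proof.
  intros HA Hlim Hv. split.
  - intros l Hl. apply Rminus_le. apply (half_to_0 _ (A * exp (T * phi l))).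
    + apply Rmult_le_pos; [assumption|apply exp_nonneg].
    + intros n. specialize (Hlim n l Hl). pose proof (proj1 (Hv n) l Hl).
      pose proof (Cmod_sub_ge (w l) (v n l)). lra.
  - intros p Hp. destruct (Delta_bounded j p) as [K [HK HD]].
    assert (Hpos : forall i, (i <= j)%nat -> 0 <= phi (p i)).
    { intros i Hi. apply (proj1 Hw), HL, (proj1 Hp). lia. }
    apply Rminus_le. apply (half_to_0 _ (K * (A * exp (T * wsum phi p j)))).
    + repeat apply Rmult_le_pos; try assumption. apply exp_nonneg.
    + intros n. pose proof (proj2 (Hv n) p Hp) as H1.
      assert (H2 : Cmod (Delta j (fun z => w z - v n z)%C p) <= K * ((1/2)^n * (A * exp (T * wsum phi p j)))).
      { apply HD. intros i Hi. eapply Rle_trans; [apply Hlim, (proj1 Hp); lia|].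
        apply Rmult_le_compat_l; [apply pow_le; lra|]. apply Rmult_le_compat_l; [assumption|].
        apply exp_le, Rmult_le_compat_l; [lra|]. apply wsum_le; assumption. }
      rewrite Delta_minus in H2.
      pose proof (Cmod_sub_ge (Delta j w p) (Delta j (v n) p)). lra.
Qed.

Hypothesis Htr : forall w, X_space phi L j w -> trace phi L w.

(** A single integer bounds constant and exponent, so that the traces form a countable union, as
    Baire's argument requires. *)
Lemma Bd_trace x w : 0 <= x -> Bd x w -> exists m, exists f, hgrow phi (INR m) (INR m) f /\ forall l, L l -> f l = w l.
Proof.
  intros Hx [_ H2]. destruct (Htr w) as [f [Hf Hfw]].
  - apply (X_space_XD Hw); [assumption|]. exists x, T. auto.
  - apply A_fun_hgrow in Hf. destruct Hf as [M [B [HB Hf]]].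
    destruct (INR_archimed 1 (Rmax M B)) as [m Hm]; [lra|].
    exists m, f. split; [|assumption].
    apply (hgrow_le phi M B); auto.
    + apply (proj1 Hw).
    + pose proof (Rmax_l M B). lra.
    + pose proof (Rmax_r M B). lra.
Qed.

(* Baire category: otherwise a sequence of nested balls avoids all traces. *)
Lemma dense_ball : exists m w0 e, 0 < e /\ forall w, Bd e (fun z => w z - w0 z)%C ->
  forall eta, 0 < eta -> exists f, hgrow phi (INR m) (INR m) f /\ Bd eta (fun z => w z - f z)%C.
Proof.
  apply NNPP. intros Hneg.
  (* A pair is a ball with centre [fst x] and radius [snd x]. Positivity of the radius is assumed
     behind the existential, so that choice yields a total step function. *)
  assert (Hstep : forall m (x : (C -> C) * R), exists y : (C -> C) * R, 0 < snd x ->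
     Bd (snd x / 2) (fun z => fst y z - fst x z)%C /\ 0 < snd y <= snd x / 2 /\
     forall f, hgrow phi (INR m) (INR m) f -> ~ Bd (snd y) (fun z => fst y z - f z)%C).
  { intros m [w0 e]. destruct (Rlt_dec 0 e) as [He|He]; [|exists (w0, e); simpl; lra].
    apply NNPP. intros Hn. apply Hneg. exists m, w0, (e / 2). split; [lra|].
    intros w Hwb eta Heta. apply NNPP. intros Hf. apply Hn.
    exists (w, Rmin eta (e / 2)). intros _. simpl. split; [assumption|]. split.
    - split; [apply Rmin_pos; lra|apply Rmin_r].
    - intros f Hg Hb. apply Hf. exists f. split; [assumption|].
      apply (Bd_le _ _ _ (Rmin_l eta (e / 2)) Hb). }
  destruct (functional_choice _ (fun m => functional_choice _ (Hstep m))) as [F HF0].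
  set (s := fix s (n : nat) : (C -> C) * R := match n with O => ((fun _ : C => RtoC 0), 1) | S k => F k (s k) end).
  assert (Hs : forall n, 0 < snd (s n) -> Bd (snd (s n) / 2) (fun z => fst (s (S n)) z - fst (s n) z)%C /\ 0 < snd (s (S n)) <= snd (s n) / 2 /\
     forall f, hgrow phi (INR n) (INR n) f -> ~ Bd (snd (s (S n))) (fun z => fst (s (S n)) z - f z)%C).
  { intros n. exact (HF0 n (s n)). }
  assert (Hpos : forall n, 0 < snd (s n) <= (1/2)^n).
  { induction n as [|n IH]; [simpl; lra|]. destruct (Hs n (proj1 IH)) as [_ [H1 _]].
    change ((1/2)^(S n)) with (1/2 * (1/2)^n). lra. }
  (* The centre moves by at most half the radius, and the radius loses at least half; hence each
     move is at most the loss of radius, and the losses telescope. *)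
  assert (Hcau : forall n k, Bd (snd (s n) - snd (s (n + k)%nat)) (fun z => fst (s (n + k)%nat) z - fst (s n) z)%C).
  { intros n. induction k as [|k IH].
    - rewrite Nat.add_0_r, Rminus_diag. apply (Bd_ext 0) with (2 := Bd_0). intros; ring.
    - rewrite Nat.add_succ_r. destruct (Hs (n + k)%nat (proj1 (Hpos _))) as [H1 [H2 _]].
      apply Bd_sym in IH. pose proof (Bd_minus _ _ _ _ H1 IH) as H3.
      apply (Bd_ext _ _ (fun z => fst (s (S (n + k))) z - fst (s n) z)%C) in H3; [|intros; ring].
      apply (Bd_le _ _ _) with (2 := H3). lra. }
  set (u := fun l k => (fst (s k) l - fst (s (S k)) l)%C).
  set (w := fun l => (fst (s O) l - Csum (u l))%C).
  assert (Hu : forall l, L l -> forall k, Cmod (u l k) <= (1/2)^k * exp (T * phi l)).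
  { intros l Hl k. destruct (Hs k (proj1 (Hpos _))) as [[H1 _] _]. unfold u.
    rewrite Cmod_sub_sym. eapply Rle_trans; [apply H1, Hl|].
    apply Rmult_le_compat_r; [apply exp_nonneg|]. pose proof (Hpos k). lra. }
  assert (Hlim : forall n l, L l -> Cmod (w l - fst (s n) l)%C <= (1/2)^n * (4 * exp (T * phi l))).
  { intros n l Hl. unfold w.
    rewrite (Csum_partial (u l) (fun k => (1/2)^k * exp (T * phi l)) (fun k => fst (s k) l)) with (n := n).
    - replace (fst (s n) l - Csum (fun k => u l (n + k)%nat) - fst (s n) l)%C with (- Csum (fun k => u l (n + k)%nat))%C by ring.
      rewrite Cmod_opp.
      eapply Rle_trans; [apply (Csum_bound _ (fun k => (1/2)^(n + k) * exp (T * phi l))); [intros; apply Hu, Hl|apply ex_series_half]|].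
      rewrite Series_half. lra.
    - apply Hu, Hl.
    - apply (ex_series_half _ 0).
    - intros k. unfold u. ring. }
  assert (Hball : forall n, Bd (snd (s n)) (fun z => w z - fst (s n) z)%C).
  { intros n. apply (Bd_lim _ _ (fun k z => fst (s (n + k)%nat) z - fst (s n) z)%C 4); [lra| |].
    - intros k l Hl.
      replace (w l - fst (s n) l - (fst (s (n + k)%nat) l - fst (s n) l))%C with (w l - fst (s (n + k)%nat) l)%C by ring.
      eapply Rle_trans; [apply Hlim, Hl|]. apply Rmult_le_compat_r.
      + pose proof (exp_pos (T * phi l)). lra.
      + rewrite pow_add. assert (0 < (1/2)^k) by (apply pow_lt; lra).
        pose proof (pow_incr (1/2) 1 n ltac:(lra)) as Hle. rewrite pow1 in Hle. nra.
    - intros k. apply (Bd_le (snd (s n) - snd (s (n + k)%nat))); [pose proof (Hpos (n + k)%nat); lra|apply Hcau]. }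
  (* The limit is the trace of a function with some integer bound [m], yet it lies in the ball
     chosen at step [m] to avoid all such traces. *)
  destruct (Bd_trace 1 w Rle_0_1) as [m [f [Hf1 Hf2]]].
  { apply (Bd_ext 1 (fun z => w z - fst (s O) z)%C); [|apply (Hball O)]. intros l _. simpl. ring. }
  destruct (Hs m (proj1 (Hpos _))) as [_ [_ H]]. apply (H f Hf1).
  apply Bd_sym. apply (Bd_ext _ (fun z => w z - fst (s (S m)) z)%C); [|apply Hball].
  intros l Hl. rewrite Hf2 by assumption. reflexivity.
Qed.

(** Subtracting an approximation of [w0] from one of w0 + t w moves the ball of [dense_ball] to the
    origin, and dividing by t = e / x adapts it to radius [x]. The factor 2 * INR m / e accounts for
    the two approximations. *)
Lemma approx_trace : exists m Q, 0 < Q /\ forall w x, 0 < x -> Bd x w ->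
  forall eta, 0 < eta -> exists f, hgrow phi (x * Q) (INR m) f /\ Bd eta (fun z => w z - f z)%C.
Proof.
  destruct dense_ball as [m [w0 [e [He H]]]].
  exists m, (2 * INR m / e + 1). pose proof (pos_INR m) as Hm.
  assert (Hme : 0 <= 2 * INR m / e) by (apply Rmult_le_pos; [lra|apply Rinv_nonneg, He]).
  split; [lra|].
  intros w x Hx Hb eta Heta.
  set (t := e / x). assert (Ht : 0 < t) by (apply Rdiv_lt_0_compat; assumption).
  assert (Htc : RtoC t <> 0%C) by (intros E; apply RtoC_inj in E; lra).
  assert (Heta2 : 0 < t * eta / 2) by (apply Rdiv_lt_0_compat; [apply Rmult_lt_0_compat|]; lra).
  destruct (H (fun z => w0 z + RtoC t * w z)%C) with (eta := t * eta / 2) as [f1 [Hf1 Hb1]]; [|assumption|].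
  { apply (Bd_ext _ (fun z => RtoC t * w z)%C); [intros; ring|].
    apply (Bd_le (Cmod (RtoC t) * x)); [|apply Bd_scal; assumption].
    rewrite Cmod_R, Rabs_right by lra. unfold t. apply Req_le. field. lra. }
  destruct (H w0) with (eta := t * eta / 2) as [f0 [Hf0 Hb0]]; [|assumption|].
  { apply (Bd_ext _ (fun _ => 0%C)); [intros; ring|]. apply (Bd_le 0); [lra|apply Bd_0]. }
  exists (fun z => / RtoC t * (f1 z + (-(1)) * f0 z))%C. split.
  - apply (hgrow_le phi (Cmod (/ RtoC t) * (INR m + Cmod (-(1))%C * INR m)) (INR m)).
    + apply (proj1 Hw).
    + rewrite Cmod_m1, Cmod_inv, Cmod_R, Rabs_right by (try assumption; lra).
      apply Rle_trans with (x * (2 * INR m / e)).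
      * unfold t. apply Req_le. field. lra.
      * apply Rmult_le_compat_l; lra.
    + lra.
    + apply hgrow_scal, hgrow_plus; [assumption|]. apply hgrow_scal. assumption.
  - apply (Bd_ext _ (fun z => / RtoC t * ((w0 z + RtoC t * w z - f1 z) - (w0 z - f0 z)))%C).
    + intros l _. field. assumption.
    + apply (Bd_le (Cmod (/ RtoC t) * (t * eta / 2 + t * eta / 2))).
      * rewrite Cmod_inv, Cmod_R, Rabs_right by (try assumption; lra). apply Req_le. field. lra.
      * apply Bd_scal, Bd_minus; assumption.
Qed.

(* Successive approximation, as in the open mapping theorem. *)
Lemma uniform_trace : exists M B, 0 <= M /\ 0 <= B /\ forall w, Bd 1 w ->
  exists f, hgrow phi M B f /\ forall l, L l -> f l = w l.
Proof.
  destruct approx_trace as [m [Q [HQ H]]].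
  (* One factor 2 is the sum of the geometric series, the other is that of [weierstrass]. *)
  exists (2 * (2 * Q)), (INR m). split; [lra|]. split; [apply pos_INR|].
  intros w Hb.
  assert (Hp2 : forall k, 0 < (1/2)^k) by (intros; apply pow_lt; lra).
  assert (Hstep : forall k v, exists f, Bd ((1/2)^k) v -> hgrow phi ((1/2)^k * Q) (INR m) f /\ Bd ((1/2)^(S k)) (fun z => v z - f z)%C).
  { intros k v. destruct (classic (Bd ((1/2)^k) v)) as [Hv|Hv].
    - destruct (H v _ (Hp2 k) Hv _ (Hp2 (S k))) as [f Hf]. exists f. auto.
    - exists (fun _ => 0%C). intros; contradiction. }
  destruct (functional_choice _ (fun k => functional_choice _ (Hstep k))) as [F HF].
  (* [s n] is the error left after n corrections; it lies in the ball of radius (1/2)^n. *)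
  set (s := fix s (n : nat) : C -> C := match n with O => w | S k => (fun z => s k z - F k (s k) z)%C end).
  assert (Hs : forall k, Bd ((1/2)^k) (s k)).
  { induction k as [|k IH]; [exact Hb|]. apply (HF k (s k) IH). }
  set (f := fun k => F k (s k)).
  assert (Hf : forall k, hgrow phi ((1/2)^k * Q) (INR m) (f k)) by (intros k; apply (HF k (s k) (Hs k))).
  exists (fun z => Csum (fun k => f k z)). split.
  - assert (E : Series (fun k => (1/2)^k * Q) = 2 * Q).
    { pose proof (Series_half Q 0) as E. simpl in E. simpl. rewrite E. lra. }
    rewrite <- E. apply (weierstrass Hw); [apply pos_INR|assumption|].
    apply (ex_series_half Q 0).
  - intros l Hl.
    set (W := exp (INR m * phi l)). assert (HW : 0 < W) by apply exp_pos.
    assert (Hfl : forall k, Cmod (f k l) <= (1/2)^k * (Q * W)).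
    { intros k. rewrite <- Rmult_assoc. apply (Hf k), HL, Hl. }
    assert (H0 : Cmod (w l - Csum (fun k => f k l)) <= 0).
    { apply (half_to_0 _ (exp (T * phi l) + 4 * (Q * W))).
      - pose proof (exp_pos (T * phi l)). assert (0 < Q * W) by (apply Rmult_lt_0_compat; assumption). lra.
      - intros n.
        pose proof (Csum_partial (fun k => f k l) (fun k => (1/2)^k * (Q * W)) (fun k => s k l) Hfl (ex_series_half _ 0) (fun k => eq_refl) n) as EP.
        change (w l - Csum (fun k => f k l) = s n l - Csum (fun k => f (n + k)%nat l))%C in EP. rewrite EP.
        eapply Rle_trans; [apply Cmod_sub_le|].
        rewrite Rmult_plus_distr_l. apply Rplus_le_compat.
        + apply (proj1 (Hs n)), Hl.
        + eapply Rle_trans; [apply (Csum_bound _ (fun k => (1/2)^(n + k) * (Q * W))); [intros; apply Hfl|apply ex_series_half]|].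
          rewrite Series_half. lra. }
    assert (H1 : (w l - Csum (fun k => f k l))%C = 0%C).
    { apply Cmod_eq_0. pose proof (Cmod_ge_0 (w l - Csum (fun k => f k l))). lra. }
    transitivity (w l - (w l - Csum (fun k => f k l)))%C; [ring|]. rewrite H1. ring.
Qed.
End OpenMapping.

Arguments uniform_trace {phi kap c D}.

(** * Separated and interpolating sequences *)

Definition nfl (x : R) : nat := proj1_sig (nfloor_ex (Rmax 0 x) (Rmax_l 0 x)).

Lemma nfl_spec x : 0 <= x -> INR (nfl x) <= x < INR (nfl x) + 1.
Proof.
  intros Hx. unfold nfl. destruct (nfloor_ex (Rmax 0 x) (Rmax_l 0 x)) as [n Hn]. simpl.
  rewrite Rmax_right in Hn by assumption. exact Hn.
Qed.

Lemma cantor_bound a b : (S (to_nat (a, b)) <= (a + b + 1) * (a + b + 1))%nat.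
Proof. pose proof (to_nat_spec a b). nia. Qed.

(* The code of a point is its cell in a grid of mesh smaller than the
   separation [s] at that point, together with the mesh. *)
Definition mesh (s : C -> R) (z : C) : nat := S (nfl (4 / s z)).
Definition code (s : C -> R) (z : C) : nat :=
  to_nat (to_nat (nfl ((Re z + 1) * INR (mesh s z)), nfl ((Im z + 1) * INR (mesh s z))), mesh s z).

Section Code.
Variables (s : C -> R) (G : C -> Prop).
Hypothesis HG : forall z, G z -> disk z.
Hypothesis Hs : forall z, G z -> 0 < s z <= 1.

Lemma mesh_spec z : G z -> 4 / s z < INR (mesh s z) <= 5 / s z.
Proof.
  intros Hz. destruct (Hs z Hz) as [H1 H2].
  assert (H0 : 1 <= / s z) by (rewrite <- Rinv_1; apply Rinv_le_contravar; assumption).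
  unfold mesh. rewrite S_INR. destruct (nfl_spec (4 / s z)) as [H3 H4]; unfold Rdiv in *; lra.
Qed.

Lemma disk_components z : disk z -> 0 <= Re z + 1 <= 2 /\ 0 <= Im z + 1 <= 2.
Proof.
  intros Hz. unfold disk in Hz. pose proof (re_le_Cmod z). pose proof (im_le_Cmod z).
  pose proof (Rle_abs (Re z)). pose proof (Rle_abs (Im z)).
  pose proof (Rabs_maj2 (Re z)). pose proof (Rabs_maj2 (Im z)). lra.
Qed.

Lemma code_inj z w : G z -> G w -> (z <> w -> s z <= Cmod (z - w)%C) -> code s z = code s w -> z = w.
Proof.
  intros Hz Hw Hsep E. apply NNPP. intros Hne. specialize (Hsep Hne).
  unfold code in E. apply to_nat_inj in E.
  assert (E3 : mesh s z = mesh s w) by congruence.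
  assert (E4 := f_equal fst E). cbn [fst] in E4. apply to_nat_inj in E4.
  assert (E1 := f_equal fst E4). assert (E2 := f_equal snd E4). cbn [fst snd] in E1, E2. clear E4 E.
  rewrite <- E3 in E1, E2.
  destruct (mesh_spec z Hz) as [HN _]. destruct (Hs z Hz) as [Hs0 _].
  set (N := INR (mesh s z)) in *.
  assert (H4 : 0 < 4 / s z) by (apply Rdiv_lt_0_compat; lra).
  destruct (disk_components z (HG z Hz)) as [A1 A2]. destruct (disk_components w (HG w Hw)) as [B1 B2].
  destruct (nfl_spec ((Re z + 1) * N)) as [C1 C2]; [apply Rmult_le_pos; lra|].
  destruct (nfl_spec ((Im z + 1) * N)) as [C3 C4]; [apply Rmult_le_pos; lra|].
  destruct (nfl_spec ((Re w + 1) * N)) as [D1 D2]; [apply Rmult_le_pos; lra|].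
  destruct (nfl_spec ((Im w + 1) * N)) as [D3 D4]; [apply Rmult_le_pos; lra|].
  rewrite <- E1 in D1, D2. rewrite <- E2 in D3, D4.
  pose proof (Cmod_le_components (z - w)) as Hc. simpl in Hc.
  assert (K1 : Rabs (Re z + - Re w) * N <= 1).
  { rewrite <- (Rabs_right N) at 1 by lra. rewrite <- Rabs_mult. apply Rabs_le. split; nra. }
  assert (K2 : Rabs (Im z + - Im w) * N <= 1).
  { rewrite <- (Rabs_right N) at 1 by lra. rewrite <- Rabs_mult. apply Rabs_le. split; nra. }
  (* In a common cell each coordinate differs by at most 1 / N, whereas N > 4 / s z. *)
  assert (K3 : s z * N <= 2) by (unfold Re, Im in *; nra).
  apply (Rmult_lt_compat_l (s z)) in HN; [|assumption].
  replace (s z * (4 / s z)) with 4 in HN by (field; lra). lra.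
Qed.

(** A cell has indices of order [m], and each of the two nested pairings squares, whence the fourth
    power. Only the polynomial dependence on 1 / s z matters. *)
Lemma code_bound z : G z -> INR (code s z) + 1 <= 2304 * (5 / s z) ^ 4.
Proof.
  intros Hz. destruct (mesh_spec z Hz) as [HN1 HN2]. destruct (Hs z Hz) as [Hs0 Hs1].
  destruct (disk_components z (HG z Hz)) as [A1 A2].
  assert (H4 : 0 < 4 / s z) by (apply Rdiv_lt_0_compat; lra).
  set (m := mesh s z) in *.
  destruct (nfl_spec ((Re z + 1) * INR m)) as [C1 _]; [apply Rmult_le_pos; lra|].
  destruct (nfl_spec ((Im z + 1) * INR m)) as [C3 _]; [apply Rmult_le_pos; lra|].
  set (a := nfl ((Re z + 1) * INR m)) in *. set (b := nfl ((Im z + 1) * INR m)) in *.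
  assert (Ha : (a <= 2 * m)%nat) by (apply INR_le; rewrite mult_INR; change (INR 2) with (1 + 1); eapply Rle_trans; [eassumption|]; apply Rmult_le_compat_r; lra).
  assert (Hb : (b <= 2 * m)%nat) by (apply INR_le; rewrite mult_INR; change (INR 2) with (1 + 1); eapply Rle_trans; [eassumption|]; apply Rmult_le_compat_r; lra).
  assert (Hm : (1 <= m)%nat) by (unfold m, mesh; lia).
  unfold code. fold m a b.
  pose proof (cantor_bound a b) as B1. set (t := to_nat (a, b)) in *.
  pose proof (cantor_bound t m) as B2.
  assert (B3 : (S t <= 25 * (m * m))%nat) by nia.
  assert (B4 : (t + m + 1 <= 26 * (m * m))%nat) by nia.
  assert (B5 : (S (to_nat (t, m)) <= 26 * (m * m) * (26 * (m * m)))%nat) by nia.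
  apply le_INR in B5. rewrite S_INR, !mult_INR in B5.
  replace (INR 26) with 26 in B5 by (simpl; lra).
  eapply Rle_trans; [exact B5|].
  assert (P0 : 0 <= INR m) by apply pos_INR.
  pose proof (pow_incr (INR m) (5 / s z) 4 (conj P0 HN2)) as H5.
  replace (26 * (INR m * INR m) * (26 * (INR m * INR m))) with (676 * INR m ^ 4) by ring.
  assert (0 <= INR m ^ 4) by (apply pow_le; assumption). lra.
Qed.
End Code.

Lemma ex_series_inv_sqr : ex_series (fun k => / (INR k + 1) ^ 2).
Proof.
  apply (ex_series_le (V := R_CompleteNormedModule) _ (fun k => 2 * (/ (INR k + 1) - / (INR k + 2)))).
  - intros k. unfold norm; simpl; unfold abs; simpl. pose proof (pos_INR k).
    rewrite Rabs_right by (apply Rle_ge, Rlt_le, Rinv_0_lt_compat; nra).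
    replace (2 * (/ (INR k + 1) - / (INR k + 2))) with (2 / ((INR k + 1) * (INR k + 2))) by (field; lra).
    rewrite Rmult_1_r. unfold Rdiv. rewrite Rinv_mult, Rinv_mult.
    assert (P1 : 0 < / (INR k + 1)) by (apply Rinv_0_lt_compat; lra).
    assert (P2 : / (INR k + 1) <= 2 * / (INR k + 2)).
    { replace (2 * / (INR k + 2)) with (/ ((INR k + 2) / 2)) by (field; lra). apply Rinv_le_contravar; lra. }
    nra.
  - apply (ex_series_scal_l 2 (fun k => / (INR k + 1) - / (INR k + 2))).
    exists 1.
    assert (E : forall n, sum_n (fun k => / (INR k + 1) - / (INR k + 2)) n = 1 - / (INR n + 2)).
    { induction n as [|n IH].
      - rewrite sum_O. simpl. field.
      - rewrite sum_Sn, IH. unfold plus; simpl plus. rewrite S_INR. pose proof (pos_INR n).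
        change (1 - / (INR n + 2) + (/ (INR n + 1 + 1) - / (INR n + 1 + 2)) = 1 - / (INR n + 1 + 2)). field. lra. }
    change (is_lim_seq (sum_n (fun k => / (INR k + 1) - / (INR k + 2))) 1).
    apply (is_lim_seq_ext (fun n => 1 - / (INR n + 2))); [intros; symmetry; apply E|].
    replace 1 with (1 - 0) at 1 by ring.
    apply is_lim_seq_minus'; [apply is_lim_seq_const|].
    apply (is_lim_seq_inv (fun n => INR n + 2) p_infty); [|discriminate].
    apply (is_lim_seq_plus _ _ p_infty 2); [apply is_lim_seq_INR|apply is_lim_seq_const|reflexivity].
Qed.

(** The bound involves the weight of one point only, because the code of a point is computed from
    that point alone. The summand 1 in [phi l + 1] absorbs constant factors. *)
Definition separated (phi : C -> R) (G : C -> Prop) : Prop :=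
  exists Q, 0 < Q /\ forall l m, G l -> G m -> l <> m -> exp (- Q * (phi l + 1)) <= Cmod (l - m)%C.

(** This converts separation into summability: with such a numbering, exp (- 2 q phi) on [G] is
    dominated by a multiple of 1 / (k + 1)^2 at the point numbered k. *)
Lemma separated_code phi G : (forall z, G z -> disk z /\ 0 <= phi z) -> separated phi G ->
  exists (f : C -> nat) A q, 0 < A /\ 0 < q /\ (forall z w, G z -> G w -> f z = f w -> z = w) /\
    (forall z, G z -> INR (f z) + 1 <= A * exp (q * phi z)).
Proof.
  intros HG [Q [HQ Hsep]].
  set (s := fun z => exp (- Q * (phi z + 1))).
  assert (Hs : forall z, G z -> 0 < s z <= 1).
  { intros z Hz. split; [apply exp_pos|]. unfold s. apply Rle_trans with (exp 0); [apply exp_le|rewrite exp_0; lra].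
    pose proof (proj2 (HG z Hz)). nra. }
  exists (code s), (2304 * 625 * exp (4 * Q)), (4 * Q).
  split. { pose proof (exp_pos (4 * Q)). lra. } split; [lra|]. split.
  - intros z w Hz Hw. apply (code_inj s G (fun z Hz => proj1 (HG z Hz)) Hs z w Hz Hw).
    intros Hne. apply Hsep; assumption.
  - intros z Hz. eapply Rle_trans; [apply (code_bound s G (fun z Hz => proj1 (HG z Hz)) Hs z Hz)|].
    unfold s. replace (5 / exp (- Q * (phi z + 1))) with (5 * exp (Q * (phi z + 1))).
    2:{ replace (- Q * (phi z + 1)) with (- (Q * (phi z + 1))) by ring. rewrite exp_Ropp. field.
        apply Rgt_not_eq, exp_pos. }
    apply Req_le. rewrite Rpow_mult_distr.
    replace (exp (Q * (phi z + 1)) ^ 4) with (exp (4 * Q) * exp (4 * Q * phi z)).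
    + ring.
    + rewrite <- exp_plus. simpl. rewrite Rmult_1_r, <- !exp_plus. f_equal. ring.
Qed.

(** The series runs over codes, with the zero function for a code that belongs to no point. T = 2 q
    compensates the square of the code. [T] depends on [G] alone, so it is available before the
    family [F] is built and can enter its normalisation. *)
Lemma glue {phi kap c D} (Hw : wconst phi kap c D) (G : C -> Prop) :
  (forall z, G z -> disk z) -> separated phi G ->
  exists T, 0 < T /\ forall M B (F : C -> C -> C), 0 <= B ->
    (forall m, G m -> hgrow phi (M * exp (- T * phi m)) B (F m)) ->
    exists f M', hgrow phi M' B f /\
      (forall z, disk z -> (forall m, G m -> F m z = 0%C) -> f z = 0%C) /\
      (forall l z, G l -> disk z -> (forall m, G m -> m <> l -> F m z = 0%C) -> f z = F l z).
Proof.
  intros HG Hsep.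
  destruct (separated_code phi G) as [cd [A [q [HA [Hq [Hinj Hbd]]]]]]; [|assumption|].
  { intros z Hz. split; [apply HG, Hz|apply (proj1 Hw), HG, Hz]. }
  exists (2 * q). split; [lra|]. intros M B F HB HF.
  set (t := fun k => match excluded_middle_informative (exists m, G m /\ cd m = k) with
    | left H => F (proj1_sig (constructive_indefinite_description _ H))
    | right _ => (fun _ => RtoC 0) end).
  assert (Ht1 : forall m, G m -> t (cd m) = F m).
  { intros m Hm. unfold t. destruct (excluded_middle_informative _) as [H|H].
    - destruct (constructive_indefinite_description _ H) as [m' [H1 H2]]. simpl.
      rewrite (Hinj m' m H1 Hm H2). reflexivity.
    - exfalso. apply H. exists m. auto. }
  assert (Ht2 : forall k, (exists m, G m /\ cd m = k) \/ t k = (fun _ => RtoC 0)).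
  { intros k. unfold t. destruct (excluded_middle_informative _) as [H|H]; auto. }
  clearbody t.
  set (mm := fun k => / (INR k + 1) ^ 2 * (Rabs M * A ^ 2)).
  assert (Hmm : ex_series mm) by (apply ex_series_scal_r, ex_series_inv_sqr).
  assert (HMA : 0 <= Rabs M * A^2) by (apply Rmult_le_pos; [apply Rabs_pos|apply pow_le; lra]).
  assert (Htg : forall k, hgrow phi (mm k) B (t k)).
  { intros k. pose proof (pos_INR k). destruct (Ht2 k) as [[m [Hm <-]]| ->].
    - rewrite Ht1 by assumption. apply (hgrow_le phi (M * exp (- (2 * q) * phi m)) B); auto; [apply (proj1 Hw)| |lra].
      specialize (Hbd m Hm). unfold mm. set (x := INR (cd m) + 1) in *.
      assert (Hx : 0 < x) by (unfold x; lra).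
      replace (- (2 * q) * phi m) with (- (q * phi m + q * phi m)) by ring. rewrite exp_Ropp, exp_plus.
      pose proof (exp_pos (q * phi m)) as He. set (y := exp (q * phi m)) in *.
      apply Rle_trans with (Rabs M * / (y * y)).
      { apply Rmult_le_compat_r; [apply Rinv_nonneg; nra|apply Rle_abs]. }
      replace (/ x ^ 2 * (Rabs M * A ^ 2)) with (Rabs M * (A ^ 2 / x ^ 2)) by (field; lra).
      apply Rmult_le_compat_l; [apply Rabs_pos|].
      apply Rle_div_r; [apply pow_lt; lra|].
      rewrite Rmult_comm. apply Rle_div_l; [nra|].
      replace (A ^ 2 * (y * y)) with ((A * y) ^ 2) by ring. apply pow_incr. lra.
    - apply (hgrow_le phi (Cmod 0) B); [apply (proj1 Hw)| |lra|apply hgrow_const; [apply (proj1 Hw)|assumption]].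
      rewrite Cmod_0. unfold mm. apply Rmult_le_pos; [|assumption].
      apply Rinv_nonneg, pow_lt. lra. }
  exists (fun z => Csum (fun k => t k z)), (2 * Series mm).
  split; [apply (weierstrass Hw); assumption|].
  split.
  - intros z Hz H. rewrite (Csum_ext _ (fun _ => 0%C)); [apply Csum_0|].
    intros k. destruct (Ht2 k) as [[m [Hm <-]]| ->]; [|reflexivity]. rewrite Ht1 by assumption. auto.
  - intros l z Hl Hz H.
    rewrite (Csum_single (cd l) (fun k => t k z) (fun k => mm k * exp (B * phi z))).
    + rewrite Ht1 by assumption. reflexivity.
    + intros k. apply Htg, Hz.
    + apply ex_series_scal_r. assumption.
    + intros k Hk. destruct (Ht2 k) as [[m [Hm <-]]| ->]; [|reflexivity]. rewrite Ht1 by assumption.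
      apply H; [assumption|]. intros ->. apply Hk. reflexivity.
Qed.

(* If the points are not close, the distance is bounded below by the distance
   to the unit circle; otherwise the two weights are comparable. *)
Lemma one_sided_bound {phi kap c D} (Hw : wconst phi kap c D) A B : 0 < A -> 0 <= B ->
  exists Q, 0 < Q /\ forall l m, disk l ->
    A * exp (- B * (phi l + phi m)) <= Cmod (l - m)%C -> exp (- Q * (phi l + 1)) <= Cmod (l - m)%C.
Proof.
  intros HA HB. destruct Hw as (Hp & Hk & Hc & HD & Hw1 & Hw2).
  exists (B * (1 + D) + kap + Rabs (ln A) + Rabs (ln c)).
  set (Q := B * (1 + D) + kap + Rabs (ln A) + Rabs (ln c)).
  pose proof (Rabs_pos (ln A)). pose proof (Rabs_pos (ln c)).
  assert (HBD : 0 <= B * (1 + D)) by (apply Rmult_le_pos; lra).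
  split; [unfold Q; lra|]. intros l m Hl H1.
  assert (Hpl := Hp l Hl).
  destruct (Rle_lt_dec (Cmod (m - l)) (c * (1 - Cmod l))) as [Hn|Hf].
  - eapply Rle_trans; [|exact H1].
    destruct (Hw2 l m Hl Hn) as [_ [G1 _]].
    rewrite <- (exp_ln A) at 1 by assumption. rewrite <- exp_plus. apply exp_le.
    pose proof (Rabs_maj2 (ln A)).
    assert (B * (phi l + phi m) <= B * ((1 + D) * (phi l + 1))) by (apply Rmult_le_compat_l; nra).
    assert (0 <= kap * (phi l + 1)) by nra.
    assert (0 <= Rabs (ln c) * (phi l + 1)) by nra.
    assert (0 <= Rabs (ln A) * phi l) by nra.
    unfold Q. nra.
  - rewrite Cmod_sub_sym. apply Rlt_le. eapply Rle_lt_trans; [|exact Hf].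
    apply Rle_trans with (c * exp (- kap * phi l)).
    + rewrite <- (exp_ln c) at 1 by lra. rewrite <- exp_plus. apply exp_le.
      pose proof (Rabs_maj2 (ln c)).
      assert (0 <= B * (1 + D) * (phi l + 1)) by nra.
      assert (0 <= Rabs (ln A) * (phi l + 1)) by nra.
      assert (0 <= Rabs (ln c) * phi l) by nra.
      unfold Q. nra.
    + apply Rmult_le_compat_l; [lra|]. apply Hw1, Hl.
Qed.

Lemma separated_of_pair {phi kap c D} (Hw : wconst phi kap c D) (G : C -> Prop) A B :
  (forall z, G z -> disk z) -> 0 < A -> 0 <= B ->
  (forall l m, G l -> G m -> l <> m -> A * exp (- B * (phi l + phi m)) <= Cmod (l - m)%C) ->
  separated phi G.
Proof.
  intros HG HA HB H.
  destruct (one_sided_bound Hw A B HA HB) as [Q [HQ HQ2]].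
  exists Q. split; [assumption|]. intros l m Hl Hm Hne. apply HQ2; auto.
Qed.

Lemma X_space_0 {phi kap c D} (Hw : wconst phi kap c D) L w : (forall z, L z -> disk z) ->
  X_space phi L 0 w -> A_seq phi L w.
Proof.
  intros HL HX. apply (X_space_XD Hw) in HX; [|assumption].
  destruct HX as [M [B [HM [HB HX]]]]. exists (M + 1), B. split; [lra|]. split; [assumption|].
  intros l Hl. specialize (HX (fun _ => l)). unfold wsum in HX; simpl in HX.
  eapply Rle_trans; [apply HX; split; [intros; assumption|intros; lia]|].
  apply Rmult_le_compat_r; [apply exp_nonneg|lra].
Qed.

(** The case of order 0 of [uniform_trace]: differences of order 0 are the values, and both bounds
    in [Bd] then say the same. *)
Lemma interp_uniform {phi kap c D} (Hw : wconst phi kap c D) G T :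
  interpolating_sequence phi G -> 0 < T ->
  exists M B, 0 <= M /\ 0 <= B /\ forall w, (forall l, G l -> Cmod (w l) <= exp (T * phi l)) ->
    exists f, hgrow phi M B f /\ forall l, G l -> f l = w l.
Proof.
  intros [[HG Hdis] Hint] HT.
  destruct (uniform_trace Hw G HG 0 T HT) as [M [B [HM [HB H]]]].
  - intros w HX. apply Hint, (X_space_0 Hw); assumption.
  - exists M, B. split; [assumption|]. split; [assumption|]. intros w Hwb. apply H. split.
    + intros l Hl. rewrite Rmult_1_l. auto.
    + intros p Hp. rewrite Rmult_1_l. unfold wsum; simpl. apply Hwb, (proj1 Hp). lia.
Qed.

Definition ind (m : C) (v : C) : C -> C := fun z => if excluded_middle_informative (z = m) then v else 0%C.

Lemma ind_eq m v : ind m v m = v.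
Proof. unfold ind. destruct (excluded_middle_informative (m = m)); congruence. Qed.

Lemma ind_neq m v z : z <> m -> ind m v z = 0%C.
Proof. intros H. unfold ind. destruct (excluded_middle_informative (z = m)); congruence. Qed.

Definition two_points (x y : C) : nat -> C := fun i => match i with O => x | _ => y end.

(** A function that is 1 at [m] and 0 at [l] has first difference 1 / (m - l); uniform interpolation
    bounds it independently of the pair. *)
Lemma interp_separated {phi kap c D} (Hw : wconst phi kap c D) G :
  interpolating_sequence phi G -> separated phi G.
Proof.
  intros Hint. assert (HG : forall z, G z -> disk z) by apply Hint.
  destruct (interp_uniform Hw G 1 Hint Rlt_0_1) as [M [B [HM [HB H]]]].
  destruct (Delta_growth Hw 1 B HB) as [B' [K' [HB' [HK' HD']]]].
  (* The summand 1 keeps the constant positive even if M * K' is 0. *)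
  apply (separated_of_pair Hw G (/ (M * K' + 1)) B' HG).
  - apply Rinv_0_lt_compat. nra.
  - lra.
  - intros l m Hl Hm Hne.
    destruct (H (ind m 1%C)) as [f [Hf1 Hf2]].
    { intros z Hz. apply Rle_trans with 1.
      - destruct (classic (z = m)) as [->|Hz2]; [rewrite ind_eq, Cmod_1; lra|rewrite ind_neq, Cmod_0 by assumption; lra].
      - rewrite Rmult_1_l. apply exp_ge_1, (proj1 Hw), HG, Hz. }
    assert (Hp : distinct_tuple disk 2 (two_points l m)).
    { split.
      - intros [|i] Hi; simpl; apply HG; assumption.
      - intros [|[|i]] [|[|k]]; simpl; intros; try lia; congruence. }
    pose proof (HD' f M Hf1 (two_points l m) Hp) as HX.
    unfold wsum in HX; simpl in HX. rewrite Hf2, Hf2, ind_eq, ind_neq in HX by assumption.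
    assert (Hn : (m - l)%C <> 0%C) by (apply Csub_neq_0; congruence).
    assert (Hn0 : 0 < Cmod (m - l)) by (apply Cmod_gt_0; assumption).
    replace ((1 - 0) / (m - l))%C with (/ (m - l))%C in HX by (field; assumption).
    rewrite Cmod_inv in HX by assumption.
    rewrite Cmod_sub_sym.
    set (E := exp (B' * (phi l + phi m))) in *. assert (HE : 0 < E) by apply exp_pos.
    replace (- B' * (phi l + phi m)) with (- (B' * (phi l + phi m))) by ring. rewrite exp_Ropp. fold E.
    rewrite <- Rinv_mult. rewrite <- (Rinv_inv (Cmod (m - l))).
    apply Rinv_le_contravar; [apply Rinv_0_lt_compat; assumption|]. nra.
Qed.

Lemma discrete_subset (L L' : C -> Prop) : discrete_sequence L -> (forall z, L' z -> L z) -> discrete_sequence L'.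
Proof.
  intros [HL Hacc] Hsub. split; [auto|].
  intros z Hz H. apply (Hacc z Hz). intros eps He. destruct (H eps He) as [l [H1 H2]]. exists l. auto.
Qed.

Lemma interp_subset phi G G' : interpolating_sequence phi G -> (forall z, G' z -> G z) ->
  interpolating_sequence phi G'.
Proof.
  intros [HG Hint] Hsub. split; [apply (discrete_subset G); assumption|].
  intros w.
    set (w' := fun z => if excluded_middle_informative (G' z) then w z else 0%C).
    assert (E : forall z, G' z -> w' z = w z).
    { intros z Hz. unfold w'. destruct (excluded_middle_informative (G' z)); tauto. }
    assert (E0 : forall z, ~ G' z -> w' z = 0%C).
    { intros z Hz. unfold w'. destruct (excluded_middle_informative (G' z)); tauto. }
    split.
    + intros [f [Hf Hfw]].
      assert (HA : A_seq phi G f).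
      { apply Hint. exists f. auto. }
      destruct HA as [A [B [HA [HB HAB]]]]. exists A, B. split; [assumption|]. split; [assumption|].
      intros l Hl. rewrite <- Hfw by assumption. auto.
    + intros [A [B [HA [HB HAB]]]].
      destruct (proj2 (Hint w')) as [f [Hf Hfw]].
      * exists A, B. split; [assumption|]. split; [assumption|]. intros l Hl.
        destruct (classic (G' l)) as [H|H].
        { rewrite E by assumption. auto. }
        { rewrite E0, Cmod_0 by assumption. apply Rmult_le_pos; [lra|apply exp_nonneg]. }
      * exists f. split; [assumption|]. intros l Hl. rewrite Hfw, E by auto. reflexivity.
Qed.

Lemma trace_A_seq phi G w : (forall z, G z -> disk z) -> trace phi G w -> A_seq phi G w.
Proof.
  intros HG [f [Hf Hfw]]. apply A_fun_hgrow in Hf. destruct Hf as [M [B [HB [Hf Hb]]]].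
  exists (Rabs M + 1), B. pose proof (Rabs_pos M). split; [lra|]. split; [assumption|].
  intros l Hl. rewrite <- Hfw by assumption. eapply Rle_trans; [apply Hb, HG, Hl|].
  apply Rmult_le_compat_r; [apply exp_nonneg|]. pose proof (Rle_abs M). lra.
Qed.

(** The distance [e] depends on [q] without control. The cap at 1 suits powers of [e] and its use as
    a separation in [code]. *)
Lemma isolated L q : discrete_sequence L -> disk q -> exists e, 0 < e <= 1 /\ forall l, L l -> l <> q -> e <= Cmod (q - l)%C.
Proof.
  intros [_ Hd] Hq. apply NNPP. intros Hn. apply (Hd q Hq). intros eps He.
  apply NNPP. intros Hn2. apply Hn. exists (Rmin eps 1). split.
  - split; [apply Rmin_pos; lra|apply Rmin_r].
  - intros l Hl Hlq. destruct (Rle_lt_dec (Rmin eps 1) (Cmod (q - l))) as [H|H]; [assumption|].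
    exfalso. apply Hn2. exists l. split; [assumption|]. split; [assumption|].
    rewrite Cmod_sub_sym. eapply Rlt_le_trans; [exact H|apply Rmin_l].
Qed.

Lemma A_fun_newton phi g a v : (forall z, disk z -> 0 <= phi z) -> disk a -> A_fun phi g ->
  A_fun phi (fun z => v + (z - a) * g z)%C.
Proof.
  intros Hp Ha Hg. apply A_fun_hgrow in Hg. destruct Hg as [M [B [HB Hg]]].
  apply A_fun_hgrow. eexists _, (0 + B). split; [lra|].
  apply hgrow_plus; [apply hgrow_const; [assumption|lra]|].
  apply hgrow_mult; [apply hgrow_lin; [assumption|lra|assumption]|eassumption].
Qed.

(** Newton's form w q + (z - q) g reduces the data to difference quotients on [G], whose
    denominators are bounded below because [q] is isolated. Constants may depend on [q], as a single
    point is added; this makes empty pieces non-empty. *)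
Lemma interp_add_point {phi kap c D} (Hw : wconst phi kap c D) L G q :
  discrete_sequence L -> (forall z, G z -> L z) -> L q -> ~ G q -> interpolating_sequence phi G ->
  interpolating_sequence phi (fun z => z = q \/ G z).
Proof.
  intros HL HGL HLq Hq Hint.
  assert (Hdq : disk q) by (apply HL, HLq).
  assert (Hsub : forall z, z = q \/ G z -> L z) by (intros z [->|Hz]; auto).
  split; [apply (discrete_subset L); assumption|].
  intros w. split; [apply trace_A_seq; intros z Hz; apply HL, Hsub, Hz|].
    intros [A [B [HA [HB HAB]]]].
    destruct (isolated L q HL Hdq) as [e [He Hiso]].
    destruct (proj2 (proj2 Hint (fun z => (w z - w q) / (z - q))%C)) as [g [Hg Hgw]].
    + exists ((A + A * exp (B * phi q)) * / e), B.
      assert (Hie : 0 < / e) by (apply Rinv_0_lt_compat; lra).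
      pose proof (exp_pos (B * phi q)).
      split; [apply Rmult_lt_0_compat; nra|]. split; [assumption|].
      intros l Hl. assert (Hne : l <> q) by congruence.
      rewrite Cmod_div by (apply Csub_neq_0; assumption). rewrite Cmod_sub_sym with (x := l).
      assert (Hi : / Cmod (q - l) <= / e) by (apply Rinv_le_contravar; [lra|apply Hiso; auto]).
      assert (H1 : Cmod (w l) <= A * exp (B * phi l)) by (apply HAB; auto).
      assert (H2 : Cmod (w q) <= A * exp (B * phi q)) by (apply HAB; auto).
      assert (H3 : 1 <= exp (B * phi l)).
      { apply exp_ge_1, Rmult_le_pos; [lra|]. apply (proj1 Hw), HL. auto. }
      assert (H4 : Cmod (w l - w q) <= (A + A * exp (B * phi q)) * exp (B * phi l)).
      { eapply Rle_trans; [apply Cmod_sub_le|]. assert (0 < A * exp (B * phi q)) by nra. nra. }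
      replace ((A + A * exp (B * phi q)) * / e * exp (B * phi l)) with ((A + A * exp (B * phi q)) * exp (B * phi l) * / e) by ring.
      apply Rmult_le_compat; [apply Cmod_ge_0| |assumption|assumption].
      apply Rinv_nonneg, Cmod_gt_0, Csub_neq_0. congruence.
    + exists (fun z => w q + (z - q) * g z)%C. split.
      * apply A_fun_newton; [apply (proj1 Hw)|assumption|assumption].
      * intros l [->|Hl]; [ring|]. rewrite Hgw by assumption. field. apply Csub_neq_0. congruence.
Qed.

(** * Unions of interpolating sequences *)

(** Each failure of near-minimality more than halves the value, which cannot fall below [e]. *)
Lemma near_min {X : Type} (P : X -> Prop) (v : X -> R) (e : R) : 0 < e ->
  (forall x, P x -> e <= v x) -> (exists x, P x) ->
  exists x, P x /\ forall y, P y -> v x <= 2 * v y.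
Proof.
  intros He Hlow [x0 Hx0].
  assert (Hind : forall n x, P x -> v x < e * 2^n -> exists x, P x /\ forall y, P y -> v x <= 2 * v y).
  { induction n as [|n IH]; intros x Hx Hv.
    - specialize (Hlow x Hx). simpl in Hv. lra.
    - destruct (classic (forall y, P y -> v x <= 2 * v y)) as [H|H]; [exists x; auto|].
      apply not_all_ex_not in H. destruct H as [y H]. apply imply_to_and in H. destruct H as [Hy H].
      apply (IH y Hy). simpl in Hv. lra. }
  destruct (Pow_x_infinity 2) with (b := v x0 / e + 1) as [n Hn].
  { rewrite Rabs_right; lra. }
  specialize (Hn n (le_n n)). rewrite Rabs_right in Hn by (apply Rle_ge, pow_le; lra).
  apply (Hind n x0 Hx0). apply Rlt_le_trans with (e * (v x0 / e + 1)).
  - replace (e * (v x0 / e + 1)) with (v x0 + e) by (field; lra). lra.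
  - apply Rmult_le_compat_l; lra.
Qed.

(** A nearest point of [G] may carry a much larger weight than [mu]. Within c (1 - |mu|) the weights
    are comparable; otherwise all distances from [mu] to [G] are at least of the order of exp (- kap
    * phi mu), and a fixed point [b] will do because the disk has diameter 2. [D] in the constant is
    for the first case; [kap], [phi b] and 4 / c are for the second. *)
Lemma near_point {phi kap c D} (Hw : wconst phi kap c D) G : discrete_sequence G -> (exists b, G b) ->
  exists Q, 0 < Q /\ forall mu, disk mu -> ~ G mu -> exists l d, G l /\ 0 < d <= 2 /\
    phi l <= Q * (phi mu + 1) /\ Cmod (mu - l)%C <= d * exp (Q * (phi mu + 1)) /\
    forall l', G l' -> d <= Cmod (mu - l')%C.
Proof.
  intros HG [b Hb]. assert (Hpb := proj1 Hw b (proj1 HG b Hb)).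
  assert (HGd := proj1 HG).
  destruct Hw as (Hp & Hk & Hc & HD & Hw1 & Hw2).
  exists (D + kap + phi b + 4 / c).
  assert (H4c : 4 < 4 / c).
  { apply Rmult_lt_reg_r with c; [lra|]. unfold Rdiv. rewrite Rmult_assoc, Rinv_l; lra. }
  set (Q := D + kap + phi b + 4 / c). assert (HQ : 0 < Q) by (unfold Q; lra).
  split; [assumption|]. intros mu Hmu Hn.
  assert (Hpm := Hp mu Hmu).
  destruct (isolated G mu HG Hmu) as [e [He Hiso]].
  destruct (near_min G (fun l => Cmod (mu - l)%C) e) as [l1 [Hl1 Hmin]].
  { lra. } { intros l Hl. apply Hiso; [assumption|congruence]. } { exists b; assumption. }
  set (x := Cmod (mu - l1)) in *.
  assert (Hx : 0 < x). { unfold x. specialize (Hiso l1 Hl1 ltac:(congruence)). lra. }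
  assert (Hdist : forall l, G l -> Cmod (mu - l) <= 2).
  { intros l Hl. pose proof (Cmod_sub_le mu l). specialize (HGd l Hl). unfold disk in *. lra. }
  assert (HE : 2 <= exp (Q * (phi mu + 1))).
  { apply Rle_trans with (exp 1).
    - pose proof (exp_ineq1 1 ltac:(lra)). lra.
    - apply exp_le. assert (1 <= Q) by (unfold Q; lra). nra. }
  destruct (Rle_lt_dec x (c * (1 - Cmod mu))) as [Hnear|Hfar].
  - exists l1, (x / 2). split; [assumption|]. split; [split; [lra|]|split; [|split]].
    + specialize (Hdist l1 Hl1). fold x in Hdist. lra.
    + destruct (Hw2 mu l1 Hmu) as [_ [H _]]; [rewrite Cmod_sub_sym; assumption|].
      assert (D <= Q) by (unfold Q; lra). nra.
    + fold x. nra.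
    + intros l' Hl'. specialize (Hmin l' Hl'). lra.
  - exists b, (x / 2). split; [assumption|]. split; [split; [lra|]|split; [|split]].
    + specialize (Hdist l1 Hl1). fold x in Hdist. lra.
    + assert (phi b <= Q) by (unfold Q; lra). nra.
    + apply Rle_trans with 2; [apply Hdist, Hb|].
      assert (G1 : c * exp (- kap * phi mu) <= x).
      { eapply Rle_trans; [|apply Rlt_le, Hfar]. apply Rmult_le_compat_l; [lra|auto]. }
      assert (G2 : 4 / c * exp (kap * phi mu) <= exp (Q * (phi mu + 1))).
      { apply Rle_trans with (exp (4 / c) * exp (kap * phi mu)).
        - apply Rmult_le_compat_r; [apply exp_nonneg|]. pose proof (exp_ineq1 (4 / c) ltac:(lra)). lra.
        - rewrite <- exp_plus. apply exp_le. 
          assert (0 <= (D + phi b) * (phi mu + 1)) by nra. assert (0 <= 4 / c * phi mu) by nra. unfold Q. nra. }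
      apply Rle_trans with (c * exp (- kap * phi mu) / 2 * (4 / c * exp (kap * phi mu))).
      { replace (- kap * phi mu) with (- (kap * phi mu)) by ring. rewrite exp_Ropp.
        apply Req_le. field. split; apply Rgt_not_eq; [lra|apply exp_pos]. }
      pose proof (exp_pos (- kap * phi mu)). pose proof (exp_pos (kap * phi mu)).
      apply Rmult_le_compat; [nra|nra|lra|assumption].
    + intros l' Hl'. specialize (Hmin l' Hl'). lra.
Qed.

(** Uniformity in [mu] comes from [d] being a lower bound for all distances to [G]: the data d / (z
    - mu) have modulus at most 1, so one pair of interpolation constants serves every [mu]. *)
Lemma vanish_fun {phi kap c D} (Hw : wconst phi kap c D) G : interpolating_sequence phi G -> (exists b, G b) ->
  exists M B Q, 0 <= M /\ 0 <= B /\ 0 < Q /\ forall mu, disk mu -> ~ G mu -> exists F l, hgrow phi M B F /\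
    (forall l', G l' -> F l' = 0%C) /\ F mu <> 0%C /\ G l /\ phi l <= Q * (phi mu + 1) /\
    Cmod (mu - l)%C <= Cmod (F mu) * exp (Q * (phi mu + 1)).
Proof.
  intros Hint Hne.
  destruct (near_point Hw G (proj1 Hint) Hne) as [Q [HQ HN]].
  destruct (interp_uniform Hw G 1 Hint Rlt_0_1) as [M [B [HM [HB HI]]]].
  exists (2 + 2 * M), B, Q. split; [lra|]. split; [assumption|]. split; [assumption|].
  intros mu Hmu Hn. destruct (HN mu Hmu Hn) as [l [d [Hl [Hd [H1 [H2 H3]]]]]].
  destruct (HI (fun z => RtoC d / (z - mu))%C) as [h [Hh1 Hh2]].
  { intros z Hz. assert (Hne2 : z <> mu) by congruence.
    rewrite Cmod_div, Cmod_R, Rabs_right by (try apply Csub_neq_0; auto; lra).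
    apply Rle_trans with 1.
    - apply Rle_div_l; [apply Cmod_gt_0, Csub_neq_0; assumption|]. rewrite Cmod_sub_sym, Rmult_1_l. auto.
    - rewrite Rmult_1_l. apply exp_ge_1, (proj1 Hw), (proj1 Hint), Hz. }
  assert (Fmu : (RtoC d + (-(1)) * ((mu - mu) * h mu))%C = RtoC d) by ring.
  exists (fun z => RtoC d + (-(1)) * ((z - mu) * h z))%C, l.
  split; [|split; [|split; [|split; [|split]]]]; try assumption.
  - apply (hgrow_le phi (Cmod (RtoC d) + Cmod (-(1)) * (2 * M)) B); [apply (proj1 Hw)| |lra|].
    + rewrite Cmod_m1, Cmod_R, Rabs_right by lra. lra.
    + apply hgrow_plus; [apply hgrow_const; [apply (proj1 Hw)|assumption]|].
      apply hgrow_scal. replace B with (0 + B) by ring.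
      apply hgrow_mult; [apply hgrow_lin; [apply (proj1 Hw)|lra|assumption]|assumption].
  - intros l' Hl'. rewrite Hh2 by assumption. field. apply Csub_neq_0. congruence.
  - cbv beta. rewrite Fmu. intros E. apply RtoC_inj in E. lra.
  - cbv beta. rewrite Fmu, Cmod_R, Rabs_right by lra. assumption.
Qed.

(** The points [p i], one from each piece, form together with [mu] the tuple on which a divided
    difference of the data is evaluated; its denominator at [mu] is the product that [F mu]
    dominates here. *)
Lemma vanish_prod {phi kap c D} (Hw : wconst phi kap c D) (G : nat -> C -> Prop) (n : nat) :
  (forall i, (i < n)%nat -> interpolating_sequence phi (G i) /\ exists b, G i b) ->
  exists M B Q, 0 <= M /\ 0 <= B /\ 0 < Q /\ forall mu, disk mu -> (forall i, (i < n)%nat -> ~ G i mu) ->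
    exists F p, hgrow phi M B F /\ (forall i l', (i < n)%nat -> G i l' -> F l' = 0%C) /\ F mu <> 0%C /\
    (forall i, (i < n)%nat -> G i (p i) /\ phi (p i) <= Q * (phi mu + 1)) /\
    Cmod (facl mu (map p (seq 0 n))) <= Cmod (F mu) * exp (Q * (phi mu + 1)).
Proof.
  intros HG. induction n as [|n IH].
  - exists 1, 0, 1. split; [lra|]. split; [lra|]. split; [lra|]. intros mu Hmu _.
    exists (fun _ => 1%C), (fun _ => 0%C). split; [|split; [|split; [|split]]].
    + apply (hgrow_le phi (Cmod 1) 0); [apply (proj1 Hw)|rewrite Cmod_1; lra|lra|].
      apply hgrow_const; [apply (proj1 Hw)|lra].
    + intros; lia.
    + intros E. apply RtoC_inj in E. lra.
    + intros; lia.
    + simpl. rewrite Cmod_1, Rmult_1_l. apply exp_ge_1. pose proof (proj1 Hw mu Hmu). lra.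
  - destruct IH as [M1 [B1 [Q1 [HM1 [HB1 [HQ1 H1]]]]]]; [intros; apply HG; lia|].
    destruct (HG n ltac:(lia)) as [Hint Hne].
    destruct (vanish_fun Hw (G n) Hint Hne) as [M2 [B2 [Q2 [HM2 [HB2 [HQ2 H2]]]]]].
    exists (M1 * M2), (B1 + B2), (Q1 + Q2). split; [nra|]. split; [lra|]. split; [lra|].
    intros mu Hmu Hn.
    destruct (H1 mu Hmu) as [F1 [p [A1 [A2 [A3 [A4 A5]]]]]]; [intros; apply Hn; lia|].
    destruct (H2 mu Hmu) as [F2 [l [C1 [C2 [C3 [C4 [C5 C6]]]]]]]; [apply Hn; lia|].
    pose proof (proj1 Hw mu Hmu) as Hpm.
    exists (fun z => F1 z * F2 z)%C, (extend n p l).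
    split; [apply hgrow_mult; assumption|]. split; [|split; [|split]].
    + intros i l' Hi Hl'. destruct (Nat.eq_dec i n) as [->|Hin].
      * rewrite C2 by assumption. ring.
      * rewrite (A2 i) by (try lia; assumption). ring.
    + apply Cmult_neq_0; assumption.
    + intros i Hi. destruct (Nat.eq_dec i n) as [->|Hin].
      * rewrite extend_last. split; [assumption|]. nra.
      * rewrite extend_lt by lia. destruct (A4 i ltac:(lia)) as [E1 E2]. split; [assumption|]. nra.
    + rewrite seq_S, map_app, facl_app. simpl plus. simpl map. rewrite extend_last.
      rewrite (map_ext_in _ p) by (intros i Hi; apply in_seq in Hi; apply extend_lt; lia).
      simpl facl. rewrite fac_neq by (intros ->; apply (Hn n); [lia|assumption]).
      rewrite Cmult_1_r, !Cmod_mult, Rmult_plus_distr_r, exp_plus.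
      replace (Cmod (F1 mu) * Cmod (F2 mu) * (exp (Q1 * (phi mu + 1)) * exp (Q2 * (phi mu + 1)))) with
        ((Cmod (F1 mu) * exp (Q1 * (phi mu + 1))) * (Cmod (F2 mu) * exp (Q2 * (phi mu + 1)))) by ring.
      apply Rmult_le_compat; try apply Cmod_ge_0; assumption.
Qed.

Lemma A_fun_plus phi f g : (forall z, disk z -> 0 <= phi z) -> A_fun phi f -> A_fun phi g ->
  A_fun phi (fun z => f z + g z)%C.
Proof.
  intros Hp Hf Hg. apply A_fun_hgrow in Hf. apply A_fun_hgrow in Hg. apply A_fun_hgrow.
  destruct Hf as [M [B [HB Hf]]]. destruct Hg as [M' [B' [HB' Hg]]].
  exists (M + M'), (B + B'). split; [lra|].
  apply hgrow_plus; [apply (hgrow_le phi M B)|apply (hgrow_le phi M' B')]; auto; lra.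
Qed.

Lemma hgrow_A_fun phi M B f : (forall z, disk z -> 0 <= phi z) -> hgrow phi M B f -> A_fun phi f.
Proof.
  intros Hp Hf. apply A_fun_hgrow. exists M, (Rabs B + 1). pose proof (Rabs_pos B). pose proof (Rle_abs B).
  split; [lra|]. apply (hgrow_le phi M B); auto; lra.
Qed.

Lemma XD_ext phi L k M B v w : (forall l, L l -> v l = w l) -> XD phi L k M B v -> XD phi L k M B w.
Proof.
  intros E H p Hp. rewrite <- (Delta_ext k v w p p); [auto|].
  intros i Hi. split; [apply E, (proj1 Hp); lia|reflexivity].
Qed.

Lemma trace_X_space {phi kap c D} (Hw : wconst phi kap c D) L k w : (forall z, L z -> disk z) ->
  trace phi L w -> X_space phi L k w.
Proof.
  intros HL [f [Hf Hfw]]. apply A_fun_hgrow in Hf. destruct Hf as [M [B [HB Hf]]].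
  pose proof (hgrow_nonneg _ _ _ _ Hf) as HM.
  destruct (Delta_growth Hw k B ltac:(lra)) as [B' [K' [HB' [HK' H]]]].
  apply (X_space_XD Hw); [assumption|]. exists (M * K'), B'.
  split; [nra|]. split; [assumption|]. apply (XD_ext phi L k _ _ f w Hfw).
  intros p Hp. apply (H f M Hf). apply (distinct_sub L disk); assumption.
Qed.

(** This drives the induction on pieces: fixing a node [a] of the last piece lowers the order by
    one, to match the number of remaining pieces. *)
Lemma XD_quot phi L L' n M B w a : (forall z, L' z -> L z) -> L a -> ~ L' a ->
  XD phi L (S n) M B w -> XD phi L' n (M * exp (B * phi a)) B (fun z => (w z - w a) / (z - a))%C.
Proof.
  intros HLL Ha Ha' H p Hp.
  set (p' := extend (S n) p a).
  assert (E1 : forall i, (i <= n)%nat -> p' i = p i) by (intros i Hi; apply extend_lt; lia).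
  assert (E2 : p' (S n) = a) by apply extend_last.
  assert (HpL : forall i, (i <= n)%nat -> L' (p i)) by (intros i Hi; apply (proj1 Hp); lia).
  assert (Hp' : distinct_tuple L (S (S n)) p') by (apply (distinct_extend L L'); assumption).
  specialize (H p' Hp').
  rewrite (Delta_quot w (fun z => (w z - w a) / (z - a))%C a n p') in H.
  - rewrite (Delta_ext n _ (fun z => (w z - w a) / (z - a))%C p' p) in H.
    + eapply Rle_trans; [exact H|]. rewrite Rmult_assoc, <- exp_plus. apply Req_le. do 2 f_equal.
      unfold wsum. simpl sum_f_R0. rewrite E2.
      rewrite (sum_eq _ (fun i => phi (p i))) by (intros i Hi; rewrite E1 by assumption; reflexivity). ring.
    + intros i Hi. rewrite E1 by assumption. split; reflexivity.
  - apply (distinct_inj L), Hp'.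
  - assumption.
  - intros i Hi. rewrite E1 by assumption. field. apply Csub_neq_0. intros E. apply Ha'. rewrite <- E. apply HpL, Hi.
Qed.

(** Pieces are non-empty so that a point can be picked in each of them, and disjoint so that the
    picked points form a tuple of distinct points. *)
Lemma interpolation_of_union {phi kap c D} (Hw : wconst phi kap c D) (n : nat) : forall (G : nat -> C -> Prop) L,
  discrete_sequence L ->
  (forall i, (i <= n)%nat -> interpolating_sequence phi (G i) /\ exists b, G i b) ->
  (forall i k z, (i <= n)%nat -> (k <= n)%nat -> G i z -> G k z -> i = k) ->
  (forall z, L z <-> exists i, (i <= n)%nat /\ G i z) ->
  forall w, X_space phi L n w -> trace phi L w.
Proof.
  induction n as [|n IH]; intros G L HL HG Hdisj HLG w HX.
  - destruct (HG O (le_n _)) as [Hint _].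
    apply (X_space_0 Hw) in HX; [|apply HL].
    assert (HLG0 : forall z, L z -> G O z).
    { intros z Hz. apply HLG in Hz. destruct Hz as [i [Hi Hz]]. replace i with O in Hz by lia. exact Hz. }
    apply (interp_subset phi (G O) L Hint HLG0). exact HX.
  - apply (X_space_XD Hw) in HX; [|apply HL]. destruct HX as [M [B [HM [HB HX]]]].
    assert (Hp := proj1 Hw).
    destruct (HG (S n) (le_n _)) as [Hint [a Ha]].
    assert (HLa : L a) by (apply HLG; exists (S n); auto).
    set (L' := fun z => exists i, (i <= n)%nat /\ G i z).
    assert (HL'L : forall z, L' z -> L z).
    { intros z [i [Hi Hz]]. apply HLG. exists i. split; [lia|assumption]. }
    assert (HL'n : forall z, G (S n) z -> ~ L' z).
    { intros z Hz [i [Hi Hz']]. pose proof (Hdisj i (S n) z ltac:(lia) (le_n _) Hz' Hz). lia. }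
    assert (HGL : forall z, G (S n) z -> L z) by (intros z Hz; apply HLG; exists (S n); auto).
    destruct (IH G L') with (w := fun z => ((w z - w a) / (z - a))%C) as [g [Hg Hgw]].
    { apply (discrete_subset L); assumption. }
    { intros i Hi. apply HG. lia. }
    { intros i k z Hi Hk. apply Hdisj; lia. }
    { intros z. reflexivity. }
    { apply (X_space_XD Hw); [intros z Hz; apply HL, HL'L, Hz|].
      exists (M * exp (B * phi a)), B. split; [apply Rmult_le_pos; [assumption|apply exp_nonneg]|].
      split; [assumption|]. apply (XD_quot phi L L'); auto. }
    set (f1 := fun z => (w a + (z - a) * g z)%C).
    assert (Hf1 : A_fun phi f1) by (apply A_fun_newton; [assumption|apply HL, HLa|assumption]).
    assert (Hf1w : forall z, L' z -> f1 z = w z).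
    { intros z Hz. unfold f1. rewrite Hgw by assumption. field. apply Csub_neq_0. intros ->.
      apply (HL'n a Ha Hz). }
    clearbody f1.
    assert (HX1 : X_space phi L (S n) f1) by (apply (trace_X_space Hw); [apply HL|exists f1; auto]).
    apply (X_space_XD Hw) in HX1; [|apply HL]. destruct HX1 as [M1 [B1 [HM1 [HB1 HX1]]]].
    set (w1 := fun z => (w z - f1 z)%C).
    destruct (vanish_prod Hw G (S n)) as [MF [BF [Q [HMF [HBF [HQ HF]]]]]].
    { intros i Hi. apply HG. lia. }
    (* The weights along the tuple sum to at most INR (S (S n)) * (Q + 1) * (phi mu + 1), with
       exponent B + B1 for the difference of two functions; the last [Q] comes from the product of
       distances. *)
    set (Q3 := (B + B1) * (INR (S (S n)) * (Q + 1)) + Q).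
    assert (HS : 0 < INR (S (S n))) by (apply lt_0_INR; lia).
    assert (HQ3 : 0 < Q3) by (unfold Q3; assert (0 < INR (S (S n)) * (Q + 1)) by nra; nra).
    destruct (glue Hw (G (S n))) as [T0 [HT0 Hglue]]; [intros z Hz; apply HL; auto|apply (interp_separated Hw); assumption|].
    (* [Q3] pays for the size of w1 mu / F mu, [T0] for the gluing. *)
    set (T := T0 + Q3). assert (HT : 0 < T) by (unfold T; lra).
    destruct (interp_uniform Hw (G (S n)) T Hint HT) as [Mg [Bg [HMg [HBg Hg1]]]].
    assert (Hfam : forall mu, exists f, G (S n) mu ->
      hgrow phi ((M + M1) * exp Q3 * MF * Mg * exp (- T0 * phi mu)) (BF + Bg) f /\
      (forall l, L' l -> f l = 0%C) /\ (forall l, G (S n) l -> l <> mu -> f l = 0%C) /\ f mu = w1 mu).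
    { intros mu. destruct (classic (G (S n) mu)) as [Hmu|Hmu]; [|exists (fun _ => 0%C); intros; contradiction].
      assert (Hdmu : disk mu) by (apply HL; auto). assert (Hpm := Hp mu Hdmu).
      destruct (HF mu Hdmu) as [F [p [A1 [A2 [A3 [A4 A5]]]]]].
      { intros i Hi Hz. apply (HL'n mu Hmu). exists i. split; [lia|assumption]. }
      destruct (Hg1 (ind mu (RtoC (exp (T * phi mu))))) as [h [Hh1 Hh2]].
      { intros l Hl. destruct (classic (l = mu)) as [->|Hne].
        - rewrite ind_eq, Cmod_R, Rabs_right; [lra|apply Rle_ge, Rlt_le, exp_pos].
        - rewrite ind_neq, Cmod_0 by assumption. apply exp_nonneg. }
      (* [w1] vanishes at the points [p i], so its difference of order S n at these and [mu] is w1
         mu divided by the product of distances. *)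
      assert (Hw1 : Cmod (w1 mu) <= Cmod (F mu) * ((M + M1) * exp (Q3 * (phi mu + 1)))).
      { set (p' := extend (S n) p mu).
        assert (E1 : forall i, (i < S n)%nat -> p' i = p i) by (intros i Hi; apply extend_lt; lia).
        assert (E2 : p' (S n) = mu) by apply extend_last.
        assert (HpL : forall i, (i < S n)%nat -> L' (p i)) by (intros i Hi; exists i; split; [lia|apply A4; assumption]).
        assert (Hp' : distinct_tuple L (S (S n)) p').
        { apply (distinct_extend L L'); auto. split; [assumption|].
          intros i k Hi Hk Hik E. apply Hik.
          apply (Hdisj i k (p i)); [lia|lia|apply A4; lia|rewrite E; apply A4; lia]. }
        destruct (Delta_single w1 mu (S n) p') as [HDs _].
        { apply (distinct_inj L), Hp'. }
        { intros i Hi Hne. destruct (Nat.eq_dec i (S n)) as [->|Hi2]; [contradiction|].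
          rewrite E1 by lia. unfold w1. rewrite Hf1w by (apply HpL; lia). ring. }
        specialize (HDs (ex_intro _ (S n) (conj (le_n _) E2))).
        assert (Hfac : facl mu (tup (S n) p') = facl mu (map p (seq 0 (S n)))).
        { rewrite tup_Sr, facl_app, E2. unfold tup.
          rewrite (map_ext_in p' p) by (intros i Hi; apply in_seq in Hi; apply E1; lia).
          cbn [facl fold_right]. rewrite fac_eq. ring. }
        pose proof (facl_nz mu (map p (seq 0 (S n)))) as Hnz.
        set (P := facl mu (map p (seq 0 (S n)))) in *.
        rewrite Hfac in HDs.
        assert (Ews : wsum phi p' (S n) <= INR (S (S n)) * ((Q + 1) * (phi mu + 1))).
        { apply wsum_bound. intros i Hi. destruct (Nat.eq_dec i (S n)) as [->|Hi2].
          - rewrite E2. nra.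
          - rewrite E1 by lia. assert (phi (p i) <= Q * (phi mu + 1)) by (apply A4; lia). nra. }
        assert (Ews0 : 0 <= wsum phi p' (S n)).
        { apply wsum_nonneg. intros i Hi. apply Hp, HL, (proj1 Hp'). lia. }
        assert (HDw : Cmod (Delta (S n) w1 p') <= (M + M1) * exp ((B + B1) * wsum phi p' (S n))).
        { unfold w1. rewrite Delta_minus. eapply Rle_trans; [apply Cmod_sub_le|].
          specialize (HX p' Hp'). specialize (HX1 p' Hp').
          assert (exp (B * wsum phi p' (S n)) <= exp ((B + B1) * wsum phi p' (S n))) by (apply exp_le; nra).
          assert (exp (B1 * wsum phi p' (S n)) <= exp ((B + B1) * wsum phi p' (S n))) by (apply exp_le; nra).
          nra. }
        rewrite HDs, Cmod_div in HDw by assumption.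
        assert (HP : 0 < Cmod P) by (apply Cmod_gt_0; assumption).
        apply (proj1 (Rle_div_l _ _ _ HP)) in HDw.
        eapply Rle_trans; [exact HDw|].
        apply Rle_trans with ((M + M1) * exp ((B + B1) * (INR (S (S n)) * ((Q + 1) * (phi mu + 1)))) * (Cmod (F mu) * exp (Q * (phi mu + 1)))).
        - apply Rmult_le_compat; [apply Rmult_le_pos; [lra|apply exp_nonneg]|lra| |exact A5].
          apply Rmult_le_compat_l; [lra|]. apply exp_le. apply Rmult_le_compat_l; lra.
        - apply Req_le.
          replace (Q3 * (phi mu + 1)) with ((B + B1) * (INR (S (S n)) * ((Q + 1) * (phi mu + 1))) + Q * (phi mu + 1)) by (unfold Q3; ring).
          rewrite exp_plus. ring. }
      assert (HFm : 0 < Cmod (F mu)) by (apply Cmod_gt_0; assumption).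
      set (cst := (w1 mu / F mu * RtoC (exp (- (T * phi mu))))%C).
      exists (fun z => cst * (F z * h z))%C. intros _. split; [|split; [|split]].
      - apply (hgrow_le phi (Cmod cst * (MF * Mg)) (BF + Bg)); [assumption| |lra|apply hgrow_scal, hgrow_mult; assumption].
        replace ((M + M1) * exp Q3 * MF * Mg * exp (- T0 * phi mu)) with ((M + M1) * exp Q3 * exp (- T0 * phi mu) * (MF * Mg)) by ring.
        apply Rmult_le_compat_r; [nra|].
        unfold cst. rewrite Cmod_mult, Cmod_div, Cmod_R by assumption.
        rewrite Rabs_right by (apply Rle_ge, Rlt_le, exp_pos).
        apply Rle_trans with ((M + M1) * exp (Q3 * (phi mu + 1)) * exp (- (T * phi mu))).
        + apply Rmult_le_compat_r; [apply exp_nonneg|]. apply Rle_div_l; [assumption|]. lra.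
        + rewrite !Rmult_assoc, <- !exp_plus. apply Rmult_le_compat_l; [lra|]. apply exp_le. unfold T. lra.
      - intros l [i [Hi Hl]]. rewrite (A2 i l) by (try lia; assumption). ring.
      - intros l Hl Hne. rewrite Hh2, ind_neq by assumption. ring.
      - rewrite Hh2, ind_eq by assumption. unfold cst. rewrite exp_Ropp.
        rewrite RtoC_inv by (apply Rgt_not_eq, exp_pos). field. split; [|assumption].
        intros E. apply RtoC_inj in E. pose proof (exp_pos (T * phi mu)). lra. }
    destruct (functional_choice _ Hfam) as [Fam HFam].
    destruct (Hglue ((M + M1) * exp Q3 * MF * Mg) (BF + Bg) Fam) as [f2 [M2 [Hf2 [Hz1 Hz2]]]]; [lra|intros; apply HFam; assumption|].
    exists (fun z => f1 z + f2 z)%C. split.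
    + apply A_fun_plus; [assumption|assumption|]. apply (hgrow_A_fun phi M2 (BF + Bg)); assumption.
    + intros l Hl. pose proof (proj1 HL l Hl) as Hdl. apply HLG in Hl. destruct Hl as [i [Hi Hl]].
      destruct (Nat.eq_dec i (S n)) as [->|Hi2].
      * rewrite (Hz2 l l Hl Hdl).
        { destruct (HFam l Hl) as (_ & _ & _ & ->). unfold w1. ring. }
        { intros m Hm Hne. apply HFam; auto. }
      * assert (Hl' : L' l) by (exists i; split; [lia|assumption]).
        rewrite Hf1w, (Hz1 l Hdl) by (try assumption; intros m Hm; destruct (HFam m Hm) as (_ & HF0 & _); auto). ring.
Qed.

(** Newton interpolation. It covers the sets with fewer than [n] points, on which the condition on
    n-tuples is empty. *)
Lemma finite_trace phi (Hp : forall z, disk z -> 0 <= phi z) (k : nat) : forall p w, distinct_tuple disk k p ->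
  exists f, A_fun phi f /\ forall i, (i < k)%nat -> f (p i) = w (p i).
Proof.
  induction k as [|k IH]; intros p w Hpp.
  - exists (fun _ => 0%C). split; [|intros; lia].
    apply (hgrow_A_fun phi (Cmod 0) 0); [assumption|]. apply hgrow_const; [assumption|lra].
  - destruct (IH p (fun z => (w z - w (p k)) / (z - p k))%C) as [g [Hg Hgw]].
    { split; [intros i Hi; apply (proj1 Hpp); lia|intros i j Hi Hj; apply (proj2 Hpp); lia]. }
    exists (fun z => w (p k) + (z - p k) * g z)%C. split.
    + apply A_fun_newton; [assumption|apply (proj1 Hpp); lia|assumption].
    + intros i Hi. destruct (Nat.eq_dec i k) as [->|Hik]; [ring|].
      rewrite Hgw by lia. field. apply Csub_neq_0, (proj2 Hpp); lia.
Qed.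

Lemma tuple_dichotomy (L : C -> Prop) (n : nat) :
  (exists p, distinct_tuple L n p) \/
  (exists k p, (k < n)%nat /\ distinct_tuple L k p /\ forall z, L z -> exists i, (i < k)%nat /\ p i = z).
Proof.
  induction n as [|n IH].
  - left. exists (fun _ => 0%C). split; intros; lia.
  - destruct IH as [[p Hp]|[k [p [Hk H]]]]; [|right; exists k, p; split; [lia|assumption]].
    destruct (classic (exists q, L q /\ forall i, (i < n)%nat -> p i <> q)) as [[q [Hq Hqp]]|Hno].
    + left. exists (extend n p q). apply (distinct_extend L (fun z => L z /\ z <> q)); [tauto|assumption|tauto|].
      split; [|apply (proj2 Hp)]. intros i Hi. split; [apply (proj1 Hp), Hi|apply Hqp, Hi].
    + right. exists n, p. split; [lia|]. split; [assumption|]. intros z Hz. apply NNPP. intros Hn.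
      apply Hno. exists z. split; [assumption|]. intros i Hi E. apply Hn. exists i. auto.
Qed.

Lemma least_index (P : nat -> Prop) : (exists i, P i) -> exists i, P i /\ forall k, (k < i)%nat -> ~ P k.
Proof.
  intros [i Hi]. revert Hi. induction i as [i IH] using lt_wf_ind. intros Hi.
  destruct (classic (exists k, (k < i)%nat /\ P k)) as [[k [Hk Hk2]]|Hn]; [apply (IH k); assumption|].
  exists i. split; [assumption|]. intros k Hk Hk2. apply Hn. exists k. auto.
Qed.

Theorem union_interpolation phi L n : weight phi -> discrete_sequence L -> (1 <= n)%nat ->
  union_of_interpolating phi L n -> forall w, trace phi L w <-> X_space phi L (n - 1) w.
Proof.
  intros Hphi HL Hn [G [HG HLG]] w.
  destruct (weight_wconst phi Hphi) as [kap [c [D Hw]]].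
  split; [apply (trace_X_space Hw); apply HL|].
  destruct (tuple_dichotomy L n) as [[q Hq]|[k [p [Hk [Hp Hpz]]]]].
  (* To make the pieces disjoint and non-empty, [n] chosen points of [L] are given to one piece
     each, and any other point goes to the first piece that contains it. *)
  - set (G' := fun i z => z = q i \/ (G i z /\ (forall k, (k < n)%nat -> z <> q k) /\ forall k, (k < i)%nat -> ~ G k z)).
    apply (interpolation_of_union Hw (n - 1) G' L HL).
    + intros i Hi. split; [|exists (q i); left; reflexivity].
      apply (interp_add_point Hw L); auto.
      * intros z [Hz _]. apply HLG. exists i. split; [lia|assumption].
      * apply (proj1 Hq). lia.
      * intros [_ [H _]]. apply (H i); [lia|reflexivity].
      * apply (interp_subset phi (G i)); [apply HG; lia|]. intros z [Hz _]. assumption.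
    + intros i j z Hi Hj [Hi1|[Hi1 [Hi2 Hi3]]] [Hj1|[Hj1 [Hj2 Hj3]]].
      * apply NNPP. intros Hij. apply (proj2 Hq i j ltac:(lia) ltac:(lia) Hij). congruence.
      * exfalso. apply (Hj2 i); [lia|assumption].
      * exfalso. apply (Hi2 j); [lia|assumption].
      * destruct (Nat.lt_trichotomy i j) as [H|[H|H]]; [exfalso; apply (Hj3 i); assumption|assumption|exfalso; apply (Hi3 j); assumption].
    + intros z. split.
      * intros Hz. destruct (classic (exists k, (k < n)%nat /\ z = q k)) as [[k [Hk ->]]|Hno].
        { exists k. split; [lia|left; reflexivity]. }
        apply HLG in Hz. destruct (least_index _ Hz) as [i [[Hi1 Hi2] Hi3]].
        exists i. split; [lia|]. right. split; [assumption|]. split.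
        { intros k Hk E. apply Hno. exists k. auto. }
        { intros k Hk E. apply (Hi3 k Hk). split; [lia|assumption]. }
      * intros [i [Hi [->|[Hz _]]]]; [apply (proj1 Hq); lia|]. apply HLG. exists i. split; [lia|assumption].
  - intros _. destruct (finite_trace phi (proj1 Hw) k p w) as [f [Hf Hfw]].
    + apply (distinct_sub L disk); [apply HL|assumption].
    + exists f. split; [assumption|]. intros l Hl. destruct (Hpz l Hl) as [i [Hi <-]]. auto.
Qed.

(** * Partition into interpolating sequences *)

Section Colouring.
Variables (X : Type) (L : X -> Prop) (cd : X -> nat) (E : X -> X -> Prop) (n : nat).
Hypothesis Hcd : forall x y, L x -> L y -> cd x = cd y -> x = y.
Hypothesis Esym : forall x y, E x y -> E y x.
Hypothesis Hdeg : forall x, L x -> ~ exists v, NoDup v /\ length v = n /\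
  forall y, In y v -> L y /\ y <> x /\ E x y.

Definition free (k : nat) (t : nat -> nat) (a : nat) : Prop :=
  (a < n)%nat /\ forall x y, L x -> cd x = k -> L y -> (cd y < k)%nat -> E x y -> t (cd y) <> a.

(** Colours are stored by code, and [table k] settles the codes below [k]. A code that belongs to no
    point also receives a value, which no point ever reads. *)
Fixpoint table (k : nat) : nat -> nat :=
  match k with
  | O => fun _ => O
  | S k => fun i => if Nat.eqb i k then epsilon (inhabits O) (free k (table k)) else table k i
  end.

Lemma table_stable k i : (i < k)%nat -> table k i = table (S i) i.
Proof.
  induction k as [|k IH]; [lia|]. intros Hi. destruct (Nat.eq_dec i k) as [->|Hne]; [reflexivity|].
  rewrite <- IH by lia. cbn [table]. rewrite (proj2 (Nat.eqb_neq i k) Hne). reflexivity.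
Qed.

(** Pigeonhole: if no colour were free, each of the [n] colours would be carried by an earlier
    neighbour, and one neighbour per colour would give [n] distinct ones, against [Hdeg]. *)
Lemma table_free x : L x -> free (cd x) (table (cd x)) (table (S (cd x)) (cd x)).
Proof.
  intros Hx. cbn [table]. rewrite Nat.eqb_refl. apply epsilon_spec.
  apply NNPP. intros Hno.
  assert (Hall : forall a, exists y, (a < n)%nat -> L y /\ (cd y < cd x)%nat /\ E x y /\ table (cd x) (cd y) = a).
  { intros a. apply NNPP. intros Hn. apply Hno. exists a. split.
    - apply NNPP. intros Ha. apply Hn. exists x. intros; contradiction.
    - intros x' y Hx' Hxx Hy Hlt Hxy Heq. apply Hn. exists y. intros _.
      rewrite (Hcd x' x Hx' Hx Hxx) in Hxy. auto. }
  destruct (functional_choice _ Hall) as [g Hg].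
  apply (Hdeg x Hx). exists (map g (seq 0 n)). split; [|split].
  - apply (NoDup_map_inv (fun y => table (cd x) (cd y))). rewrite map_map.
    rewrite (map_ext_in _ (fun a => a)).
    + rewrite map_id. apply seq_NoDup.
    + intros a Ha. apply in_seq in Ha. apply Hg. lia.
  - rewrite length_map, length_seq. reflexivity.
  - intros y Hy. apply in_map_iff in Hy. destruct Hy as [a [<- Ha]]. apply in_seq in Ha.
    destruct (Hg a ltac:(lia)) as [H1 [H2 [H3 _]]]. split; [assumption|]. split; [|assumption].
    intros Eq. rewrite Eq in H2. lia.
Qed.

Lemma greedy_colouring : exists col : X -> nat, (forall x, L x -> (col x < n)%nat) /\
  forall x y, L x -> L y -> x <> y -> E x y -> col x <> col y.
Proof.
  exists (fun x => table (S (cd x)) (cd x)). split.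
  - intros x Hx. apply (table_free x Hx).
  - assert (Hlt : forall x y, L x -> L y -> (cd y < cd x)%nat -> E x y -> table (S (cd x)) (cd x) <> table (S (cd y)) (cd y)).
    { intros x y Hx Hy Hlt Hxy. destruct (table_free x Hx) as [_ H].
      rewrite <- (table_stable (cd x) (cd y) Hlt). apply not_eq_sym. apply (H x y); auto. }
    intros x y Hx Hy Hne Hxy. destruct (Nat.lt_trichotomy (cd x) (cd y)) as [H|[H|H]].
    + apply not_eq_sym, Hlt; auto.
    + exfalso. apply Hne, Hcd; assumption.
    + apply Hlt; auto.
Qed.
End Colouring.

(** * Products over lists of points and repeated division *)

Lemma tup_nth k (l : list C) : length l = S k -> tup k (fun i => nth i l 0%C) = l.
Proof.
  intros Hl. apply (nth_ext _ _ (nth 0 l 0%C) 0%C).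
  - unfold tup. rewrite length_map, length_seq. congruence.
  - intros i Hi. unfold tup in *. rewrite length_map, length_seq in Hi.
    rewrite (map_nth (fun i => nth i l 0%C) (seq 0 (S k)) 0%nat i).
    rewrite seq_nth by assumption. reflexivity.
Qed.

Lemma distinct_nth (L : C -> Prop) l : NoDup l -> (forall x, In x l -> L x) ->
  distinct_tuple L (length l) (fun i => nth i l 0%C).
Proof.
  intros Hnd HL. split.
  - intros i Hi. apply HL, nth_In, Hi.
  - intros i k Hi Hk Hik E. apply Hik. apply (proj1 (NoDup_nth l 0%C) Hnd); assumption.
Qed.

Lemma tup_NoDup k p : inj_upto k p -> NoDup (tup k p).
Proof.
  intros Hp. apply (NoDup_nth _ (p O)). unfold tup. rewrite length_map, length_seq. intros i m Hi Hm E.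
  rewrite !map_nth, !seq_nth in E by assumption. apply NNPP. intros Hne. apply (Hp i m); [lia|lia|assumption|exact E].
Qed.

Lemma length_tup k p : length (tup k p) = S k.
Proof. unfold tup. rewrite length_map, length_seq. reflexivity. Qed.

Lemma Cmult_zero (x y : C) : (x * y)%C = 0%C -> x = 0%C \/ y = 0%C.
Proof.
  intros H. destruct (classic (x = 0%C)) as [Hx|Hx]; [left; assumption|right].
  apply NNPP. intros Hy. apply (Cmult_neq_0 x y); assumption.
Qed.

(** Unlike [facl], this vanishes at the listed points: it is the polynomial that is divided out. *)
Definition zprod (z : C) (l : list C) : C := fold_right (fun x acc => (z - x) * acc)%C 1%C l.

Lemma zprod_facl mu l : ~ In mu l -> zprod mu l = facl mu l.
Proof.
  induction l as [|x l IH]; intros H; simpl; [reflexivity|].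
  rewrite fac_neq by (intros ->; apply H; left; reflexivity).
  rewrite IH by (intros Hi; apply H; right; assumption). reflexivity.
Qed.

Lemma zprod_nz z l : ~ In z l -> zprod z l <> 0%C.
Proof. intros H. rewrite zprod_facl by assumption. apply facl_nz. Qed.

Lemma facl_filter mu b l :
  facl mu l = (facl mu (filter b l) * facl mu (filter (fun x => negb (b x)) l))%C.
Proof.
  induction l as [|x l IH]; simpl; [ring|]. rewrite IH. destruct (b x); simpl; ring.
Qed.

Lemma facl_lower mu e l : 0 <= e <= 1 -> (forall x, In x l -> e <= Cmod (mu - x)%C) ->
  forall m, (length l <= m)%nat -> e ^ m <= Cmod (facl mu l).
Proof.
  intros He. induction l as [|x l IH]; intros Hl m Hm.
  - simpl. rewrite Cmod_1. pose proof (pow_incr e 1 m He) as H. rewrite pow1 in H. exact H.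
  - destruct m as [|m]; [simpl in Hm; lia|]. simpl. rewrite Cmod_mult.
    apply Rmult_le_compat; [lra|apply pow_le; lra| |].
    + unfold fac. destruct (excluded_middle_informative (x = mu)); [rewrite Cmod_1; lra|apply Hl; left; reflexivity].
    + apply IH; [intros y Hy; apply Hl; right; assumption|simpl in Hm; lia].
Qed.

Definition lsum (phi : C -> R) (l : list C) : R := fold_right (fun x acc => phi x + acc) 0 l.

Lemma lsum_le phi l X m : 0 <= X -> (forall x, In x l -> phi x <= X) -> (length l <= m)%nat -> lsum phi l <= INR m * X.
Proof.
  intros HX. revert m. induction l as [|x l IH]; intros m Hl Hm; simpl.
  - apply Rmult_le_pos; [apply pos_INR|assumption].
  - destruct m as [|m]; [simpl in Hm; lia|]. rewrite S_INR.
    assert (phi x <= X) by (apply Hl; left; reflexivity).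
    assert (lsum phi l <= INR m * X) by (apply IH; [intros; apply Hl; right; assumption|simpl in Hm; lia]). lra.
Qed.

(** After division by one factor the other points are still zeros, because they are distinct. The
    constants depend on the bound [m] for the length and not on the list. *)
Lemma div_list {phi kap c D} (Hw : wconst phi kap c D) (m : nat) : forall B, 0 <= B ->
  exists B' K', 0 <= B' /\ 0 < K' /\ forall (f : C -> C) M S, (length S <= m)%nat -> NoDup S ->
    (forall x, In x S -> disk x /\ f x = 0%C) -> hgrow phi M B f ->
    exists g, hgrow phi (M * K' * exp (kap * lsum phi S)) B' g /\ forall z, f z = (zprod z S * g z)%C.
Proof.
  assert (Hp := proj1 Hw).
  induction m as [|m IH]; intros B HB.
  - exists B, 1. split; [assumption|]. split; [lra|]. intros f M S HS _ _ Hf.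
    destruct S; [|simpl in HS; lia]. exists f. split.
    + simpl. rewrite !Rmult_0_r, exp_0, !Rmult_1_r. assumption.
    + intros z. simpl. ring.
  - destruct (div_zero Hw B HB) as [B1 [K1 [HB1 [HK1 H1]]]].
    destruct (IH B1 HB1) as [B2 [K2 [HB2 [HK2 H2]]]].
    assert (HK : 0 < K1 * K2) by (apply Rmult_lt_0_compat; assumption).
    (* The summands [B] and 1 cover the empty list, for which the quotient is [f] itself. *)
    exists (B2 + B), (K1 * K2 + 1). split; [lra|]. split; [lra|].
    intros f M S HS Hnd Hz Hf. pose proof (hgrow_nonneg _ _ _ _ Hf) as HM.
    destruct S as [|x S].
    + exists f. split; [|intros z; simpl; ring].
      simpl. rewrite Rmult_0_r, exp_0, Rmult_1_r. apply (hgrow_le phi M B); auto; [nra|lra].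
    + destruct (H1 f M x (proj1 (Hz x (or_introl eq_refl))) Hf (proj2 (Hz x (or_introl eq_refl)))) as [g1 [Hg1 Hg1z]].
      inversion Hnd as [|x' S' Hx HndS]; subst.
      destruct (H2 g1 (M * K1 * exp (kap * phi x)) S) as [g [Hg Hgz]]; [simpl in HS; lia|assumption| |exact Hg1|].
      * intros y Hy. destruct (Hz y (or_intror Hy)) as [Hy1 Hy2]. split; [assumption|].
        rewrite Hg1z in Hy2. destruct (Cmult_zero _ _ Hy2) as [E|E]; [|assumption].
        exfalso. apply (Csub_neq_0 y x); [intros ->; contradiction|assumption].
      * exists g. split.
        { apply (hgrow_le phi (M * K1 * exp (kap * phi x) * K2 * exp (kap * lsum phi S)) B2); auto; [|lra].
          change (lsum phi (x :: S)) with (phi x + lsum phi S).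
          rewrite (Rmult_plus_distr_l kap), exp_plus.
          pose proof (exp_pos (kap * phi x)). pose proof (exp_pos (kap * lsum phi S)).
          replace (M * K1 * exp (kap * phi x) * K2 * exp (kap * lsum phi S)) with
            (M * (K1 * K2) * (exp (kap * phi x) * exp (kap * lsum phi S))) by ring.
          apply Rmult_le_compat_r; [nra|]. apply Rmult_le_compat_l; lra. }
        { intros z. rewrite Hg1z, Hgz. simpl. ring. }
Qed.

(** * From equality of the two spaces to a partition *)

Section Necessity.
Variables (phi : C -> R) (kap c D : R).
Hypothesis Hw : wconst phi kap c D.
Variable L : C -> Prop.
Hypothesis HL : discrete_sequence L.
Variable j : nat.
Hypothesis Htr : forall w, X_space phi L j w -> trace phi L w.

Definition adm (mu : C) (l : list C) : Prop :=
  NoDup l /\ (forall x, In x l -> L x /\ x <> mu) /\ (length l <= j)%nat.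

Definition near_minimizer (mu : C) (l : list C) : Prop :=
  adm mu l /\ forall l', adm mu l' -> Cmod (facl mu l) <= 2 * Cmod (facl mu l').

Lemma near_minimizer_ex mu : L mu -> exists l, near_minimizer mu l.
Proof.
  intros Hmu. destruct (isolated L mu HL (proj1 HL mu Hmu)) as [e [He Hiso]].
  apply (near_min (adm mu) (fun l => Cmod (facl mu l)) (e ^ j)).
  - apply pow_lt. lra.
  - intros l [_ [Hl1 Hl2]]. apply facl_lower; [lra| |assumption].
    intros x Hx. apply Hiso; apply Hl1, Hx.
  - exists []. split; [constructor|]. split; [intros x []|simpl; lia].
Qed.

Lemma facl_pos mu l : 0 < Cmod (facl mu l).
Proof. apply Cmod_gt_0, facl_nz. Qed.

(* Up to a factor 2, this is the largest value at [mu] for which the divided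
   differences of order [j] stay bounded. *)
Lemma single_in_unit_ball T mu l : 0 < T -> L mu -> near_minimizer mu l ->
  Bd phi L j T 1 (ind mu (RtoC (exp (T * phi mu) * (Cmod (facl mu l) / 2)))).
Proof.
  intros HT Hmu [_ Hmin]. assert (Hp := proj1 Hw).
  pose proof (exp_pos (T * phi mu)) as HE. pose proof (facl_pos mu l) as HP.
  split.
  - intros x Hx. rewrite Rmult_1_l. destruct (classic (x = mu)) as [->|Hne].
    + rewrite ind_eq, Cmod_R, Rabs_right by nra.
      assert (Hnil : adm mu []) by (split; [constructor|split; [intros y []|simpl; lia]]).
      specialize (Hmin [] Hnil). simpl in Hmin. rewrite Cmod_1 in Hmin. simpl. nra.
    + rewrite ind_neq, Cmod_0 by assumption. apply exp_nonneg.
  - intros p Hpp. rewrite Rmult_1_l.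
    assert (Hpos : forall i, (i <= j)%nat -> 0 <= phi (p i)) by (intros i Hi; apply Hp, HL, (proj1 Hpp); lia).
    destruct (Delta_single (ind mu (RtoC (exp (T * phi mu) * (Cmod (facl mu l) / 2)))) mu j p) as [H1 H2].
    + apply (distinct_inj L), Hpp.
    + intros i Hi Hne. apply ind_neq, Hne.
    + destruct (classic (exists i, (i <= j)%nat /\ p i = mu)) as [Hin|Hout].
      * rewrite (H1 Hin), ind_eq. clear H1 H2. destruct Hin as [i [Hi Ei]].
        assert (Hin : In mu (tup j p)) by (apply in_tup; exists i; auto).
        pose proof (tup_NoDup j p (distinct_inj L j p Hpp)) as Hnd.
        pose proof (length_tup j p) as Hlen.
        assert (HinL : forall x, In x (tup j p) -> L x).
        { intros x Hx. apply in_tup in Hx. destruct Hx as [k [Hk <-]]. apply (proj1 Hpp). lia. }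
        destruct (in_split _ _ Hin) as [l1 [l2 El]]. rewrite El in *.
        assert (Hf : facl mu (l1 ++ mu :: l2) = facl mu (l1 ++ l2)).
        { rewrite !facl_app. simpl. rewrite fac_eq. ring. }
        (* The tuple without [mu] is an admissible list of [j] points, so its product is at least
           half that of the near-minimizer. *)
        rewrite Hf. assert (Hadm : adm mu (l1 ++ l2)).
        { split; [apply (NoDup_remove_1 _ _ _ Hnd)|]. split.
          - intros x Hx. split.
            + apply HinL. apply in_app_iff in Hx. apply in_app_iff. simpl. tauto.
            + intros ->. apply (NoDup_remove_2 _ _ _ Hnd Hx).
          - rewrite length_app in *. simpl in Hlen. lia. }
        specialize (Hmin _ Hadm). pose proof (facl_pos mu (l1 ++ l2)) as HP2.
        rewrite Cmod_div, Cmod_R, Rabs_right by (try apply facl_nz; nra).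
        apply Rle_div_l; [assumption|].
        apply Rle_trans with (exp (T * phi mu) * Cmod (facl mu (l1 ++ l2))); [nra|].
        apply Rmult_le_compat_r; [lra|]. apply exp_le, Rmult_le_compat_l; [lra|].
        rewrite <- Ei. apply wsum_le; assumption.
      * rewrite H2, Cmod_0; [apply exp_nonneg|]. intros i Hi E. apply Hout. exists i. auto.
Qed.

(** Among S j points too close to [mu], one, [x], is outside the near-minimizer [l]. Trying to add
    [x] to [l], or to exchange a member for it, shows that [l] has exactly [j] members, all nearly
    as close to [mu]. On the nodes [mu], [x] and [l] the extension has a difference of order S j too
    large for [Delta_growth]. The factor 2 in the radius condition leaves room for the members of
    [l], which are only within twice the distance. *)
Lemma cluster_bound : exists Q, 0 < Q /\
  (forall mu, disk mu -> 2 * exp (- Q * (phi mu + 1)) <= c * (1 - Cmod mu)) /\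
  forall mu, L mu -> ~ exists v, NoDup v /\ length v = S j /\
    forall x, In x v -> L x /\ x <> mu /\ Cmod (mu - x)%C <= exp (- Q * (phi mu + 1)).
Proof.
  destruct (uniform_trace Hw L (proj1 HL) j 1 Rlt_0_1 Htr) as [M [B [HM [HB HU]]]].
  destruct (Delta_growth Hw (S j) B HB) as [B' [K' [HB' [HK' HG]]]].
  destruct Hw as (Hp & Hk & Hc & HD & Hw1 & Hw2).
  set (Q0 := B' * (INR (S (S j)) * D)).
  assert (HS : 0 < INR (S (S j))) by (apply lt_0_INR; lia).
  assert (HSD : 0 < INR (S (S j)) * D) by (apply Rmult_lt_0_compat; lra).
  assert (HQ0 : 0 < Q0) by (apply Rmult_lt_0_compat; assumption).
  assert (HMK : 0 <= M * K') by (apply Rmult_le_pos; lra).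
  assert (H2c : 2 < 2 / c).
  { apply Rmult_lt_reg_r with c; [lra|]. unfold Rdiv. rewrite Rmult_assoc, Rinv_l; lra. }
  (* [Q0] matches the exponent of the upper bound, 2 * (M * K') beats its constant by exp x >= 1 +
     x, and kap + 2 / c keeps the doubled radius below c (1 - |mu|). *)
  set (Q := Q0 + 2 * (M * K') + kap + 2 / c).
  assert (HQ : 0 < Q) by (unfold Q; lra).
  assert (Hd2 : forall mu, disk mu -> 2 * exp (- Q * (phi mu + 1)) <= c * (1 - Cmod mu)).
  { intros mu Hmu. pose proof (Hp mu Hmu).
    apply Rle_trans with (c * exp (- kap * phi mu)); [|apply Rmult_le_compat_l; [lra|auto]].
    apply Rmult_le_reg_l with (/ c); [apply Rinv_0_lt_compat; lra|].
    rewrite <- (Rmult_assoc (/ c) c), Rinv_l, Rmult_1_l by lra.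
    apply Rle_trans with (exp (2 / c) * exp (- Q * (phi mu + 1))).
    - rewrite <- Rmult_assoc. apply Rmult_le_compat_r; [apply exp_nonneg|].
      pose proof (exp_ineq1 (2 / c) ltac:(lra)). unfold Rdiv in *. lra.
    - rewrite <- exp_plus. apply exp_le.
      assert (0 <= (Q0 + 2 * (M * K') + 2 / c) * phi mu) by (apply Rmult_le_pos; lra).
      unfold Q. lra. }
  exists Q. split; [assumption|]. split; [assumption|].
  intros mu Hmu [v [Hnd [Hlen Hv]]].
  assert (Hdmu : disk mu) by (apply HL, Hmu). assert (Hpm := Hp mu Hdmu).
  set (d := exp (- Q * (phi mu + 1))) in *. assert (Hd : 0 < d) by apply exp_pos.
  assert (H2d : 2 * d <= c * (1 - Cmod mu)) by (apply Hd2, Hdmu).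
  assert (Hd1 : 2 * d < 1) by (pose proof (Cmod_ge_0 mu); unfold disk in Hdmu; nra).
  destruct (near_minimizer_ex mu Hmu) as [l Hl].
  destruct (HU _ (single_in_unit_ball 1 mu l Rlt_0_1 Hmu Hl)) as [f [Hf1 Hf2]].
  destruct Hl as [[Hl1 [Hl2 Hl3]] Hmin].
  pose proof (facl_pos mu l) as HP.
  assert (Hx : exists x, In x v /\ ~ In x l).
  { apply NNPP. intros Hno. assert (Hincl : incl v l).
    { intros x Hx. apply NNPP. intros Hn. apply Hno. exists x. auto. }
    pose proof (NoDup_incl_length Hnd Hincl). lia. }
  destruct Hx as [x [Hxv Hxl]]. destruct (Hv x Hxv) as [Hx1 [Hx2 Hx3]].
  assert (Hxpos : 0 < Cmod (mu - x)) by (apply Cmod_gt_0, Csub_neq_0; congruence).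
  assert (Hadmx : forall l', NoDup l' -> (forall y, In y l' -> In y l) -> (length l' < j)%nat -> adm mu (x :: l')).
  { intros l' Hn' Hi' Hlen'. split; [constructor; auto|]. split; [|simpl; lia].
    intros y [<-|Hy]; [split; assumption|apply Hl2; auto]. }
  assert (Hfx : forall l', Cmod (facl mu (x :: l')) = Cmod (mu - x) * Cmod (facl mu l')).
  { intros l'. simpl. rewrite fac_neq by assumption. apply Cmod_mult. }
  (* Otherwise [x] could be added, which multiplies the product by |mu - x| < 1 / 2. *)
  assert (Hlj : length l = j).
  { destruct (Nat.eq_dec (length l) j) as [E|E]; [assumption|].
    assert (Ha : adm mu (x :: l)) by (apply Hadmx; auto; lia).
    specialize (Hmin _ Ha). rewrite Hfx in Hmin. exfalso. nra. }
  (* Exchanging [y] for [x] may at best halve the product, so |mu - y| <= 2 |mu - x|. *)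
  assert (Hly : forall y, In y l -> Cmod (mu - y) <= 2 * d).
  { intros y Hy. destruct (in_split _ _ Hy) as [l1 [l2 El]].
    assert (Ha : adm mu (x :: l1 ++ l2)).
    { apply Hadmx.
      - rewrite El in Hl1. apply (NoDup_remove_1 _ _ _ Hl1).
      - intros z Hz. rewrite El. apply in_app_iff in Hz. apply in_app_iff. simpl. tauto.
      - rewrite El, length_app in Hlj. simpl in Hlj. rewrite length_app. lia. }
    specialize (Hmin _ Ha). rewrite Hfx in Hmin.
    assert (Ef : Cmod (facl mu l) = Cmod (mu - y) * Cmod (facl mu (l1 ++ l2))).
    { rewrite El, !facl_app. simpl. rewrite fac_neq by (apply Hl2, Hy). rewrite <- Cmod_mult. f_equal. ring. }
    rewrite Ef in Hmin. pose proof (facl_pos mu (l1 ++ l2)) as HP2.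
    apply Rmult_le_reg_r with (Cmod (facl mu (l1 ++ l2))); [assumption|]. nra. }
  set (m := mu :: x :: l).
  assert (Hmlen : length m = S (S j)) by (unfold m; simpl; rewrite Hlj; reflexivity).
  assert (HmL : forall y, In y m -> L y /\ Cmod (mu - y) <= 2 * d).
  { intros y [<-|[<-|Hy]].
    - split; [assumption|]. rewrite Cmod_diag. lra.
    - split; [assumption|lra].
    - split; [apply Hl2, Hy|apply Hly, Hy]. }
  assert (Hmnd : NoDup m).
  { constructor.
    - intros [E|E]; [congruence|]. destruct (Hl2 mu E). congruence.
    - constructor; assumption. }
  pose proof (distinct_nth L m Hmnd (fun y Hy => proj1 (HmL y Hy))) as Hdist.
  rewrite Hmlen in Hdist.
  set (p := fun i => nth i m 0%C) in *.
  assert (Hpm2 : forall i, (i <= S j)%nat -> In (p i) m).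
  { intros i Hi. apply nth_In. lia. }
  destruct (Delta_single f mu (S j) p) as [HDs _].
  { apply (distinct_inj L), Hdist. }
  { intros i Hi Hne. rewrite Hf2 by (apply HmL, Hpm2, Hi). apply ind_neq, Hne. }
  specialize (HDs (ex_intro _ O (conj (Nat.le_0_l _) eq_refl))).
  unfold p in HDs at 2. rewrite tup_nth in HDs by assumption.
  rewrite Hf2, ind_eq in HDs by assumption.
  pose proof (HG f M Hf1 p (distinct_sub L disk _ _ (proj1 HL) Hdist)) as Hup.
  assert (Efm : Cmod (facl mu m) = Cmod (mu - x) * Cmod (facl mu l)).
  { unfold m. change (facl mu (mu :: x :: l)) with (fac mu mu * facl mu (x :: l))%C.
    rewrite fac_eq, Cmult_1_l. apply Hfx. }
  rewrite HDs, Cmod_div, Efm, Cmod_R in Hup by apply facl_nz.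
  rewrite Rmult_1_l in Hup.
  pose proof (exp_ge_1 (phi mu) Hpm) as HE1.
  rewrite Rabs_right in Hup by nra.
  (* The product over [l] in the prescribed value cancels against the denominator of the difference;
     1 / (2 |mu - x|) is left, times exp (phi mu) >= 1. *)
  assert (Hlow : / (2 * d) <= exp (phi mu) * (Cmod (facl mu l) / 2) / (Cmod (mu - x) * Cmod (facl mu l))).
  { replace (exp (phi mu) * (Cmod (facl mu l) / 2) / (Cmod (mu - x) * Cmod (facl mu l))) with
      (exp (phi mu) * / (2 * Cmod (mu - x))) by (field; lra).
    rewrite <- (Rmult_1_l (/ (2 * d))). apply Rmult_le_compat; try lra.
    - apply Rinv_nonneg. lra.
    - apply Rinv_le_contravar; lra. }
  assert (Hws : wsum phi p (S j) <= INR (S (S j)) * (D * (phi mu + 1))).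
  { apply wsum_bound. intros i Hi. destruct (HmL _ (Hpm2 i Hi)) as [_ Hclose].
    destruct (Hw2 mu (p i) Hdmu) as [_ [H _]]; [rewrite Cmod_sub_sym; lra|]. lra. }
  assert (Hfin : / (2 * d) <= M * K' * exp (Q0 * (phi mu + 1))).
  { eapply Rle_trans; [exact Hlow|]. eapply Rle_trans; [exact Hup|].
    apply Rmult_le_compat_l; [assumption|]. apply exp_le.
    replace (Q0 * (phi mu + 1)) with (B' * (INR (S (S j)) * (D * (phi mu + 1)))) by (unfold Q0; ring).
    apply Rmult_le_compat_l; lra. }
  assert (Hdinv : / d = exp (Q * (phi mu + 1))).
  { unfold d. rewrite <- exp_Ropp. f_equal. ring. }
  rewrite Rinv_mult, Hdinv in Hfin.
  assert (Hbig : (2 * (M * K') + 1) * exp (Q0 * (phi mu + 1)) <= exp (Q * (phi mu + 1))).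
  { apply Rle_trans with (exp (2 * (M * K')) * exp (Q0 * (phi mu + 1))).
    - apply Rmult_le_compat_r; [apply exp_nonneg|].
      destruct HMK as [HMK|HMK].
      + pose proof (exp_ineq1 (2 * (M * K')) ltac:(lra)). lra.
      + rewrite <- HMK, Rmult_0_r, exp_0. lra.
    - rewrite <- exp_plus. apply exp_le.
      assert (0 <= 2 * (M * K') * phi mu) by (apply Rmult_le_pos; lra).
      assert (0 <= (kap + 2 / c) * (phi mu + 1)) by (apply Rmult_le_pos; lra).
      unfold Q. lra. }
  pose proof (exp_pos (Q0 * (phi mu + 1))). lra.
Qed.

(* Dividing an extension of the function of [single_in_unit_ball] by the factors
   of the neighbours of [mu] leaves a value at [mu] that is not too small. *)
Lemma class_interpolating Q (E : C -> C -> Prop) (col : C -> nat) (i : nat) : 0 < Q ->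
  (forall mu, disk mu -> 2 * exp (- Q * (phi mu + 1)) <= c * (1 - Cmod mu)) ->
  (forall x y, E x y <-> Cmod (x - y)%C <= exp (- Q * (phi x + 1)) /\ Cmod (x - y)%C <= exp (- Q * (phi y + 1))) ->
  (forall x y, L x -> L y -> x <> y -> E x y -> col x <> col y) ->
  interpolating_sequence phi (fun z => L z /\ col z = i).
Proof.
  intros HQ HQ2 HE Hcol.
  assert (Hp := proj1 Hw). assert (HLd := proj1 HL).
  set (G := fun z => L z /\ col z = i).
  assert (HGL : forall z, G z -> L z) by (intros z [H _]; exact H).
  assert (HGd : forall z, G z -> disk z) by auto.
  assert (Hfar : forall x y, L x -> L y -> ~ E x y -> exp (- (2 * Q)) * exp (- Q * (phi x + phi y)) <= Cmod (x - y)%C).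
  { intros x y Hx Hy HnE. pose proof (Hp x (HLd x Hx)). pose proof (Hp y (HLd y Hy)).
    rewrite <- exp_plus. rewrite HE in HnE.
    destruct (Rle_lt_dec (Cmod (x - y)) (exp (- Q * (phi x + 1)))) as [H1|H1].
    - destruct (Rle_lt_dec (Cmod (x - y)) (exp (- Q * (phi y + 1)))) as [H2|H2]; [tauto|].
      eapply Rle_trans; [|apply Rlt_le, H2]. apply exp_le. nra.
    - eapply Rle_trans; [|apply Rlt_le, H1]. apply exp_le. nra. }
  assert (Hsep : separated phi G).
  { apply (separated_of_pair Hw G (exp (- (2 * Q))) Q HGd (exp_pos _)); [lra|].
    intros l m Hl Hm Hne. apply Hfar; auto. intros Hlm.
    apply (Hcol l m (HGL l Hl) (HGL m Hm) Hne Hlm). destruct Hl as [_ ->]. destruct Hm as [_ ->]. reflexivity. }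
  destruct (one_sided_bound Hw (exp (- (2 * Q))) Q (exp_pos _) ltac:(lra)) as [Q' [HQ' Hfar']].
  destruct (glue Hw G HGd Hsep) as [T0 [HT0 Hglue]].
  split; [apply (discrete_subset L); assumption|].
  intros w. split; [apply trace_A_seq, HGd|]. intros [A [Bw [HA [HBw HAw]]]].
  pose proof (pos_INR j) as Hj.
  assert (HD := proj1 (proj2 (proj2 (proj2 Hw)))). assert (Hk := proj1 (proj2 Hw)).
  (* The first term bounds below the product of distances to non-neighbours, the second is the cost
     of dividing by the factors at neighbours, whose weights are comparable to that of [mu]. *)
  set (Q1 := INR j * Q' + kap * (INR j * D)).
  assert (HQ1 : 0 <= Q1).
  { unfold Q1. assert (0 <= INR j * Q') by (apply Rmult_le_pos; lra).
    assert (0 <= INR j * D) by (apply Rmult_le_pos; lra). nra. }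
  (* [Bw] is the growth of the data, [Q1] the loss in the division, and [T0] the decay needed for
     gluing. *)
  set (T := T0 + Bw + Q1). assert (HT : 0 < T) by (unfold T; lra).
  destruct (uniform_trace Hw L HLd j T HT Htr) as [M [B [HM [HB HU]]]].
  destruct (div_list Hw j B HB) as [B' [K' [HB' [HK' Hdiv]]]].
  set (M' := A * (2 * exp Q1) * (M * K')).
  assert (Hfam : forall mu, exists F, G mu ->
     hgrow phi (M' * exp (- T0 * phi mu)) B' F /\ (forall y, G y -> y <> mu -> F y = 0%C) /\ F mu = w mu).
  { intros mu. destruct (classic (G mu)) as [Hmu|Hmu]; [|exists (fun _ => 0%C); intros; contradiction].
    assert (HLmu := HGL mu Hmu). assert (Hdmu := HGd mu Hmu). assert (Hpm := Hp mu Hdmu).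
    destruct (near_minimizer_ex mu HLmu) as [l Hl].
    destruct (HU _ (single_in_unit_ball T mu l HT HLmu Hl)) as [f [Hf1 Hf2]].
    destruct Hl as [[Hl1 [Hl2 Hl3]] _].
    set (b := fun x => if excluded_middle_informative (E mu x) then true else false).
    assert (Hb : forall x, b x = true <-> E mu x).
    { intros x. unfold b. destruct (excluded_middle_informative (E mu x)); split; intros; try assumption; try reflexivity; try discriminate; contradiction. }
    (* Only neighbours of [mu] are divided out: dividing by the factor at a distant point could
       remove a zero at a point of the same colour. *)
    set (S := filter b l). set (N := filter (fun x => negb (b x)) l).
    assert (HS : forall x, In x S -> In x l /\ E mu x).
    { intros x Hx. apply filter_In in Hx. rewrite Hb in Hx. exact Hx. }
    assert (HN : forall x, In x N -> In x l /\ ~ E mu x).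
    { intros x Hx. apply filter_In in Hx. destruct Hx as [H1 H2]. split; [assumption|].
      intros H3. apply Hb in H3. rewrite H3 in H2. discriminate. }
    assert (HSlen : (length S <= j)%nat) by (pose proof (filter_length_le b l); unfold S; lia).
    assert (HNlen : (length N <= j)%nat) by (pose proof (filter_length_le (fun x => negb (b x)) l); unfold N; lia).
    destruct (Hdiv f M S HSlen (NoDup_filter _ Hl1)) as [g [Hg1 Hg2]]; [|assumption|].
    { intros x Hx. destruct (HS x Hx) as [Hxl _]. destruct (Hl2 x Hxl) as [HLx Hxm].
      split; [apply HLd, HLx|]. rewrite Hf2 by assumption. apply ind_neq, Hxm. }
    assert (HmuS : ~ In mu S) by (intros H; destruct (Hl2 mu (proj1 (HS mu H))); congruence).
    (* The division removes the small distances from the product; only those to the points of [N]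
       remain, and they are bounded below. *)
    assert (Hgmu : Cmod (g mu) = exp (T * phi mu) * (Cmod (facl mu N) / 2)).
    { pose proof (Hg2 mu) as Hm. rewrite Hf2, ind_eq, zprod_facl in Hm by assumption.
      apply (f_equal Cmod) in Hm. rewrite Cmod_mult, Cmod_R in Hm.
      pose proof (exp_pos (T * phi mu)). pose proof (facl_pos mu l). pose proof (facl_pos mu S).
      rewrite Rabs_right in Hm by nra.
      rewrite (facl_filter mu b l), Cmod_mult in Hm. fold S N in Hm.
      apply Rmult_eq_reg_l with (Cmod (facl mu S)); [|lra]. rewrite <- Hm. field. }
    assert (HNlow : exp (- Q' * (phi mu + 1)) ^ j <= Cmod (facl mu N)).
    { apply facl_lower; [|intros x Hx|assumption].
      - split; [apply exp_nonneg|]. apply Rle_trans with (exp 0); [apply exp_le; nra|rewrite exp_0; lra].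
      - destruct (HN x Hx) as [H1 H2]. apply Hfar'; [assumption|]. apply Hfar; [assumption|apply Hl2, H1|assumption]. }
    assert (Hexpj : exp (- Q' * (phi mu + 1)) ^ j = exp (- (INR j * Q' * (phi mu + 1)))).
    { rewrite <- (exp_ln (exp (- Q' * (phi mu + 1)) ^ j)) by (apply pow_lt, exp_pos).
      rewrite ln_pow by apply exp_pos. rewrite ln_exp. f_equal. ring. }
    rewrite Hexpj in HNlow.
    pose proof (exp_pos (T * phi mu)) as HET.
    set (low := exp (T * phi mu) * (exp (- (INR j * Q' * (phi mu + 1))) / 2)).
    assert (Hlow0 : 0 < low) by (unfold low; pose proof (exp_pos (- (INR j * Q' * (phi mu + 1)))); nra).
    assert (Hlow : low <= Cmod (g mu)) by (rewrite Hgmu; unfold low; nra).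
    assert (Hgm0 : g mu <> 0%C) by (apply Cmod_gt_0; lra).
    exists (fun z => (w mu / g mu) * g z)%C. intros _. split; [|split].
    - apply (hgrow_le phi (Cmod (w mu / g mu) * (M * K' * exp (kap * lsum phi S))) B'); [assumption| |lra|apply hgrow_scal; assumption].
      assert (Hls : lsum phi S <= INR j * (D * (phi mu + 1))).
      { apply lsum_le; [apply Rmult_le_pos; lra| |assumption].
        intros x Hx. destruct (HS x Hx) as [_ HEx]. apply HE in HEx. destruct HEx as [HEx _].
        destruct (proj2 (proj2 (proj2 (proj2 (proj2 Hw)))) mu x Hdmu) as [_ [H _]]; [|lra].
        rewrite Cmod_sub_sym. specialize (HQ2 mu Hdmu). pose proof (exp_pos (- Q * (phi mu + 1))). lra. }
      rewrite Cmod_div by assumption.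
      assert (HMK : 0 <= M * K') by (apply Rmult_le_pos; lra).
      apply Rle_trans with (A * exp (Bw * phi mu) * / low * (M * K' * exp (kap * (INR j * (D * (phi mu + 1)))))).
      + apply Rmult_le_compat.
        * apply Rmult_le_pos; [apply Cmod_ge_0|apply Rinv_nonneg; lra].
        * apply Rmult_le_pos; [assumption|apply exp_nonneg].
        * apply Rmult_le_compat; [apply Cmod_ge_0|apply Rinv_nonneg; lra|apply HAw, Hmu|apply Rinv_le_contravar; assumption].
        * apply Rmult_le_compat_l; [assumption|]. apply exp_le, Rmult_le_compat_l; lra.
      + assert (Hlinv : / low = 2 * exp (- (T * phi mu) + INR j * Q' * (phi mu + 1))).
        { unfold low. rewrite exp_plus, !exp_Ropp. field. split; apply Rgt_not_eq, exp_pos. }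
        rewrite Hlinv.
        replace (A * exp (Bw * phi mu) * (2 * exp (- (T * phi mu) + INR j * Q' * (phi mu + 1))) *
          (M * K' * exp (kap * (INR j * (D * (phi mu + 1)))))) with
          (A * 2 * (M * K') * (exp (Bw * phi mu) * (exp (- (T * phi mu) + INR j * Q' * (phi mu + 1)) * exp (kap * (INR j * (D * (phi mu + 1))))))) by ring.
        rewrite <- !exp_plus. unfold M'.
        replace (A * (2 * exp Q1) * (M * K') * exp (- T0 * phi mu)) with (A * 2 * (M * K') * (exp Q1 * exp (- T0 * phi mu))) by ring.
        rewrite <- exp_plus. apply Rmult_le_compat_l; [apply Rmult_le_pos; lra|]. apply Req_le. f_equal.
        unfold T, Q1. ring.
    (* A point of the same colour as [mu] is no neighbour of [mu], so it is not among the zeros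
       divided out. *)
    - intros y Hy Hne. assert (Hfy := Hg2 y). rewrite Hf2, ind_neq in Hfy by auto.
      symmetry in Hfy. destruct (Cmult_zero _ _ Hfy) as [E0|E0]; [|rewrite E0; ring].
      exfalso. apply (zprod_nz y S); [|assumption]. intros Hin. destruct (HS y Hin) as [_ HEy].
      apply (Hcol mu y HLmu (HGL y Hy)); [congruence|assumption|].
      destruct Hmu as [_ ->]. destruct Hy as [_ ->]. reflexivity.
    - field. assumption. }
  destruct (functional_choice _ Hfam) as [Fam HFam].
  destruct (Hglue M' B' Fam HB') as [f [M2 [Hf [_ Hf2]]]]; [intros; apply HFam; assumption|].
  exists f. split; [apply (hgrow_A_fun phi M2 B'); assumption|].
  intros l Hl. rewrite (Hf2 l l Hl (HGd l Hl)); [apply HFam, Hl|].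
  intros m Hm Hne. apply HFam; auto.
Qed.

(** The colouring needs only an injective numbering of [L], so [code] is applied with the isolation
    distance of each point, which is not controlled by the weight. S j colours suffice because
    [cluster_bound] leaves each point at most [j] neighbours. *)
Lemma interpolating_partition : union_of_interpolating phi L (S j).
Proof.
  destruct cluster_bound as [Q [HQ [HQ2 Hcl]]].
  set (E := fun x y => Cmod (x - y)%C <= exp (- Q * (phi x + 1)) /\ Cmod (x - y)%C <= exp (- Q * (phi y + 1))).
  assert (Hs : forall z, exists s, L z -> 0 < s <= 1 /\ forall y, L y -> y <> z -> s <= Cmod (z - y)%C).
  { intros z. destruct (classic (L z)) as [Hz|Hz]; [|exists 0; intros; contradiction].
    destruct (isolated L z HL (proj1 HL z Hz)) as [e He]. exists e. auto. }
  destruct (functional_choice _ Hs) as [s Hs2].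
  destruct (greedy_colouring C L (code s) E (S j)) as [col [Hcol1 Hcol2]].
  - intros x y Hx Hy. apply (code_inj s L (proj1 HL) (fun z Hz => proj1 (Hs2 z Hz)) x y Hx Hy).
    intros Hne. apply Hs2; auto.
  - intros x y [H1 H2]. split; rewrite Cmod_sub_sym; assumption.
  - intros x Hx [v [H1 [H2 H3]]]. apply (Hcl x Hx). exists v. split; [assumption|]. split; [assumption|].
    intros y Hy. destruct (H3 y Hy) as [H4 [H5 [H6 _]]]. auto.
  - exists (fun i z => L z /\ col z = i). split.
    + intros i _. apply (class_interpolating Q E); auto. intros x y. reflexivity.
    + intros z. split.
      * intros Hz. exists (col z). auto.
      * intros [i [_ [Hz _]]]. assumption.
Qed.
End Necessity.

Theorem mainTheorem2 (phi : C -> R) (L : C -> Prop) (n : nat)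
  (Hphi : weight phi) (HL : discrete_sequence L) (Hn : (1 <= n)%nat) :
  (forall w : C -> C, trace phi L w <-> X_space phi L (n - 1) w) <->
  union_of_interpolating phi L n.
Proof.
  destruct (weight_wconst phi Hphi) as [kap [c [D Hw]]].
  split.
  - intros H. destruct n as [|j]; [lia|].
    replace (S j - 1)%nat with j in H by lia.
    apply (interpolating_partition phi kap c D Hw L HL j). intros w. apply H.
  - apply union_interpolation; assumption.
Qed.
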